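(* Let $N\ge1$, $a\in\{-1/2,1/2\}$, let $E\in C^1[-1,1]$ with $E(1)\ne0$, let $P^{(N),a}$ be the (possibly signed) measure on $\mathbb{J}^{(N),a}$ associated with $E$, and let $\varphi_t(x)=e^{t(x-1)}$. Then for every $t\ge0$, \[P^{(N),a}\,e^{tQ_{N,a}}=P^{(N),a}\,A^{\varphi_t}_{N,a},\] where measures are regarded as row vectors acted on by the matrices from the right.
   Context: Polynomials: for $x=\cos\theta$, $\mathsf{J}^{(-1/2,-1/2)}_s(\cos\theta)=\cos(s\theta)$, $\mathsf{J}^{(1/2,-1/2)}_s(\cos\theta)=\sin((s+\frac12)\theta)/\sin(\theta/2)$; $W^{(-1/2,-1/2)}(0)=1$, $W^{(-1/2,-1/2)}(s)=2$ ($s>0$), $W^{(1/2,-1/2)}(s)=1$. $\mathbb{J}_n$ = integer sequences $\lambda_1\ge\dots\ge\lambda_n\ge0$; $\mathbb{J}_0=\{\emptyset\}$. Dimensions: $\dim_{SO(2n+1)}\lambda=\prod_{i<j}\frac{l_i^2-l_j^2}{m_i^2-m_j^2}\prod_i\frac{l_i}{m_i}$ ($l_i=\lambda_i+n-i+\frac12$, $m_i=n-i+\frac12$), $\dim_{SO(2n)}\lambda=\prod_{i<j}\frac{l_i^2-l_j^2}{m_i^2-m_j^2}$ ($l_i=\lambda_i+n-i$, $m_i=n-i$). Write $SO(2n+1/2+b)$ for $SO(2n+1)$ if $b=1/2$ and $SO(2n)$ if $b=-1/2$. One-level matrices: for $\psi\in C^1[-1,1]$, $I^\psi_b(l,i)=\frac{W^{(b,-1/2)}(i)}{\pi}\int_{-1}^1\mathsf{J}^{(b,-1/2)}_i(x)\mathsf{J}^{(b,-1/2)}_l(x)\psi(x)(1-x)^b(1+x)^{-1/2}dx$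 and, on $\mathbb{J}_n\times\mathbb{J}_n$, $T^\psi_{n,b}(\mu,\lambda)=\det[I^\psi_b(\mu_i-i+n,\lambda_j-j+n)]_{i,j=1}^n\frac{\dim_{SO(2n+1/2+b)}\lambda}{\dim_{SO(2n+1/2+b)}\mu}$ ($T^\psi_{0,1/2}=1$). Link matrices: with $\mathcal{T}(x,y)=0$ if $x<y$, $=1$ if $x\ge y=0$, $=2$ if $x\ge y>0$, and $\phi(x,y)=1$ if $x>y$, $0$ otherwise: $T^{n,+}_{n,-}(\mu,\lambda)=\frac{\dim_{SO(2n)}\lambda}{\dim_{SO(2n+1)}\mu}\det[\mathcal{T}(\mu_i-i+n,\lambda_j-j+n)]_{i,j=1}^n$ for $\mu,\lambda\in\mathbb{J}_n$; $T^{n,-}_{n-1,+}(\mu,\lambda)=\frac{\dim_{SO(2n-1)}\lambda}{\dim_{SO(2n)}\mu}\det[\phi(\mu_i-i+n,\lambda_j-j+n-1)]_{i,j=1}^n$ for $\mu\in\mathbb{J}_n,\lambda\in\mathbb{J}_{n-1}$, with the convention $\lambda_n=0$. Paths: levels $(n,b)$, $n\ge1$, $b\in\{\pm\frac12\}$, ordered by $2n+b$: $\ell_1=(1,-\frac12),\ell_2=(1,\frac12),\ell_3=(2,-\frac12),\dots$; $(N,a)=\ell_M$, $M=2N+a-\frac12$. Interlacing: for $\lambda\in\mathbb{J}_n$ at level $(n,-\frac12)$ and $\mu\in\mathbb{J}_n$ at level $(n,\frac12)$, $\lambda\prec\mu$ iff $0\le\lambda_n\le\mu_n\le\lambda_{n-1}\le\dots\le\lambda_1\le\mu_1$;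 for $\lambda\in\mathbb{J}_n$ at $(n,\frac12)$ and $\mu\in\mathbb{J}_{n+1}$ at $(n+1,-\frac12)$, $\lambda\prec\mu$ iff $\mu_{n+1}\le\lambda_n\le\mu_n\le\dots\le\lambda_1\le\mu_1$. $\mathbb{J}^{(N),a}$ is the set of sequences $\lambda^{\ell_1}\prec\lambda^{\ell_2}\prec\dots\prec\lambda^{\ell_M}$ with $\lambda^{(n,b)}\in\mathbb{J}_n$. For $i\ge2$ let $\Lambda_i=T^{n,+}_{n,-}$ if $\ell_i=(n,\frac12)$ and $\Lambda_i=T^{n,-}_{n-1,+}$ if $\ell_i=(n,-\frac12)$, and $\Delta_i=\Lambda_iT^{\psi}_{\ell_{i-1}}$ (writing $T^\psi_{(n,b)}=T^\psi_{n,b}$). Define $A^\psi_{N,a}(\lambda,\mu)=T^\psi_{\ell_1}(\lambda^{\ell_1},\mu^{\ell_1})\prod_{i=2}^M\frac{T^\psi_{\ell_i}(\lambda^{\ell_i},\mu^{\ell_i})\Lambda_i(\mu^{\ell_i},\mu^{\ell_{i-1}})}{\Delta_i(\lambda^{\ell_i},\mu^{\ell_{i-1}})}$ if all $\Delta_i(\lambda^{\ell_i},\mu^{\ell_{i-1}})\ne0$, and $0$ otherwise. Measure: $P_{N,a}(\lambda)=C_{N,a}E(1)^{-N}\det[f_j^{(N,a)}(\lambda_i-i+N)]_{i,j=1}^N\dim_{SO(2N+1/2+a)}\lambda$, with $f_j^{(N,a)}(k)=\frac{W^{(a,-1/2)}(k)}{\pi}\int_{-1}^1x^{N-j}E(x)\mathsf{J}^{(a,-1/2)}_k(x)(1-x)^a(1+x)^{-1/2}dx$,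 $C_{N,1/2}=2^{N(N-1)/2}$, $C_{N,-1/2}=2^{(N-1)(N-2)/2}$; and $P^{(N),a}(\lambda)=P_{N,a}(\lambda^{\ell_M})\prod_{i=2}^M\Lambda_i(\lambda^{\ell_i},\lambda^{\ell_{i-1}})$. Generator $Q_{N,a}$ on $\mathbb{J}^{(N),a}$: for $\lambda\ne\mu$, $Q_{N,a}(\lambda,\mu)=1$ in Case 1a, $=\frac12$ in Case 1b or Case 2, $=0$ otherwise; diagonal entries make rows sum to $0$. Case 1: there are levels $\ell_p\le\ell_q$ with $\ell_p=(n_0,b_0)$, an index $k\le n_0$ and an integer $c$ such that $\lambda^{\ell}_k=c$, $\mu^{\ell}_k=c+1$ for all levels $\ell_p\le\ell\le\ell_q$, and all other entries of $\lambda$ and $\mu$ coincide. Case 1a: Case 1 with $b_0=-\frac12$, $k=n_0$, $c=0$ (a particle at the wall). Case 1b: Case 1 but not 1a. Case 2: there are levels $\ell_p\le\ell_q$, $\ell_p=(n_0,b_0)$, an index $k\le n_0$ and an integer $c$ such that for every level $\ell_p\le\ell=(n,b)\le\ell_q$, with $d=2(n-n_0)+b-b_0$, $\lambda^{\ell}_{k+d}=c$ and $\mu^{\ell}_{k+d}=c-1$, and all other entries coincide. ($Q_{N,a}$ generates the particle dynamics with independent rate-$\frac12$ left/right jumps, blocking, pushing and reflection at the wall.) *)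

(* Defs.v *)
From HB Require Import structures.
From mathcomp Require Import all_boot all_order all_algebra.
From mathcomp Require Import all_classical all_reals all_analysis.
Set Implicit Arguments. Unset Strict Implicit. Unset Printing Implicit Defensive.
Import Order.TTheory GRing.Theory Num.Theory.
Import numFieldNormedType.Exports.
Local Open Scope classical_set_scope.
Local Open Scope ring_scope.

(* Convention: a parameter b : bool encodes b = +1/2 (true) or b = -1/2 (false). *)

Section Defs.
Variable R : realType.

Definition halfR (b : bool) : R := if b then 1 / 2 else - (1 / 2).

Definition Wt (b : bool) (s : nat) : R :=
  if b then 1 else (if s == 0%N then 1 else 2).

Definition Jac (b : bool) (s : nat) (x : R) : R :=
  let th := acos x in
  if b then sin ((s%:R + 1 / 2) * th) / sin (th / 2) else cos (s%:R * th).

Definition wgt (b : bool) (x : R) : R :=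
  powR (1 - x) (halfR b) * powR (1 + x) (- (1 / 2)).

Definition int11 (f : R -> R) : R :=
  \int[@lebesgue_measure R]_(x in `[(-1)%R, 1%R]) f x.

Definition Iint (b : bool) (psi : R -> R) (l i : nat) : R :=
  Wt b i / pi * int11 (fun x => Jac b i x * Jac b l x * psi x * wgt b x).

Definition is_part (n : nat) (l : seq nat) : Prop :=
  size l = n /\ sorted geq l.

(* lambda_i - i + n  (i is the 0-based index, i.e. the 1-based index is i+1) *)
Definition posn (l : seq nat) (n i : nat) : nat := nth 0%N l i + (n - i.+1).
Definition posz (l : seq nat) (n i : nat) : int :=
  (nth 0%N l i)%:Z + n%:Z - (i.+1)%:Z.

Definition lB (n : nat) (l : seq nat) (i : nat) : R := (nth 0%N l i)%:R + (n - i.+1)%:R + 1 / 2.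
Definition mB (n i : nat) : R := (n - i.+1)%:R + 1 / 2.
Definition lD (n : nat) (l : seq nat) (i : nat) : R := (nth 0%N l i)%:R + (n - i.+1)%:R.
Definition mD (n i : nat) : R := (n - i.+1)%:R.

Definition dimB (n : nat) (l : seq nat) : R :=
  (\prod_(i < n) \prod_(j < n | (i < j)%N)
     (((lB n l i) ^+ 2 - (lB n l j) ^+ 2) / ((mB n i) ^+ 2 - (mB n j) ^+ 2)))
  * \prod_(i < n) (lB n l i / mB n i).

Definition dimD (n : nat) (l : seq nat) : R :=
  \prod_(i < n) \prod_(j < n | (i < j)%N)
     (((lD n l i) ^+ 2 - (lD n l j) ^+ 2) / ((mD n i) ^+ 2 - (mD n j) ^+ 2)).

Definition dimSO (b : bool) (n : nat) (l : seq nat) : R :=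
  if b then dimB n l else dimD n l.

Definition Tone (b : bool) (psi : R -> R) (n : nat) (mu lam : seq nat) : R :=
  \det (\matrix_(i < n, j < n) Iint b psi (posn mu n i) (posn lam n j))
  * dimSO b n lam / dimSO b n mu.

Definition calT (x y : nat) : R :=
  if (x < y)%N then 0 else if y == 0%N then 1 else 2.

Definition Tplus (n : nat) (mu lam : seq nat) : R :=
  dimD n lam / dimB n mu *
  \det (\matrix_(i < n, j < n) calT (posn mu n i) (posn lam n j)).

(* T^{n,-}_{n-1,+}(mu,lambda), lambda in J_{n-1}, convention lambda_n = 0
   (nth with default 0) *)
Definition Tminus (n : nat) (mu lam : seq nat) : R :=
  dimB n.-1 lam / dimD n mu *
  \det (\matrix_(i < n, j < n)
          (if (posz lam n j - 1 < posz mu n i)%R then (1 : R) else 0)).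

(* Levels, 0-based: level k is (lvn k, lvb k); k = 0 is (1,-1/2),
   k = 1 is (1,1/2), k = 2 is (2,-1/2), ... *)
Definition lvn (k : nat) : nat := k./2.+1.
Definition lvb (k : nat) : bool := odd k.
(* number of levels M = 2N + a - 1/2 *)
Definition nlev (N : nat) (a : bool) : nat := if a then (2 * N)%N else (2 * N).-1.

Definition interlace (k : nat) (lam mu : seq nat) : Prop :=
  let n := lvn k in
  if lvb k then
    (forall i, (i < n)%N ->
       (nth 0%N mu i.+1 <= nth 0%N lam i)%N /\ (nth 0%N lam i <= nth 0%N mu i)%N)
  else
    (forall i, (i < n)%N ->
       (nth 0%N lam i <= nth 0%N mu i)%N /\
       ((0 < i)%N -> (nth 0%N mu i <= nth 0%N lam i.-1)%N)).

Definition JN (N : nat) (a : bool) : set (seq (seq nat)) :=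
  [set s | size s = nlev N a /\
     (forall k, (k < nlev N a)%N -> is_part (lvn k) (nth [::] s k)) /\
     (forall k, (k.+1 < nlev N a)%N ->
        interlace k (nth [::] s k) (nth [::] s k.+1))].

(* signed sums over (countable) sets: sum of positive part minus sum of
   negative part, as in MathComp-Analysis (cf. esumB) *)
Definition ssumE (T : choiceType) (D : set T) (f : T -> R) : \bar R :=
  (\esum_(x in D) (EFin \o f)^\+ x - \esum_(x in D) (EFin \o f)^\- x)%E.
Definition rsum (T : choiceType) (D : set T) (f : T -> R) : R := fine (ssumE D f).

(* Lambda_i for level k >= 1 (0-based): from level k to level k-1 *)
Definition Lam (k : nat) (x y : seq nat) : R :=
  if lvb k then Tplus (lvn k) x y else Tminus (lvn k) x y.

Definition Tlev (psi : R -> R) (k : nat) : seq nat -> seq nat -> R :=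
  Tone (lvb k) psi (lvn k).

Definition Delta (psi : R -> R) (k : nat) (x y : seq nat) : R :=
  rsum [set kap | is_part (lvn k.-1) kap] (fun kap => Lam k x kap * Tlev psi k.-1 kap y).

Definition Amat (psi : R -> R) (N : nat) (a : bool) (lam mu : seq (seq nat)) : R :=
  let M := nlev N a in
  let L k := nth [::] lam k in
  let U k := nth [::] mu k in
  if `[< forall k, (0 < k < M)%N -> Delta psi k (L k) (U k.-1) != 0 >] then
    Tlev psi 0 (L 0%N) (U 0%N) *
    \prod_(1 <= k < M) (Tlev psi k (L k) (U k) * Lam k (U k) (U k.-1)
                          / Delta psi k (L k) (U k.-1))
  else 0.

Definition fcoef (E : R -> R) (N : nat) (a : bool) (j k : nat) : R :=
  Wt a k / pi * int11 (fun x => x ^+ (N - j.+1) * E x * Jac a k x * wgt a x).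

Definition CNa (N : nat) (a : bool) : R :=
  if a then 2 ^+ ((N * N.-1) %/ 2) else 2 ^+ ((N.-1 * N.-2) %/ 2).

Definition Ptop (E : R -> R) (N : nat) (a : bool) (l : seq nat) : R :=
  CNa N a * (E 1) ^- N *
  \det (\matrix_(i < N, j < N) fcoef E N a j (posn l N i)) * dimSO a N l.

Definition Pmeas (E : R -> R) (N : nat) (a : bool) (lam : seq (seq nat)) : R :=
  let M := nlev N a in
  Ptop E N a (nth [::] lam M.-1) *
  \prod_(1 <= k < M) Lam k (nth [::] lam k) (nth [::] lam k.-1).

Definition ent (s : seq (seq nat)) (j m : nat) : int := (nth 0%N (nth [::] s j) m)%:Z.

Definition Case1w (N : nat) (a : bool) (lam mu : seq (seq nat)) (p q k : nat) (c : int) : Prop :=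
  (p <= q < nlev N a)%N /\ (0 < k <= lvn p)%N /\
  forall j m, (j < nlev N a)%N -> (m < lvn j)%N ->
    if (p <= j <= q)%N && (m == k.-1) then ent lam j m = c /\ ent mu j m = c + 1
    else ent lam j m = ent mu j m.

Definition Case1 N a lam mu : Prop := exists p q k c, Case1w N a lam mu p q k c.
Definition Case1a N a lam mu : Prop :=
  exists p q k c, Case1w N a lam mu p q k c /\ lvb p = false /\ k = lvn p /\ c = 0.

Definition Case2 (N : nat) (a : bool) (lam mu : seq (seq nat)) : Prop :=
  exists (p q k : nat) (c : int),
  (p <= q < nlev N a)%N /\ (0 < k <= lvn p)%N /\
  (forall j, (p <= j <= q)%N -> (k + (j - p) <= lvn j)%N) /\
  forall j m, (j < nlev N a)%N -> (m < lvn j)%N ->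
    if (p <= j <= q)%N && (m == k.-1 + (j - p))%N then ent lam j m = c /\ ent mu j m = c - 1
    else ent lam j m = ent mu j m.

Definition Qoff (N : nat) (a : bool) (lam mu : seq (seq nat)) : R :=
  if `[< Case1a N a lam mu >] then 1
  else if `[< Case1 N a lam mu \/ Case2 N a lam mu >] then 1 / 2 else 0.

Definition Qgen (N : nat) (a : bool) (lam mu : seq (seq nat)) : R :=
  if lam == mu then - rsum [set nu | JN N a nu /\ nu <> lam] (fun nu => Qoff N a lam nu)
  else Qoff N a lam mu.

Fixpoint Qpow (N : nat) (a : bool) (k : nat) (lam mu : seq (seq nat)) : R :=
  match k with
  | 0%N => (lam == mu)%:R
  | k'.+1 => rsum (JN N a) (fun nu => Qgen N a lam nu * Qpow N a k' nu mu)
  end.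

Definition expQ (N : nat) (a : bool) (t : R) (lam mu : seq (seq nat)) : R :=
  limn (series (fun k => t ^+ k / (k`!)%:R * Qpow N a k lam mu)).

Definition phit (t : R) (x : R) : R := expR (t * (x - 1)).

Definition C1on11 (E : R -> R) : Prop :=
  exists E' : R -> R,
    {within `[(-1)%R, 1%R], continuous E} /\ {within `[(-1)%R, 1%R], continuous E'} /\
    forall x : R, -1 < x < 1 -> is_derive x 1 E (E' x).

End Defs.

(* Main.v *)
(* Both sides equal the measure Pmeas associated with x |-> E x * exp (t (x - 1)).

   In the basis J_k, multiplication by x - 1 is the generator of a nearest-neighbour walk.
   Hence the determinants of one-particle moments of exp (t (x - 1)) solve a system of
   linear differential equations on partitions; a Taylor expansion with a weight that is
   exponential in the positions identifies its solutions, and the determinants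
   det I (the matrices T) are its transition matrix, so they are nonnegative.

   For A: the links Lambda are determinants of 0-1 matrices, hence indicators of
   interlacing up to explicit weights, and they intertwine the generators of consecutive
   levels. Summing over the levels from the bottom, each Delta cancels and only T at the
   top level remains, which moves the top marginal of E to that of E * exp (t (x - 1)).

   For Q: by induction on the number of levels, the same intertwining shows that the
   conditional weights of an array given its top level are preserved by Q, so that Pmeas
   of E * exp (t (x - 1)) solves the forward equation of Q, and the same Taylor argument
   applies. *)

Require Import Defs.
From HB Require Import structures.
From mathcomp Require Import all_boot all_order all_algebra perm.
From mathcomp Require Import all_classical all_reals all_analysis.
From mathcomp Require Import finmap measurable_realfun zify ring lra.
Import Order.TTheory GRing.Theory Num.Theory.
Import numFieldNormedType.Exports.
Local Open Scope classical_set_scope.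
Local Open Scope ring_scope.
Set Implicit Arguments. Unset Strict Implicit. Unset Printing Implicit Defensive.

(** * Integration against the arcsine weight *)

(** [E] is only C^1, so nothing decays a priori: the measure is controlled merely by a weight that
    grows exponentially in the positions, and the absolute convergence of both sums has to be proved
    as well. It follows from the bounded range and bounded rates of the jumps. The generator
    multiplies such a weight by at most a constant A, so the n-th Taylor remainder is at most a
    multiple of (A t)^n / n!, and so are the tails of the sums.

    The delicate point for A is a vanishing Delta. The quotient is then 0 by convention, and the
    telescoping survives only because its numerator T Lambda vanishes too. That numerator is
    nonnegative, being made of transition determinants and indicators, and it is at most Delta. The
    inequality compares one summand of T Lambda with Lambda T; it is obtained from the positivity of
    solutions of the upper equation, so that the infinite sum T Lambda never has to be formed.

    For Q the weights W are essential: they make the one-particle walks reversible, and this lets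
    the intertwining of functions be used for measures. *)

Section Improper.
Variable R : realType.
Notation mu := (@lebesgue_measure R).
Implicit Types f F : R -> R.

(** [f] may blow up at both ends, as the arcsine density does. [F] minus the indefinite integral is
    continuous up to the ends and has zero derivative inside, so the mean value theorem applies. *)
Lemma improper_FTC f F (a b : R) : a < b ->
  mu.-integrable `[a, b] (EFin \o f) ->
  (forall x, a < x < b -> {for x, continuous f}) ->
  {within `[a, b], continuous F} ->
  (forall x, a < x < b -> is_derive x 1 F (f x)) ->
  (\int[mu]_(x in `[a, b]) f x)%R = F b - F a.
Proof.
move=> ab intf cf cF dF.
pose G x := (\int[mu]_(t in `[a, x]) f t)%R.
have cG : {within `[a, b], continuous G}.
  exact: (parameterized_integral_continuous (ltW ab) intf).
have dG x : a < x < b -> is_derive x 1 G (f x).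
  move=> /[dup] xab /andP[ax xb].
  have [dG GE] := continuous_FTC1_closed xb intf ax (cf _ xab).
  by apply: DeriveDef; [exact: dG|rewrite -derive1E GE].
have [||c _] := @MVT R (F \- G) (cst 0) a b ab.
- move=> x; rewrite in_itv /= => xab.
  have := @is_deriveB _ _ _ _ _ _ _ _ _ (dF _ xab) (dG _ xab).
  by rewrite subrr.
- by move=> x; apply: continuousB; [exact: cF|exact: cG].
rewrite /= mul0r /G set_itv1 Rintegral_set1 subr0 => /eqP.
by rewrite subr_eq0 subr_eq => /eqP ->; rewrite addrAC subrr add0r.
Qed.

(** On compact subintervals the integral is an increment of the monotone [F], hence at most
    [F b - F a]; monotone convergence carries this bound to the open interval. *)
Lemma improper_integrable f F (a b : R) : a < b ->
  (forall x, a < x < b -> 0 <= f x) ->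
  (forall x, a < x < b -> {for x, continuous f}) ->
  {within `[a, b], continuous F} ->
  (forall x, a < x < b -> is_derive x 1 F (f x)) ->
  mu.-integrable `[a, b] (EFin \o f).
Proof.
move=> ab f0 cf cF dF.
have mf : measurable_fun `]a, b[ f.
  apply: open_continuous_measurable_fun; first exact: interval_open.
  by move=> x; rewrite classical_sets.inE /= in_itv /=; exact: cf.
have mf' : measurable_fun `[a, b] f.
  by apply/measurable_fun_itv_obnd_cbndP/measurable_fun_itv_bndo_bndcP.
(* With denominator n + 2 the interval is never reversed: for n = 0 both ends are the midpoint. *)
pose c (n : nat) := a + (b - a) / n.+2%:R; pose d (n : nat) := b - (b - a) / n.+2%:R.
have ba0 : 0 < b - a by rewrite subr_gt0.
have e0 (n : nat) : 0 < (b - a) / n.+2%:R by rewrite divr_gt0.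
have e2 (n : nat) : (b - a) / n.+2%:R <= (b - a) / 2.
  by rewrite ler_pM2l// lef_pV2 ?posrE// ler_nat.
have acn n : a < c n by rewrite ltrDl.
have dnb n : d n < b by rewrite ltrBlDr ltrDl.
have cd n : c n <= d n.
  by rewrite /c /d; move: (e2 n); set z := _ / n.+2%:R => ?; lra.
have sub n (x : R) : c n <= x <= d n -> a < x < b.
  move=> /andP[cx xd]; rewrite (lt_le_trans (acn n) cx)/=.
  exact: le_lt_trans xd (dnb n).
have wf n : {within `[c n, d n], continuous f}.
  by apply: continuous_in_subspaceT => x; rewrite classical_sets.inE /= in_itv /= => /sub; exact: cf.
have iE n : mu.-integrable `[c n, d n] (EFin \o f).
  by apply: continuous_compact_integrable => //; exact: segment_compact.
have ndF x y : a <= x -> x <= y -> y <= b -> F x <= F y.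
  apply: ger0_derive1_ndecr => //.
    by move=> z; rewrite in_itv/= => /dF[].
  by move=> z; rewrite in_itv/= => zab; rewrite derive1E (@derive_val _ _ _ _ _ _ _ (dF _ zab)) f0.
have EI n : (\int[mu]_(x in `[c n, d n]) (f x)%:E <= (F b - F a)%:E)%E.
  have [cdn|cdn] := ltP (c n) (d n); last first.
    have -> : c n = d n by apply/le_anti; rewrite cd cdn.
    by rewrite set_itv1 integral_set1 lee_fin subr_ge0 ndF// ltW.
  have H : (\int[mu]_(x in `[c n, d n]) f x)%R = F (d n) - F (c n).
    apply: improper_FTC => //.
    - by move=> x /andP[/ltW ? /ltW ?]; apply/cf/(sub n)/andP.
    - by apply: continuous_subspaceW cF => x /=; rewrite !in_itv/= => /sub/andP[/ltW -> /ltW ->].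
    - by move=> x /andP[/ltW ? /ltW ?]; apply/dF/(sub n)/andP.
  have fn : (\int[mu]_(x in `[c n, d n]) (f x)%:E)%E \is a fin_num.
    by apply: integrable_fin_num => //; exact: iE.
  rewrite -(fineK fn) lee_fin; move: H; rewrite /Rintegral => ->.
  by rewrite lerB// ndF ?lexx// ltW// ?(lt_trans (acn n))// ?(lt_trans cdn).
apply/integrableP; split; first exact/measurable_EFinP.
have Un : \bigcup_n `[c n, d n]%classic = `]a, b[%classic.
  apply/seteqP; split=> x /=; rewrite in_itv/=.
    by move=> [n _] /=; rewrite in_itv/=; exact: sub.
  move=> /andP[ax xb]; pose e := Num.min (x - a) (b - x).
  have e_gt0 : 0 < e by rewrite lt_min !subr_gt0 ax xb.
  have [k kP] : exists k : nat, (b - a) / e < k%:R.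
    exists (Num.truncn ((b - a) / e)).+1; exact: truncnS_gt.
  exists k => //=; rewrite in_itv/=.
  have ke : (b - a) / k.+2%:R <= e.
    rewrite ler_pdivrMr// mulrC -ler_pdivrMr// (le_trans (ltW kP))// ler_nat.
    by rewrite leqW.
  rewrite /c /d.
  have e1 : e <= x - a by rewrite /e ge_min lexx.
  have e3 : e <= b - x by rewrite /e ge_min lexx orbT.
  by move: ke; set z := _ / _ => ?; apply/andP; split; lra.
have ndE : nondecreasing_seq (fun n => `[c n, d n]%classic).
  apply/nondecreasing_seqP => n; apply/subsetPset => x /=; rewrite !in_itv/=.
  have : (b - a) / n.+3%:R <= (b - a) / n.+2%:R.
    by rewrite ler_pM2l// lef_pV2 ?posrE// ler_nat.
  rewrite /c /d; set z := _ / n.+2%:R; set w := _ / n.+3%:R => wz /andP[h1 h2].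
  by apply/andP; split; lra.
have cvI : (\int[mu]_(x in `[c n, d n]) (f x)%:E)%E @[n --> \oo] -->
    (\int[mu]_(x in `]a, b[) (f x)%:E)%E.
  rewrite -Un; apply: (@ge0_nondecreasing_set_cvg_integral _ (measurableTypeR R) R (fun n => `[c n, d n]%classic) (EFin \o f) mu ndE).
    by move=> n; exact: measurable_itv.
    by move=> n; apply: (measurable_int mu); exact: iE.
  by move=> n x /=; rewrite in_itv/= lee_fin => /sub; exact: f0.
have : (\int[mu]_(x in `]a, b[) (f x)%:E <= (F b - F a)%:E)%E.
  rewrite -(cvg_lim _ cvI)//; apply: lime_le; first by apply/cvg_ex; eexists; exact: cvI.
  by apply: nearW => n; exact: EI.
move=> intle; apply: le_lt_trans (ltry (F b - F a)); apply: le_trans intle.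
rewrite integral_itv_bndoo; last first.
  by apply: measurableT_comp => //; exact/measurable_EFinP.
rewrite le_eqVlt; apply/orP; left; apply/eqP.
by apply: eq_integral => x; rewrite classical_sets.inE/= in_itv/= => /f0 fx0; rewrite /= ger0_norm.
Qed.
End Improper.

(** * Chebyshev polynomials and the arcsine integral *)

Section Chebyshev.
Variable R : realType.
Notation mu := (@lebesgue_measure R).
Implicit Types (b : bool) (k : nat) (x : R) (f g : R -> R).

Definition cont11 (f : R -> R) := {within `[(-1), 1], continuous f}.
Lemma cont11_cst (c : R) : cont11 (fun=> c).
Proof. by move=> x; exact: cst_continuous. Qed.
Lemma cont11M f g : cont11 f -> cont11 g -> cont11 (fun x => f x * g x).
Proof. move=> cf cg x; apply: continuousM; [exact: cf|exact: cg]. Qed.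
Lemma cont11D f g : cont11 f -> cont11 g -> cont11 (fun x => f x + g x).
Proof. move=> cf cg x; apply: continuousD; [exact: cf|exact: cg]. Qed.
Lemma cont11_comp f g : cont11 f -> continuous g -> cont11 (fun x => g (f x)).
Proof. move=> cf cg x; apply: continuous_comp; [exact: cf|exact: cg]. Qed.
Lemma cont11Mc c f : cont11 f -> cont11 (fun x => c * f x).
Proof. move=> cf; apply: cont11M => //; exact: cont11_cst. Qed.
Lemma cont11N f : cont11 f -> cont11 (fun x => - f x).
Proof. move=> cf x; apply: continuousN; exact: cf. Qed.

Definition arcsine_weight x : R := (Num.sqrt (1 - x ^+ 2))^-1.
Local Notation w0 := arcsine_weight.

(** This is (1 - x)^(b + 1/2), the quotient of [wgt b] by the arcsine weight. *)
Definition jfactor b x : R := if b then 1 - x else 1.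

(* [cheb b k] is the polynomial J_k^(b,-1/2): [Jac] has a zero denominator at
   x = 1 when b = 1/2, so the two agree only up to the weight, see [JacE]. *)
Fixpoint cheb b k x : R :=
  match k with
  | 0%N => 1
  | k'.+1 => if k' is k''.+1 then 2 * x * cheb b k' x - cheb b k'' x
             else if b then 2 * x + 1 else x
  end.

Lemma chebSS b k x : cheb b k.+2 x = 2 * x * cheb b k.+1 x - cheb b k x.
Proof. by []. Qed.

Lemma cosS2 (k : nat) (c t : R) :
  cos ((k.+2%:R + c) * t) = 2 * cos t * cos ((k.+1%:R + c) * t) - cos ((k%:R + c) * t).
Proof.
have -> : (k.+2%:R + c) * t = (k.+1%:R + c) * t + t by rewrite -[k.+2%:R]natr1; ring.
have -> : (k%:R + c) * t = (k.+1%:R + c) * t - t by rewrite -[k.+1%:R]natr1; ring.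
by rewrite cosD cosB; ring.
Qed.

Lemma sinS2 (k : nat) (c t : R) :
  sin ((k.+2%:R + c) * t) = 2 * cos t * sin ((k.+1%:R + c) * t) - sin ((k%:R + c) * t).
Proof.
have -> : (k.+2%:R + c) * t = (k.+1%:R + c) * t + t by rewrite -[k.+2%:R]natr1; ring.
have -> : (k%:R + c) * t = (k.+1%:R + c) * t - t by rewrite -[k.+1%:R]natr1; ring.
by rewrite sinD sinB; ring.
Qed.

Lemma cheb_cos k x : -1 <= x <= 1 -> cheb false k x = cos (k%:R * acos x).
Proof.
move=> xB; have xK : cos (acos x) = x by rewrite acosK// in_itv.
elim/ltn_ind: k => -[|[|k]] IH; first by rewrite mul0r cos0.
  by rewrite mul1r xK.
rewrite chebSS !IH//; have := cosS2 k 0 (acos x).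
by rewrite !addr0 xK => ->.
Qed.

Lemma cheb_sin k x : -1 <= x <= 1 ->
  cheb true k x * sin (acos x / 2) = sin ((k%:R + 1 / 2) * acos x).
Proof.
move=> xB; have xK : cos (acos x) = x by rewrite acosK// in_itv.
set t := acos x.
elim/ltn_ind: k => -[|[|k]] IH.
- by rewrite /= mul1r add0r mul1r mulrC.
- rewrite /=; set u := t / 2.
  have -> : (1%:R + 1 / 2) * t = u *+ 2 + u by rewrite /u; field.
  have -> : x = cos (u *+ 2) by rewrite -xK -/t; congr cos; rewrite /u; field.
  by rewrite sinD sin_mulr2n cos_mulr2n; ring.
- by rewrite chebSS sinS2 xK -(IH k)// -(IH k.+1)//; ring.
Qed.

(** It holds at the end points too, where both sides are 0: a nonzero power of 0 is 0 for [powR],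
    and the inverse of 0 is 0. *)
Lemma wgtE b x : -1 <= x <= 1 -> wgt b x = jfactor b x * w0 x.
Proof.
move=> /andP[x1 x2]; rewrite /wgt /jfactor /w0.
have h0 : halfR R b != 0 by case: b => /=; rewrite ?oppr_eq0 mul1r invr_eq0 pnatr_eq0.
have h1 : - (1 / 2) != 0 :> R by rewrite oppr_eq0 mul1r invr_eq0 pnatr_eq0.
have [->|x1'] := eqVneq x 1.
  by rewrite subrr powR0// expr1n subrr sqrtr0 invr0 mul0r mulr0.
have [->|x2'] := eqVneq x (-1).
  by rewrite subrr (powR0 h1) sqrrN expr1n subrr sqrtr0 invr0 !mulr0.
have p1 : 0 < 1 - x by rewrite subr_gt0 lt_neqAle x1'.
have p2 : 0 < 1 + x by rewrite -ltrBlDl sub0r lt_neqAle eq_sym x2'.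
have -> : 1 - x ^+ 2 = (1 - x) * (1 + x) by ring.
rewrite sqrtrM ?ltW// !powRN mul1r powR12_sqrt ?ltW//.
have s1 : Num.sqrt (1 - x) != 0 by rewrite gt_eqF// sqrtr_gt0.
have s2 : Num.sqrt (1 + x) != 0 by rewrite gt_eqF// sqrtr_gt0.
case: b {h0} => /=; last by rewrite powRN mul1r powR12_sqrt ?ltW// mul1r invfM.
rewrite mul1r powR12_sqrt ?ltW//; have := @sqr_sqrtr _ (1 - x) (ltW p1).
by move: s1; set s := Num.sqrt (1 - x) => s1 <-; field; rewrite s1 s2.
Qed.

Lemma JacE b k x : -1 <= x <= 1 -> Jac b k x * w0 x = cheb b k x * w0 x.
Proof.
move=> xB; rewrite /Jac; case: b; last by rewrite cheb_cos.
have [->|x1] := eqVneq x 1; first by rewrite /w0 expr1n subrr sqrtr0 invr0 !mulr0.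
have [/andP[x1' x2']] := xB; congr (_ * _); rewrite -cheb_sin// mulfK//.
rewrite gt_eqF// sin_gt0_pi//.
have a0 : 0 < acos x by apply: acos_gt0; rewrite x1' lt_neqAle x1.
have a1 : acos x <= pi by apply: acos_lepi.
by apply/andP; split; lra.
Qed.

(** The arc cosine is not differentiable at the ends; continuity there comes from its inverting the
    continuous cosine on [0, pi]. *)
Lemma within_continuous_acos : {within `[(-1), 1], continuous (@acos R)}.
Proof.
rewrite -(@cospi R) -(@cos0 R).
apply: segment_can_ge_continuous; first exact: pi_ge0.
  by apply: continuous_subspaceT => x; exact: continuous_cos.
exact: cosK.
Qed.

Lemma w0_continuous x : -1 < x < 1 -> {for x, continuous w0}.
Proof.
move=> /andP[x1 x2]; apply: continuousV.
  by rewrite gt_eqF// sqrtr_gt0 subr_gt0 expr2; nra.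
apply: (continuous_comp (g := Num.sqrt)).
  by apply: continuousB; [exact: cst_continuous|exact: exprn_continuous].
exact: sqrt_continuous.
Qed.

Lemma is_derive_acos_opp x : -1 < x < 1 -> is_derive x 1 (fun y => - acos y) (w0 x).
Proof.
move=> xB; have H := is_derive1_acos xB.
by apply: is_derive_eq; rewrite opprK.
Qed.

Lemma w0_ge0 x : 0 <= w0 x.
Proof. by rewrite invr_ge0 sqrtr_ge0. Qed.

Lemma w0_integrable : mu.-integrable `[(-1), 1] (EFin \o w0).
Proof.
apply: (improper_integrable (F := fun y => - acos y)) => //.
- by move=> x _; exact: w0_ge0.
- exact: w0_continuous.
- by move=> x; apply: continuousN; exact: within_continuous_acos.
- exact: is_derive_acos_opp.
Qed.

Definition Lint g : R := (\int[mu]_(x in `[(-1), 1]) (g x * w0 x))%R.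

Lemma Lint_integrable g : cont11 g ->
  mu.-integrable `[(-1), 1] (EFin \o (fun x => g x * w0 x)).
Proof.
move=> cg.
have [B gB] : exists B, forall x, -1 <= x <= 1 -> `|g x| <= B.
  have [|c _ cP] := @EVT_max R (fun x => `|g x|) (-1) 1 (ltac:(lra)).
    by move=> x; apply: continuous_comp; [exact: cg|exact: norm_continuous].
  by exists `|g c| => x xB; apply: cP; rewrite in_itv.
have iB : mu.-integrable `[(-1), 1] (fun x => B%:E * (EFin \o w0) x)%E.
  by apply: integrableZl => //; exact: w0_integrable.
apply: le_integrable iB => //.
  apply/measurable_EFinP/measurable_funM.
    by apply: subspace_continuous_measurable_fun.
  by apply/measurable_EFinP; exact: (measurable_int mu w0_integrable).
move=> x /=; rewrite in_itv/= => xB.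
rewrite lee_fin !normrM (ger0_norm (w0_ge0 x)) ler_wpM2r ?w0_ge0//.
by rewrite (le_trans (gB _ xB))// ler_norm.
Qed.

Lemma eq_Lint f g : (forall x, -1 <= x <= 1 -> f x = g x) -> Lint f = Lint g.
Proof.
by move=> fg; apply: eq_Rintegral => x; rewrite classical_sets.inE/= in_itv/= => /fg ->.
Qed.

Lemma LintD f g : cont11 f -> cont11 g ->
  Lint (fun x => f x + g x) = Lint f + Lint g.
Proof.
move=> cf cg; rewrite /Lint -RintegralD//; [|exact: Lint_integrable..].
by apply: eq_Rintegral => x _; rewrite mulrDl.
Qed.

Lemma LintZ c g : cont11 g -> Lint (fun x => c * g x) = c * Lint g.
Proof.
move=> cg; rewrite /Lint -RintegralZl//; last exact: Lint_integrable.
by apply: eq_Rintegral => x _; rewrite mulrA.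
Qed.

Lemma LintB f g : cont11 f -> cont11 g ->
  Lint (fun x => f x - g x) = Lint f - Lint g.
Proof.
move=> cf cg; rewrite -mulN1r -LintZ// -LintD//.
  by apply: eq_Lint => x _; rewrite mulN1r.
exact: cont11Mc.
Qed.

Lemma within_cos_acos (c : R) : cont11 (fun x => cos (c * acos x)).
Proof.
apply: (@cont11_comp (fun x => c * acos x) cos); last exact: continuous_cos.
by apply: cont11Mc; exact: within_continuous_acos.
Qed.

(** Under x = cos theta the weight becomes the length on [0, pi]. The antiderivatives are [- acos]
    for m = 0 and -sin(m acos x)/m otherwise. *)
Lemma Lint_cos (m : nat) : Lint (fun x => cos (m%:R * acos x)) = if m == 0%N then pi else 0.
Proof.
have N1 : (-1 : R) < 1 by lra.
case: m => [|m] /=.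
  rewrite (_ : Lint _ = (\int[mu]_(x in `[(-1), 1]) w0 x)%R); last first.
    by apply: eq_Rintegral => x _; rewrite mul0r cos0 mul1r.
  rewrite (improper_FTC N1 w0_integrable w0_continuous (cont11N within_continuous_acos)
    is_derive_acos_opp).
  by rewrite acos1 acosN1 oppr0 opprK add0r.
pose F (y : R) := - (m.+1%:R^-1 * sin (m.+1%:R * acos y)).
suff -> : Lint (fun x => cos (m.+1%:R * acos x)) = F 1 - F (-1).
  rewrite /F acos1 mulr0 sin0 mulr0 oppr0 acosN1 opprK add0r.
  rewrite (_ : sin _ = 0) ?mulr0//; elim: {F} m => [|m IH]; first by rewrite mul1r sinpi.
  by rewrite -natr1 mulrDl mul1r sinDpi IH oppr0.
apply: improper_FTC => //.
- by apply: Lint_integrable; exact: within_cos_acos.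
- move=> x xB; apply: continuousM; last exact: w0_continuous.
  apply: continuous_comp; last exact: continuous_cos.
  by apply: continuousM; [exact: cst_continuous|exact: continuous_acos].
- apply/cont11N/cont11Mc/(@cont11_comp _ sin); last exact: continuous_sin.
  by apply: cont11Mc; exact: within_continuous_acos.
- move=> x xB; have H := is_derive1_acos xB.
  have H1 : is_derive x 1 (fun y => m.+1%:R * acos y) (m.+1%:R * - w0 x).
    by apply: is_derive_eq.
  have H2 : is_derive x 1 (sin \o (fun y => m.+1%:R * acos y))
     (cos (m.+1%:R * acos x) * (m.+1%:R * - w0 x)).
    by apply: is_derive1_comp.
  rewrite /F; apply: is_derive_eq; rewrite /GRing.scale/=; field.
  by rewrite addrC natr1 pnatr_eq0.
Qed.

Lemma Lint1 : Lint (fun=> 1) = pi.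
Proof. by rewrite -[RHS](Lint_cos 0); apply: eq_Lint => x _; rewrite mul0r cos0. Qed.

Lemma Lint_le g (B : R) : cont11 g ->
  (forall x, -1 <= x <= 1 -> `|g x| <= B) -> `|Lint g| <= B * pi.
Proof.
move=> cg gB; apply: (le_trans (le_normr_Rintegral _ (Lint_integrable cg))) => //.
have c1 : cont11 (fun=> 1 : R) by move=> x; exact: cst_continuous.
rewrite -Lint1 -LintZ//; apply: le_Rintegral => //.
- exact: integrable_norm (Lint_integrable cg).
- by apply: Lint_integrable => x; exact: cst_continuous.
- move=> x /=; rewrite in_itv/= => xB.
  by rewrite normrM (ger0_norm (w0_ge0 x)) ler_wpM2r ?w0_ge0// mulr1 gB.
Qed.

End Chebyshev.

(** * Moments of one particle *)

Section OneParticle.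
Variable R : realType.
Notation mu := (@lebesgue_measure R).
Implicit Types (b : bool) (k : nat) (x : R) (f g : R -> R).
Local Notation w0 := (@arcsine_weight R).

(* Multiplication by x - 1 in the basis [cheb b], i.e. the generator of one
   particle; for b = 1/2 the rate out of 0 is not balanced (killing at the wall). *)
Definition kop b (f : nat -> R) (u : nat) : R :=
  match u with
  | 0%N => if b then f 1%N / 2 - 3 / 2 * f 0%N else f 1%N - f 0%N
  | u'.+1 => (f u'.+2 + f u') / 2 - f u
  end.

Lemma eq_kop b (f1 f2 : nat -> R) u : f1 =1 f2 -> kop b f1 u = kop b f2 u.
Proof. by move=> e; case: u => [|u] /=; rewrite !e. Qed.

Lemma kopM b (c : R) (f : nat -> R) u : kop b (fun k => c * f k) u = c * kop b f u.
Proof. by case: u => [|u] /=; [case: b|]; field. Qed.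

(** The three-term recurrence read as an eigenvalue equation. At 0 the starting value J_1 = x gives
    reflection, while J_1 = 2x + 1 gives x - 1 = J_1/2 - 3/2. *)
Lemma cheb_kop b l x : (x - 1) * cheb b l x = kop b (fun k => cheb b k x) l.
Proof.
case: l => [|l]; first by case: b => /=; field.
by rewrite /kop chebSS; field.
Qed.

Lemma cheb_cont b k : cont11 (cheb b k : R -> R).
Proof.
elim/ltn_ind: k => -[|[|k]] IH; first exact: cont11_cst.
  case: b {IH} => /=; last by move=> x; apply: continuous_subspaceT => y; exact: cvg_id.
  apply: cont11D; last exact: cont11_cst.
  by apply: cont11Mc => x; apply: continuous_subspaceT => y; exact: cvg_id.
have cid : cont11 (fun x : R => x).
  by move=> x; apply: continuous_subspaceT => y; exact: cvg_id.
rewrite (_ : cheb b k.+2 = fun x => 2 * x * cheb b k.+1 x + - cheb b k x)//.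
apply: cont11D; last by apply/cont11N/IH.
by apply: cont11M; [exact: cont11Mc|exact: IH].
Qed.

(** Not sharp, but read off the recurrence, since 2 * 3^(k+1) + 3^k <= 3^(k+2). The base 3 of the
    later weights originates here. *)
Lemma cheb_bound b k x : -1 <= x <= 1 -> `|cheb b k x| <= 3 ^+ k.
Proof.
move=> xB; have x1 : `|x| <= 1 by rewrite ler_norml.
elim/ltn_ind: k => -[|[|k]] IH; first by rewrite /= normr1.
  rewrite expr1; case: b {IH} => /=; rewrite ?ler_norml; move: xB => /andP[? ?];
  by apply/andP; split; lra.
rewrite chebSS (le_trans (ler_normB _ _))//.
have h1 : `|2 * x * cheb b k.+1 x| <= 2 * 3 ^+ k.+1.
  rewrite !normrM (ger0_norm (ler0n _ 2))// ler_pM// ?mulr_ge0//; last exact: IH.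
  by rewrite ler_piMr.
have h2 : `|cheb b k x| <= 3 ^+ k by exact: IH.
have h3 : 0 <= 3 ^+ k :> R by rewrite exprn_ge0.
by rewrite (le_trans (lerD h1 h2))// !exprS; lra.
Qed.

Lemma jfactor_cont b : cont11 (jfactor b : R -> R).
Proof.
case: b; last exact: cont11_cst.
apply: cont11D; first exact: cont11_cst.
by apply: cont11N => x; apply: continuous_subspaceT => y; exact: cvg_id.
Qed.

Lemma jfactor_bound b x : -1 <= x <= 1 -> `|jfactor b x| <= 2.
Proof.
by case: b => /= xB; rewrite ?normr1 ?ler1n// ler_norml; move: xB => /andP[? ?];
  apply/andP; split; lra.
Qed.

(** The product formulas reduce it to [Lint_cos]. For b = 1/2 the factor 1 - x = 2 sin^2(theta/2)
    clears both denominators, and the frequency i + l + 1 of the second cosine is never 0. *)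
Lemma cheb_orth b i l :
  Lint (fun x => cheb b i x * cheb b l x * jfactor b x) =
  if i == l then pi / Wt R b i else 0.
Proof.
wlog il : i l / (l <= i)%N.
  move=> H; have [|/ltnW li] := leqP l i; first exact: H.
  rewrite (@eq_Lint _ _ (fun x => cheb b l x * cheb b i x * jfactor b x)).
    by rewrite H// eq_sym; case: eqP => // ->.
  by move=> x _; ring.
have cc c : cont11 (fun x : R => cos (c * acos x)) by exact: within_cos_acos.
case: b => /=.
  rewrite (@eq_Lint _ _ (fun x => cos ((i - l)%N%:R * acos x) +
      - cos ((i + l).+1%:R * acos x))).
    rewrite LintD//; last exact: cont11N.
    rewrite (@eq_Lint _ (fun x => - _) (fun x => (-1) * cos ((i + l).+1%:R * acos x))).
      rewrite LintZ// !Lint_cos/= mulr0 addr0 divr1 subn_eq0.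
      by rewrite (eqn_leq i l) il andbT.
    by move=> x _; rewrite mulN1r.
  move=> x xB; set t := acos x.
  have jE : 1 - x = 2 * sin (t / 2) ^+ 2.
    have -> : x = cos (t / 2 *+ 2).
      by rewrite -[LHS](@acosK R x) ?in_itv// -/t; congr cos; field.
    by rewrite cos_mulr2n cos2sin2; ring.
  have -> : cheb true i x * cheb true l x * (1 - x) =
      2 * sin ((i%:R + 1 / 2) * t) * sin ((l%:R + 1 / 2) * t).
    by rewrite -!cheb_sin// -/t jE; ring.
  rewrite natrB//.
  have -> : (i%:R - l%:R) * t = (i%:R + 1 / 2) * t - (l%:R + 1 / 2) * t by ring.
  have -> : (i + l).+1%:R * t = (i%:R + 1 / 2) * t + (l%:R + 1 / 2) * t.
    by rewrite -natr1 natrD; field.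
  by rewrite cosB cosD; ring.
rewrite (@eq_Lint _ _ (fun x => (1 / 2) * cos ((i - l)%N%:R * acos x) +
    (1 / 2) * cos ((i + l)%:R * acos x))).
  rewrite LintD; [|exact: cont11Mc..].
  rewrite !LintZ// !Lint_cos subn_eq0 addn_eq0 (eqn_leq i l) il andbT.
  have [li|li] := leqP i l.
    have -> : l = i by apply/eqP; rewrite eqn_leq il li.
    by rewrite andbb; case: (i == 0%N); field.
  by rewrite (gtn_eqF (leq_ltn_trans _ li))//=; ring.
move=> x xB; rewrite /jfactor mulr1 !cheb_cos// natrB// natrD mulrBl mulrDl.
by rewrite cosB cosD; field.
Qed.

Lemma phit_cont t : cont11 (phit t : R -> R).
Proof.
apply: (@cont11_comp _ (fun x => t * (x - 1)) expR); last exact: continuous_expR.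
apply/cont11Mc/cont11D; last exact: cont11_cst.
by move=> x; apply: continuous_subspaceT => y; exact: cvg_id.
Qed.

Lemma is_derive_phit (t x : R) : is_derive t 1 (fun s => phit s x) ((x - 1) * phit t x).
Proof.
have H : is_derive t 1 (fun s : R => s * (x - 1)) (x - 1).
  by apply: is_derive_eq; rewrite scaler0 add0r /GRing.scale/= mulr1.
rewrite mulrC.
exact: (is_derive1_comp (is_derive_expR _) H).
Qed.

Lemma phit_bound (t x : R) : 0 <= t -> -1 <= x <= 1 -> `|phit t x| <= 1.
Proof.
move=> t0 /andP[_ x1]; rewrite ger0_norm ?expR_ge0// -[leRHS]expR0 ler_expR.
by rewrite mulr_ge0_le0// subr_le0.
Qed.

Lemma is_derive_Lint_phit g (t : R) : cont11 g ->
  is_derive t 1 (fun s => Lint (fun x => phit s x * g x))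
    (Lint (fun x => (x - 1) * (phit t x * g x))).
Proof.
move=> cg; pose f (s x : R) := phit s x * g x * w0 x.
pose B := `[(-1), 1]%classic : set R.
have mB : measurable B by exact: measurable_itv.
(* For s within distance 1 of t one has |s| <= |t| + 1, and |x - 1| <= 2; this dominates the
   derivative in s. *)
pose c := 2 * expR (2 * (`|t| + 1)).
pose G x := c * `|g x| * w0 x.
have It : `]t - 1, t + 1[%classic t by rewrite /= in_itv/=; apply/andP; split; lra.
have df (s x : R) : is_derive s 1 (f ^~ x) ((x - 1) * (phit s x * g x) * w0 x).
  have H := is_derive_phit s x.
  by apply: is_derive_eq; rewrite /GRing.scale/= !mulr0 ?add0r ?addr0; ring.
have intf (s : R) : `]t - 1, t + 1[%classic s -> mu.-integrable B (EFin \o f s).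
  by move=> _; apply: (@Lint_integrable _ (fun x => phit s x * g x)); apply: cont11M => //; exact: phit_cont.
have derf (s x : R) : `]t - 1, t + 1[%classic s -> B x -> derivable (f ^~ x) s 1.
  by move=> _ _; case: (df s x).
have G0 x : 0 <= G x by rewrite !mulr_ge0// ?invr_ge0 ?sqrtr_ge0// expR_ge0.
have intG : mu.-integrable B (EFin \o G).
  apply: (@Lint_integrable _ (fun x => c * `|g x|)); apply: cont11Mc.
  apply: (@cont11_comp _ g (fun x => `|x|)) => //; exact: norm_continuous.
have Gub (s x : R) : `]t - 1, t + 1[%classic s -> B x -> `|partial1of2 f s x| <= G x.
  rewrite /B /= !in_itv/= => sI /andP[x1 x2].
  rewrite partial1of2E (@derive_val _ _ _ _ _ _ _ (df s x)) normrM (ger0_norm (w0_ge0 _)).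
  rewrite ler_wpM2r ?w0_ge0// !normrM /c mulrA ler_wpM2r// ler_pM//.
    by rewrite ler_norml; apply/andP; split; lra.
  rewrite ger0_norm ?expR_ge0// ler_expR.
  rewrite (le_trans (ler_norm _))// normrM mulrC ler_pM//.
    by rewrite ler_norml; apply/andP; split; lra.
  have -> : s = t + (s - t) by ring.
  rewrite (le_trans (ler_normD _ _))// lerD2l ler_norml.
  by move: sI => /andP[? ?]; apply/andP; split; lra.
have D := @derivable_under_integral R _ (measurableTypeR R) mu f B mB t (t - 1) (t + 1)
  It intf derf G G0 intG Gub.
have E := @differentiation_under_integral R _ (measurableTypeR R) mu f B mB t (t - 1) (t + 1)
  It intf derf G G0 intG Gub.
apply: DeriveDef; first exact: D.
rewrite -derive1E [LHS]E; apply: eq_Rintegral => x _.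
by rewrite partial1of2E (@derive_val _ _ _ _ _ _ _ (df t x)).
Qed.

(** Up to the factor W/pi, the entries of T (with [g] a Chebyshev polynomial) and the coefficients
    of the measure (with [g] = x^(N-j) E) are both of this form, so one differential equation serves
    both. *)
Definition mom b g (t : R) (l : nat) : R :=
  Lint (fun x => phit t x * (g x * cheb b l x * jfactor b x)).

Lemma mom_cont b g l : cont11 g -> cont11 (fun x => g x * cheb b l x * jfactor b x).
Proof.
move=> cg; apply: cont11M; last exact: jfactor_cont.
by apply: cont11M => //; exact: cheb_cont.
Qed.

Lemma Lint_kop b (h : nat -> R -> R) l : (forall k, cont11 (h k)) ->
  Lint (fun x => kop b (fun k => h k x) l) = kop b (fun k => Lint (h k)) l.
Proof.
move=> ch; case: l => [|l] /=.
  case: b; last exact: LintB.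
  rewrite (@eq_Lint _ _ (fun x => 2^-1 * h 1%N x - 3 / 2 * h 0%N x)).
    by rewrite LintB ?LintZ//; [ring|exact: cont11Mc..].
  by move=> x _; ring.
rewrite (@eq_Lint _ _ (fun x => 2^-1 * (h l.+2 x + h l x) - h l.+1 x)).
  by rewrite LintB ?LintZ ?LintD//; [ring|exact: cont11D|apply: cont11Mc; exact: cont11D].
by move=> x _; ring.
Qed.

Lemma is_derive_mom b g (t : R) l : cont11 g ->
  is_derive t 1 (fun s => mom b g s l) (kop b (mom b g t) l).
Proof.
move=> cg; have H := is_derive_Lint_phit t (@mom_cont b g l cg).
apply: is_derive_eq; rewrite -Lint_kop; last first.
  by move=> k; apply: cont11M; [exact: phit_cont|exact: mom_cont].
apply: eq_Lint => x _.
rewrite (@eq_kop _ _ (fun k => phit t x * g x * jfactor b x * cheb b k x)).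
  by rewrite kopM -cheb_kop; ring.
by move=> k; ring.
Qed.

Lemma mom_bound b g : cont11 g ->
  exists2 C, 0 <= C & forall t l, 0 <= t -> `|mom b g t l| <= C * 3 ^+ l.
Proof.
move=> cg.
have [c c11 cP] := @EVT_max R (fun x => `|g x|) (-1) 1 (ltac:(lra))
  (cont11_comp cg (@norm_continuous _ _)).
(* The maximum of |g|, the bound 2 of [jfactor], and the total mass pi of the arcsine weight. *)
exists (`|g c| * 2 * pi); first by rewrite !mulr_ge0// pi_ge0.
move=> t l t0.
rewrite mulrAC.
apply: Lint_le; first by apply: cont11M; [exact: phit_cont|exact: mom_cont].
move=> x xB; rewrite !normrM -[leRHS]mul1r; apply: ler_pM => //.
- exact: phit_bound.
- rewrite [leRHS]mulrAC ler_pM//; last exact: jfactor_bound.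
  by rewrite ler_pM//; [apply: cP; rewrite in_itv|exact: cheb_bound].
Qed.

Lemma Iint_mom b (t : R) l i :
  Iint b (phit t) l i = Wt R b i / pi * mom b (cheb b i) t l.
Proof.
rewrite /Iint; congr (_ * _); apply: eq_Rintegral => x.
rewrite classical_sets.inE/= in_itv/= => xB; rewrite wgtE//.
have Ji := JacE b i xB; have Jl := JacE b l xB.
transitivity ((Jac b i x * w0 x) * (Jac b l x * phit t x * jfactor b x)); first by ring.
rewrite Ji; transitivity ((Jac b l x * w0 x) * (cheb b i x * phit t x * jfactor b x)).
  by ring.
by rewrite Jl; ring.
Qed.

Lemma fcoef_mom (E : R -> R) (t : R) N b j k :
  fcoef (fun x => E x * phit t x) N b j k =
  Wt R b k / pi * mom b (fun x => x ^+ (N - j.+1) * E x) t k.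
Proof.
rewrite /fcoef; congr (_ * _); apply: eq_Rintegral => x.
rewrite classical_sets.inE/= in_itv/= => xB; rewrite wgtE//; have Jk := JacE b k xB.
transitivity ((Jac b k x * w0 x) * (x ^+ (N - j.+1) * E x * phit t x * jfactor b x)).
  by ring.
by rewrite Jk; ring.
Qed.

Lemma Wt_gt0 b k : 0 < Wt R b k.
Proof. by rewrite /Wt; case: b => //; case: eqP. Qed.

Lemma Iint_phit0 b l i : Iint b (phit 0) l i = (l == i)%:R :> R.
Proof.
rewrite Iint_mom /mom.
rewrite (@eq_Lint _ _ (fun x => cheb b i x * cheb b l x * jfactor b x)); last first.
  by move=> x _; rewrite /phit mul0r expR0 mul1r.
rewrite cheb_orth eq_sym; case: eqP => _; last by rewrite mulr0.
rewrite mulrA divfK ?divff ?gt_eqF ?pi_gt0 ?Wt_gt0//=.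
Qed.

End OneParticle.

(** * Linear differential equations and summation over a countable set *)

Section Taylor.
Variable R : realType.

Lemma is_derive_cM (k x df : R) (f : R -> R) :
  is_derive x 1 f df -> is_derive x 1 (fun y => k * f y) (k * df).
Proof. by move=> H; apply: (is_deriveZ k). Qed.

Lemma is_derive_powM (n : nat) (k x : R) :
  is_derive x 1 (fun y => y ^+ n.+1 / n.+1`!%:R * k) (x ^+ n / n`!%:R * k).
Proof.
have H : is_derive x 1 (fun y : R => k / n.+1`!%:R * y ^+ n.+1)
    (k / n.+1`!%:R * (n.+1%:R * x ^+ n)).
  apply: is_derive_cM; rewrite (_ : (fun y : R => _) = id ^+ n.+1); last by rewrite exprfctE.
  apply: (is_derive_eq (is_deriveX n.+1 (is_derive_id x 1))).
  by rewrite /GRing.scale/= mulr1.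
rewrite (_ : (fun y => _) = (fun y : R => k / n.+1`!%:R * y ^+ n.+1)); last first.
  by apply/funext => y; ring.
apply: is_derive_eq; rewrite factS natrM invfM.
have n0 : (n.+1%:R : R) != 0 by rewrite pnatr_eq0.
set a := n.+1%:R in n0 *; set b := (n`!%:R)^-1; set y := x ^+ n.
have -> : k * (a^-1 * b) * (a * y) = (a^-1 * a) * (y * b * k) by ring.
by rewrite mulVf// mul1r.
Qed.

(** The induction step for Taylor remainders: a bound on [f'] is integrated once by comparing both
    [f] and [- f] with the primitive of the bound. *)
Lemma deriv_pow_bound (f f' : R -> R) (T K : R) (n : nat) : f 0 = 0 ->
  (forall t : R, is_derive t 1 f (f' t)) ->
  (forall t, 0 <= t <= T -> `|f' t| <= K * (t ^+ n / n`!%:R)) ->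
  forall t, 0 <= t <= T -> `|f t| <= K * (t ^+ n.+1 / n.+1`!%:R).
Proof.
move=> f0 df bf t /andP[t0 tT].
pose p (s : R) := K * (s ^+ n.+1 / n.+1`!%:R).
have dp (s : R) : is_derive s 1 p (K * (s ^+ n / n`!%:R)).
  rewrite mulrC (_ : p = fun y => y ^+ n.+1 / n.+1`!%:R * K); first exact: is_derive_powM.
  by apply/funext => y; rewrite /p mulrC.
have main (e : R) : `|e| = 1 -> e * f t <= p t.
  move=> e1; pose g s := p s - e * f s.
  have dg (s : R) : is_derive s 1 g (K * (s ^+ n / n`!%:R) - e * f' s).
    have H1 := dp s; have H2 := df s.
    by apply: is_deriveB => //; exact: is_derive_cM.
  have : g 0 <= g t.
    apply: (@ger0_derive1_ndecr _ g 0 t) => //.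
    - move=> s; rewrite in_itv/= => /andP[s0 st].
      rewrite derive1E (@derive_val _ _ _ _ _ _ _ (dg s)) subr_ge0.
      rewrite (le_trans (ler_norm _))// normrM e1 mul1r bf//.
      by rewrite (ltW s0) (le_trans (ltW st)).
    - apply: derivable_within_continuous => s _; by case: (dg s).
  by rewrite /g /p f0 expr0n/= mul0r !mulr0 subrr subr_ge0.
rewrite ler_norml -/(p t) lerNl -[X in X <= _]mulN1r.
by rewrite main ?normrN1// -[X in X <= _]mul1r main ?normr1.
Qed.

Variable S : eqType.
Variables (c : S -> S -> R) (r : S -> seq S) (rho : S -> R) (A : R).
Hypothesis rho0 : forall x, 0 <= rho x.
Hypothesis A0 : 0 <= A.
Hypothesis cA : forall x, \sum_(z <- r x) `|c x z| * rho z <= A * rho x.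

Definition finop (f : S -> R) (x : S) : R := \sum_(z <- r x) c x z * f z.

(** By [cA] the operator has norm at most [A] for the supremum norm weighted by [rho]. *)
Lemma finop_bound (f : S -> R) C : (forall x, `|f x| <= C * rho x) ->
  forall x, `|finop f x| <= C * A * rho x.
Proof.
move=> fC x; rewrite (le_trans (ler_norm_sum _ _ _))//.
(* A negative [C] forces [rho], and hence [f], to vanish. *)
have [y0|C0] := ltP C 0.
  have fx0 z : rho z = 0.
    apply/eqP; rewrite eq_le rho0 andbT -(nmulr_rge0 _ y0).
    by rewrite (le_trans _ (fC z)).
  rewrite big1 ?fx0 ?mulr0// => z _; have := fC z; rewrite fx0 mulr0 normr_le0.
  by move=> /eqP ->; rewrite mulr0 normr0.
apply: (@le_trans _ _ (C * \sum_(z <- r x) `|c x z| * rho z)).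
  rewrite mulr_sumr ler_sum// => z _.
  by rewrite normrM mulrCA ler_wpM2l.
by rewrite -mulrA ler_wpM2l.
Qed.

Variables (T : R).

(** Induction on n for all solutions at once: the derivative [finop (h t)] is again a solution, with
    bound [C * A], and its remainder of order n is the derivative of the remainder of order n +
    1. *)
Lemma finop_taylor_rem n : forall (h : R -> S -> R) (C : R),
  (forall (t : R) x, is_derive t 1 (fun s => h s x) (finop (h t) x)) ->
  (forall t x, 0 <= t <= T -> `|h t x| <= C * rho x) ->
  forall t x, 0 <= t <= T ->
  `|h t x - \sum_(0 <= k < n) t ^+ k / k`!%:R * iter k finop (h 0) x|
    <= C * A ^+ n * rho x * (t ^+ n / n`!%:R).
Proof.
elim: n => [|n IH] h C dh bh t x tT.
  by rewrite big_nil subr0 expr0 !expr0 fact0 divr1 !mulr1 bh.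
pose f s := h s x - \sum_(0 <= k < n.+1) s ^+ k / k`!%:R * iter k finop (h 0) x.
pose f' s := finop (h s) x - \sum_(0 <= k < n) s ^+ k / k`!%:R * iter k finop (finop (h 0)) x.
have -> : C * A ^+ n.+1 * rho x = C * A * A ^+ n * rho x by rewrite exprS mulrA.
apply: (@deriv_pow_bound f f' T) => //.
- rewrite /f big_nat_recl//= expr0 fact0 divr1 mul1r big1 ?addr0 ?subrr//.
  by move=> k _; rewrite expr0n/= !mul0r.
- move=> s; apply: is_deriveB.
  rewrite (_ : (fun s0 => _) = (fun s0 : R => h 0 x + \sum_(0 <= k < n)
     s0 ^+ k.+1 / k.+1`!%:R * iter k finop (finop (h 0)) x)); last first.
    apply/funext => s'; rewrite big_nat_recl//= expr0 fact0 divr1 mul1r.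
    by congr (_ + _); apply: eq_bigr => k _; rewrite -iterS iterSr.
  have dsum : is_derive s 1 (fun s0 : R => \sum_(0 <= k < n)
     s0 ^+ k.+1 / k.+1`!%:R * iter k finop (finop (h 0)) x)
     (\sum_(0 <= k < n) s ^+ k / k`!%:R * iter k finop (finop (h 0)) x).
    elim: (n) => [|m IHm].
      under eq_fun do rewrite big_nil.
      by rewrite big_nil; exact: is_derive_cst.
    under eq_fun do rewrite big_nat_recr//=.
    rewrite big_nat_recr//=; apply: is_deriveD.
    exact: is_derive_powM.
  by rewrite -[X in is_derive _ _ _ X]add0r; apply: is_deriveD.
- have dH (s : R) (y : S) : is_derive s 1 (fun u => finop (h u) y) (finop (finop (h s)) y).
    rewrite /finop; elim: (r y) => [|z l IHl].
      under eq_fun do rewrite big_nil.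
      by rewrite big_nil; exact: is_derive_cst.
    under eq_fun do rewrite big_cons.
    by rewrite big_cons; apply: is_deriveD; apply: is_derive_cM; exact: dh.
  move=> s sT; apply: (IH (fun s => finop (h s)) (C * A) dH) => //.
  by move=> s' y s'T; apply: finop_bound => z; exact: bh.
Qed.

(** The remainder is [C * rho x] times a term of the exponential series of [A * t]. So a solution of
    this growth is determined by its value at time 0. *)
Lemma finop_taylor (h : R -> S -> R) (C : R) :
  (forall (t : R) x, is_derive t 1 (fun s => h s x) (finop (h t) x)) ->
  (forall t x, 0 <= t <= T -> `|h t x| <= C * rho x) ->
  forall t x, 0 <= t <= T ->
  series (fun k => t ^+ k / k`!%:R * iter k finop (h 0) x) @ \oo --> h t x.
Proof.
move=> dh bh t x tT; apply/cvgrPdist_le => e e0.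
have cv0 : (fun n => C * rho x * exp_coeff (A * t) n) @ \oo --> (0 : R).
  rewrite -(mulr0 (C * rho x)); apply: cvgM; first exact: cvg_cst.
  exact/cvg_series_cvg_0/is_cvg_series_exp_coeff.
have /cvgrPdist_le/(_ _ e0) := cv0; apply: filterS => n.
rewrite sub0r normrN => H; apply: (le_trans (finop_taylor_rem n dh bh x tT)).
apply: le_trans H; rewrite (le_trans _ (ler_norm _))// /exp_coeff/= exprMn.
by rewrite le_eqVlt; apply/orP; left; apply/eqP; ring.
Qed.

End Taylor.

(** * Unordered sums over a countable set *)

Section SeqSums.
Variables (R : realType) (S : eqType).
Implicit Types (X Y : seq S) (f : S -> R).

Lemma sum_subset_split X Y f : uniq X -> uniq Y -> {subset X <= Y} ->
  \sum_(x <- Y) f x = \sum_(x <- X) f x + \sum_(x <- Y | x \notin X) f x.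
Proof.
move=> uX uY XY; rewrite (bigID [in X])/=; congr (_ + _).
rewrite -big_filter; apply: perm_big; apply: uniq_perm => //; first exact: filter_uniq.
move=> x; rewrite mem_filter; apply/andP/idP => [[]//|xX].
by split => //; exact: XY.
Qed.

Lemma sum_subset_eq X Y f : uniq X -> uniq Y -> {subset X <= Y} ->
  (forall y, y \in Y -> y \notin X -> f y = 0) ->
  \sum_(x <- Y) f x = \sum_(x <- X) f x.
Proof.
move=> uX uY XY f0; rewrite (sum_subset_split f uX uY XY).
rewrite -[RHS]addr0; congr (_ + _); rewrite big_seq_cond big1// => y /andP[yY yX]; exact: f0.
Qed.

Lemma sum_subset_le X Y f : uniq X -> uniq Y -> {subset X <= Y} ->
  (forall y, y \in Y -> 0 <= f y) -> \sum_(x <- X) f x <= \sum_(x <- Y) f x.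
Proof.
move=> uX uY XY f0; rewrite (sum_subset_split f uX uY XY) lerDl.
by rewrite big_seq_cond sumr_ge0// => y /andP[yY yX]; exact: f0.
Qed.

End SeqSums.

Section HasSum.
Variables (R : realType).

(** Absolute convergence to [s] along finite subsets. Finite subsets are duplicate-free lists, so
    that partial sums are ordinary big operators. *)
Definition hassum (S : choiceType) (D : set S) (f : S -> R) (s : R) :=
  (exists C : R, forall X, uniq X -> (forall x, x \in X -> D x) -> \sum_(x <- X) `|f x| <= C) /\
  (forall e : R, 0 < e -> exists2 X0 : seq S, (forall x, x \in X0 -> D x) &
    forall X, uniq X -> (forall x, x \in X -> D x) -> {subset X0 <= X} ->
      `|\sum_(x <- X) f x - s| <= e).

(** Translates the supremum that defines [esum] into lists: beyond a suitable list all partial sums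
    lie within e of the total. *)
Lemma esum_seq_approx (S : choiceType) (D : set S) (g : S -> R) (C : R) :
  (forall x, D x -> 0 <= g x) ->
  (forall X, uniq X -> (forall x, x \in X -> D x) -> \sum_(x <- X) g x <= C) ->
  exists2 a : R, (\esum_(x in D) (g x)%:E)%E = a%:E &
  forall e : R, 0 < e -> exists2 X0 : seq S, uniq X0 /\ (forall x, x \in X0 -> D x) &
    forall X, uniq X -> (forall x, x \in X -> D x) -> {subset X0 <= X} ->
      a - e <= \sum_(x <- X) g x <= a.
Proof.
move=> g0 gC.
have fsE (X : seq S) : uniq X ->
    (\sum_(x \in [set` X]) (g x)%:E)%E = (\sum_(x <- X) g x)%:E.
  move=> uX; rewrite fsbig_finite; last exact: finite_seq.
  rewrite sumEFin; congr (_%:E); apply: perm_big.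
  apply: uniq_perm => //.
  by move=> x; rewrite in_fset_set ?mem_setE//; exact: finite_seq.
have leX (X : seq S) : uniq X -> (forall x, x \in X -> D x) ->
    ((\sum_(x <- X) g x)%:E <= \esum_(x in D) (g x)%:E)%E.
  move=> uX XD; apply: esum_ge; exists [set` X]; last by rewrite fsE.
  by split; [exact: finite_seq|move=> x; exact: XD].
have leC : (\esum_(x in D) (g x)%:E <= C%:E)%E.
  apply: ge_ereal_sup => _ [F [finF FD] <-].
  rewrite fsbig_finite// sumEFin lee_fin gC// => x.
  by rewrite in_fset_set// => /set_mem; exact: FD.
have fin : (\esum_(x in D) (g x)%:E)%E \is a fin_num.
  rewrite ge0_fin_numE; first exact: (le_lt_trans leC (ltry C)).
  by apply: esum_ge0 => x /g0; rewrite lee_fin.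
exists (fine (\esum_(x in D) (g x)%:E)%E); first by rewrite fineK.
move=> e e0; have [_ [F [finF FD] <-] ltF] := ub_ereal_sup_adherent e0 fin.
exists (fset_set F : seq S).
  by split; [exact: fset_uniq|move=> x; rewrite in_fset_set// => /set_mem; exact: FD].
move=> X uX XD FX; apply/andP; split; last first.
  by rewrite -lee_fin fineK//; exact: leX.
apply: (@le_trans _ _ (\sum_(x <- fset_set F) g x)).
  rewrite -lee_fin EFinB fineK// -sumEFin -fsbig_finite//.
  exact: ltW.
by apply: sum_subset_le => // y /XD/g0.
Qed.

(** [rsum] subtracts two separate sums, of the positive and of the negative part. A single list can
    be chosen that approximates both of them and [s] up to e/3. *)
Lemma hassum_rsum (S : choiceType) (D : set S) (f : S -> R) (s : R) : hassum D f s ->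
  summable D (fun x => (f x)%:E) /\ rsum D f = s.
Proof.
move=> [[C fC] fs].
have bnd (g : S -> R) : (forall x, 0 <= g x <= `|f x|) ->
    forall X, uniq X -> (forall x, x \in X -> D x) -> \sum_(x <- X) g x <= C.
  move=> gf X uX XD; apply: le_trans (fC _ uX XD).
  by apply: ler_sum => x _; case/andP: (gf x).
have pP x : 0 <= f^\+ x <= `|f x|.
  rewrite /funrpos; case: (lerP (f x) 0) => f0; first by rewrite lexx normr_ge0.
  by rewrite (ltW f0) ler_norm.
have nP x : 0 <= f^\- x <= `|f x|.
  rewrite /funrneg -normrN; case: (lerP (- f x) 0) => f0; first by rewrite lexx normr_ge0.
  by rewrite (ltW f0) ler_norm.
have [c ce _] := @esum_seq_approx _ D (fun x => `|f x|) C (fun x _ => normr_ge0 _) fC.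
have [a ae aP] := @esum_seq_approx _ D f^\+ C (fun x _ => proj1 (andP (pP x))) (bnd _ pP).
have [b be bP] := @esum_seq_approx _ D f^\- C (fun x _ => proj1 (andP (nP x))) (bnd _ nP).
split; first by rewrite /summable (eq_esum (b := fun x => (`|f x|)%:E)) ?ce ?ltry.
have aE : (\esum_(x in D) (EFin \o f)^\+ x)%E = a%:E.
  by rewrite -ae; apply: eq_esum => x _; rewrite funeposE -fine_max.
have bE : (\esum_(x in D) (EFin \o f)^\- x)%E = b%:E.
  by rewrite -be; apply: eq_esum => x _; rewrite funenegE -fine_max.
rewrite /rsum /ssumE aE bE /=; apply/eqP; rewrite -subr_eq0 -normr_le0.
apply/ler_addgt0Pl => e e0; rewrite addr0.
have e3 : 0 < e / 3 by rewrite divr_gt0.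
have [X1 [_ X1D] H1] := aP _ e3; have [X2 [_ X2D] H2] := bP _ e3.
have [X3 X3D H3] := fs _ e3.
pose X := undup (X1 ++ X2 ++ X3).
have uX : uniq X by exact: undup_uniq.
have XD x : x \in X -> D x.
  by rewrite mem_undup !mem_cat => /or3P[/X1D|/X2D|/X3D].
have {}H1 : a - e / 3 <= \sum_(x <- X) f^\+ x <= a.
  by apply: H1 => // x xX; rewrite mem_undup !mem_cat xX.
have {}H2 : b - e / 3 <= \sum_(x <- X) f^\- x <= b.
  by apply: H2 => // x xX; rewrite mem_undup !mem_cat xX orbT.
have {}H3 : `|\sum_(x <- X) f x - s| <= e / 3.
  by apply: H3 => // x xX; rewrite mem_undup !mem_cat xX !orbT.
have fE : \sum_(x <- X) f x = \sum_(x <- X) f^\+ x - \sum_(x <- X) f^\- x.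
  by rewrite -sumrB; apply: eq_bigr => x _; rewrite -[in LHS](funrposBneg f).
move: H1 H2 H3; rewrite fE; set p := \sum_(_ <- _) _; set q := \sum_(_ <- _) _.
rewrite !ler_norml => /andP[? ?] /andP[? ?] /andP[? ?].
by apply/andP; split; lra.
Qed.

(** Fubini for a map with finite fibres. Only [p] may change sign; since [G] is nonnegative, the
    absolute sum over a fibre is |p| times [H], so absolute convergence lifts. *)
Lemma hassum_fiber (T S : choiceType) (DT : set T) (DS : set S) (proj : T -> S)
    (fib : S -> seq T) (p H : S -> R) (G : T -> R) (s : R) :
  (forall l, DT l -> DS (proj l)) -> (forall l, DT l -> 0 <= G l) ->
  (forall x, DS x -> uniq (fib x)) ->
  (forall x l, DS x -> (l \in fib x) = `[< DT l /\ proj l = x >]) ->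
  (forall x, DS x -> \sum_(l <- fib x) G l = H x) ->
  hassum DS (fun x => p x * H x) s -> hassum DT (fun l => p (proj l) * G l) s.
Proof.
move=> projD G0 ufib fibP GH [[C HC] Hs].
pose fibs (Y : seq S) := flatten (map fib Y).
have fibsP Y l : (forall x, x \in Y -> DS x) ->
    (l \in fibs Y) = `[< DT l >] && (proj l \in Y).
  move=> YD; apply/flatten_mapP/andP => [[x xY]|[/asboolP Dl lY]].
    rewrite (fibP _ _ (YD _ xY)) => /asboolP[Dl lx].
    by split; [exact/asboolP|rewrite lx].
  exists (proj l) => //; rewrite (fibP _ _ (YD _ lY)); exact/asboolP.
have ufibs Y : uniq Y -> (forall x, x \in Y -> DS x) -> uniq (fibs Y).
  elim: Y => [//|x Y IH] /= /andP[xY uY] YD.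
  have YD' z : z \in Y -> DS z by move=> zY; apply: YD; rewrite inE zY orbT.
  have Dx : DS x by apply: YD; rewrite mem_head.
  rewrite cat_uniq (ufib _ Dx) (IH uY YD') andbT.
  apply/hasPn => l; rewrite (fibsP _ _ YD') => /andP[_ lY]; rewrite (fibP _ _ Dx).
  by apply/negP => /asboolP[_ lx]; rewrite lx (negbTE xY) in lY.
have sumfibs Y (q : S -> R) : (forall x, x \in Y -> DS x) ->
    \sum_(l <- fibs Y) q (proj l) * G l = \sum_(x <- Y) q x * H x.
  move=> YD; rewrite big_flatten big_map big_seq [RHS]big_seq.
  apply: eq_bigr => x xY; rewrite -(GH _ (YD _ xY)) mulr_sumr big_seq [RHS]big_seq.
  by apply: eq_bigr => l; rewrite (fibP _ _ (YD _ xY)) => /asboolP[_ ->].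
have H0 x : DS x -> 0 <= H x.
  move=> Dx; rewrite -(GH _ Dx) big_seq sumr_ge0// => l.
  by rewrite (fibP _ _ Dx) => /asboolP[Dl _]; exact: G0.
have absle X : uniq X -> (forall l, l \in X -> DT l) ->
    \sum_(l <- X) `|p (proj l) * G l| <=
    \sum_(x <- undup (map proj X)) `|p x * H x|.
  move=> uX XD; have YD x : x \in undup (map proj X) -> DS x.
    by rewrite mem_undup => /mapP[l /XD Dl ->]; exact: projD.
  have -> : \sum_(x <- undup (map proj X)) `|p x * H x| =
      \sum_(x <- undup (map proj X)) `|p x| * H x.
    rewrite big_seq [RHS]big_seq; apply: eq_bigr => x /YD Dx.
    by rewrite normrM (ger0_norm (H0 _ Dx)).
  rewrite -(sumfibs _ (fun x => `|p x|))//.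
  rewrite (_ : \sum_(l <- X) _ = \sum_(l <- X) `|p (proj l)| * G l); last first.
    rewrite big_seq [RHS]big_seq; apply: eq_bigr => l /XD Dl.
    by rewrite normrM (ger0_norm (G0 _ Dl)).
  apply: sum_subset_le => //; first by apply: ufibs => //; exact: undup_uniq.
    move=> l lX; rewrite fibsP// mem_undup map_f// andbT; exact/asboolP/XD.
  move=> l; rewrite fibsP// => /andP[/asboolP Dl _].
  by rewrite mulr_ge0// G0.
split.
  exists C => X uX XD; apply: le_trans (absle _ uX XD) _; apply: HC.
    exact: undup_uniq.
  by move=> x; rewrite mem_undup => /mapP[l /XD Dl ->]; exact: projD.
move=> e e0; have e2 : 0 < e / 2 by rewrite divr_gt0.
have [X1 X1D P1] := Hs _ e2.
have [a _ aP] := @esum_seq_approx _ DS (fun x => `|p x * H x|) C (fun x _ => normr_ge0 _) HC.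
have [X2 [_ X2D] P2] := aP _ e2.
pose Y := undup (X1 ++ X2).
have uY : uniq Y by exact: undup_uniq.
have YD x : x \in Y -> DS x by rewrite mem_undup mem_cat => /orP[/X1D|/X2D].
exists (fibs Y); first by move=> l; rewrite fibsP// => /andP[/asboolP].
move=> X uX XD YX.
rewrite (sum_subset_split _ (ufibs _ uY YD) uX YX) sumfibs//.
set s1 := \sum_(x <- Y) _; set s2 := \sum_(_ <- _ | _) _.
have h1 : `|s1 - s| <= e / 2.
  by apply: P1 => // x xX; rewrite mem_undup mem_cat xX.
(* The part of [X] outside the chosen fibres lies over base points outside [Y], whose absolute sum
   is a tail of the base series. *)
have h2 : `|s2| <= e / 2.
  pose Z := [seq l <- X | l \notin fibs Y].
  rewrite (_ : s2 = \sum_(l <- Z) p (proj l) * G l); last by rewrite big_filter.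
  apply: (le_trans (ler_norm_sum _ _ _)).
  have uZ : uniq Z by exact: filter_uniq.
  have ZD l : l \in Z -> DT l by rewrite mem_filter => /andP[_ /XD].
  apply: le_trans (absle _ uZ ZD) _; set W := undup _.
  have WD x : x \in W -> DS x.
    by rewrite mem_undup => /mapP[l /ZD Dl ->]; exact: projD.
  have dis x : x \in W -> x \notin Y.
    rewrite mem_undup => /mapP[l + ->]; rewrite mem_filter => /andP[+ /XD Dl].
    by rewrite fibsP// negb_and => /orP[/negP|//]; case; exact/asboolP.
  have uYW : uniq (Y ++ W).
    rewrite cat_uniq uY undup_uniq andbT /=; apply/hasPn => x /dis; exact.
  have A1 : a - e / 2 <= \sum_(x <- Y) `|p x * H x|.
    by have /andP[] := P2 _ uY YD (fun x xX => (ltac:(by rewrite mem_undup mem_cat xX orbT))).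
  have A2 : \sum_(x <- Y ++ W) `|p x * H x| <= a.
    have D1 x : x \in Y ++ W -> DS x by rewrite mem_cat => /orP[/YD|/WD].
    have D2 : {subset X2 <= Y ++ W}.
      by move=> x xX; rewrite mem_cat mem_undup mem_cat xX orbT.
    by have /andP[] := P2 _ uYW D1 D2.
  by move: A2; rewrite big_cat/=; lra.
rewrite (_ : s1 + s2 - s = (s1 - s) + s2); last by ring.
by rewrite (le_trans (ler_normD _ _))//; lra.
Qed.

End HasSum.

Section Positivity.
Variables (R : realType) (S : eqType).
Variables (c : S -> S -> R) (r : S -> seq S) (rho : S -> R) (A g T : R).
Hypothesis rho0 : forall x, 0 <= rho x.
Hypothesis A0 : 0 <= A.
Hypothesis cA : forall x, \sum_(z <- r x) `|c x z| * rho z <= A * rho x.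
Hypothesis g0 : 0 <= g.
Hypothesis ur : forall x, uniq (r x).
Hypothesis rx : forall x, x \in r x.
Hypothesis c_off : forall x z, z != x -> 0 <= c x z.
Hypothesis c_diag : forall x, - g <= c x x.

Let c' x z := c x z + g * (z == x)%:R.

Let sum_delta (f : S -> R) x : \sum_(z <- r x) (z == x)%:R * f z = f x.
Proof.
rewrite (bigD1_seq x)//= eqxx mul1r big1 ?addr0// => z zx.
by rewrite (negbTE zx) mul0r.
Qed.

Let finop' (f : S -> R) x : finop c' r f x = finop c r f x + g * f x.
Proof.
rewrite /finop -[in RHS](sum_delta f) mulr_sumr -big_split/=.
by apply: eq_bigr => z _; rewrite /c' mulrDl mulrA.
Qed.

(* After adding [g] on the diagonal, which multiplies the solution by e^(g t), all
   coefficients are nonnegative and so are the terms of the Taylor series. *)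
Lemma finop_pos (h : R -> S -> R) (C : R) :
  (forall (t : R) x, is_derive t 1 (fun s => h s x) (finop c r (h t) x)) ->
  (forall t x, 0 <= t <= T -> `|h t x| <= C * rho x) ->
  (forall x, 0 <= h 0 x) ->
  forall t x, 0 <= t <= T -> 0 <= h t x.
Proof.
move=> dh bh h0 t x tT.
pose h' (s : R) y := expR (g * s) * h s y.
have dh' (s : R) y : is_derive s 1 (fun u => h' u y) (finop c' r (h' s) y).
  have H1 : is_derive s 1 (fun u : R => expR (g * u)) (expR (g * s) * g).
    apply: (@is_derive1_comp _ expR (fun u => g * u)).
    by have := is_derive_cM g (is_derive_id s 1); rewrite mulr1.
  have H2 := dh s y.
  rewrite finop'; apply: (is_derive_eq (is_deriveM H1 H2)).
  rewrite /GRing.scale/= /h' /finop mulr_sumr; congr (_ + _); last by ring.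
  by apply: eq_bigr => z _; ring.
have c'A y : \sum_(z <- r y) `|c' y z| * rho z <= (A + g) * rho y.
  rewrite mulrDl; apply: le_trans (lerD (cA y) (lexx _)).
  rewrite -(sum_delta (fun y => rho y)) mulr_sumr -big_split/= ler_sum// => z _.
  rewrite /c' mulrA -mulrDl ler_wpM2r// (le_trans (ler_normD _ _))// lerD2l.
  by rewrite ger0_norm// mulr_ge0.
have bh' s y : 0 <= s <= T -> `|h' s y| <= expR (g * T) * C * rho y.
  move=> /andP[s0 sT]; rewrite normrM ger0_norm ?expR_ge0// -mulrA.
  by rewrite ler_pM ?expR_ge0 ?bh ?s0// ler_expR ler_wpM2l.
have := finop_taylor rho0 c'A dh' bh' (x := x) tT.
move=> cv; have : 0 <= h' t x.
  rewrite -(cvg_lim _ cv)//; apply: limr_ge; first by apply/cvg_ex; eexists; exact: cv.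
  apply: nearW => n; rewrite sumr_ge0// => k _.
  have t0 : 0 <= t by case/andP: tT.
  rewrite mulr_ge0 ?divr_ge0 ?exprn_ge0//.
  elim: (k) x {cv} => [|m IH] x /=.
    by rewrite /h' mulr0 expR0 mul1r.
  rewrite /finop sumr_ge0// => z _; apply: mulr_ge0; last exact: IH.
  rewrite /c'; have [->|zx] := eqVneq z x; last by rewrite mulr0 addr0 c_off.
  by rewrite mulr1; have := c_diag x; lra.
by rewrite pmulr_rge0// expR_gt0.
Qed.

End Positivity.

(** * Exponentials of matrices with finite columns *)

Section ExpSum.
Variables (R : realType) (S : choiceType) (D : set S).
Variables (b : S -> S -> R) (nb : S -> seq S) (rho : S -> R) (A : R).
Hypothesis rho0 : forall x, 0 <= rho x.
Hypothesis A0 : 0 <= A.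
Hypothesis unb : forall x, uniq (nb x).
Hypothesis nbD : forall x y, D x -> y \in nb x -> D y.
Hypothesis nbC : forall x y, D x -> D y -> y \in nb x -> x \in nb y.
Hypothesis nb_supp : forall x y, D x -> D y -> b x y != 0 -> y \in nb x.
Hypothesis bA : forall y, D y -> \sum_(x <- nb y) `|b x y| * rho x <= A * rho y.

Let colop := finop (fun y x => b x y) nb.
Definition finpow k x y := iter k (finop b nb) (fun z => (z == y)%:R) x.
Let ball y k := iter k (fun l => undup (flatten (map nb l))) [:: y].

Let ballD y k x : D y -> x \in ball y k -> D x.
Proof.
move=> Dy; elim: k x => [|k IH] x /=; first by rewrite inE => /eqP ->.
by rewrite mem_undup => /flatten_mapP[z /IH Dz]; exact: nbD.
Qed.

Let ball_uniq y k : uniq (ball y k).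
Proof. by case: k => [|k] //=; exact: undup_uniq. Qed.

Let finpow_supp k x y : D x -> D y -> finpow k x y != 0 -> x \in ball y k.
Proof.
elim: k x => [|k IH] x Dx Dy.
  by rewrite /finpow /= inE; case: (x == y); rewrite ?eqxx.
rewrite /finpow /= -/(finpow k _ y) /finop => /eqP H.
have [z znb zk] : exists2 z, z \in nb x & finpow k z y != 0.
  apply: contrapT => H'; apply: H; rewrite big_seq big1// => z zn.
  have [->|zy] := eqVneq (iter k (finop b nb) (fun z0 => (z0 == y)%:R) z) 0.
    by rewrite mulr0.
  by case: H'; exists z.
have zb := IH _ (nbD Dx znb) Dy zk; rewrite mem_undup; apply/flatten_mapP.
by exists z => //; exact: (nbC Dx (nbD Dx znb) znb).
Qed.

(** Associativity of a row vector times a matrix power: on the left the power is formed first, on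
    the right [u] is multiplied k times. Column [y] of the k-th power lives on [ball y k], so the
    sum is finite whatever [u] is. *)
Lemma finpow_sum k (u : S -> R) y X : D y -> uniq X -> (forall x, x \in X -> D x) ->
  {subset ball y k <= X} -> \sum_(x <- X) u x * finpow k x y = iter k colop u y.
Proof.
move=> Dy; elim: k u X => [|k IH] u X uX XD bX.
  rewrite (bigD1_seq y)//=; last by apply: bX; rewrite inE.
  rewrite /finpow /= eqxx mulr1 big1 ?addr0// => z zy.
  by rewrite (negbTE zy) mulr0.
have finpowS x : D x -> finpow k.+1 x y = \sum_(z <- ball y k) b x z * finpow k z y.
  move=> Dx; pose Y := undup (nb x ++ ball y k).
  have YD z : z \in Y -> D z.
    by rewrite mem_undup mem_cat => /orP[/(nbD Dx)|/(ballD Dy)].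
  rewrite /finpow /= -/(finpow k _ y) /finop.
  transitivity (\sum_(z <- Y) b x z * finpow k z y).
    apply/esym/sum_subset_eq => //; first exact: undup_uniq.
      by move=> z zn; rewrite mem_undup mem_cat zn.
    move=> z /YD Dz zn; have [->|bn] := eqVneq (b x z) 0; first by rewrite mul0r.
    by rewrite nb_supp in zn.
  apply/sum_subset_eq => //; first exact: undup_uniq.
    by move=> z zn; rewrite mem_undup mem_cat zn orbT.
  move=> z /YD Dz zn; have [->|bn] := eqVneq (finpow k z y) 0; first by rewrite mulr0.
  by rewrite finpow_supp in zn.
rewrite iterSr -(IH _ (ball y k))//; last by move=> x; exact: ballD.
rewrite big_seq; under eq_bigr => x /XD Dx do rewrite finpowS// mulr_sumr.
rewrite -big_seq exchange_big/= big_seq [RHS]big_seq; apply: eq_bigr => z zb.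
have Dz := ballD Dy zb.
rewrite /colop /finop mulr_suml; under eq_bigr do rewrite mulrA.
rewrite -!mulr_suml; congr (_ * _).
under [RHS]eq_bigr do rewrite mulrC.
apply: sum_subset_eq => //.
  move=> x xn; apply: bX; rewrite /= mem_undup; apply/flatten_mapP; by exists z.
move=> x /XD Dx xn; have [->|bn] := eqVneq (b x z) 0; first by rewrite mulr0.
by rewrite (nbC Dx Dz (nb_supp Dx Dz bn)) in xn.
Qed.

End ExpSum.

Lemma cvg_seq_sum (R : realType) (S : eqType) (X : seq S) (f : S -> nat -> R) (l : S -> R) :
  (forall x, x \in X -> f x @ \oo --> l x) ->
  (fun n => \sum_(x <- X) f x n) @ \oo --> \sum_(x <- X) l x.
Proof.
elim: X => [|x X IH] fl.
  by rewrite big_nil; under eq_fun do rewrite big_nil; exact: cvg_cst.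
rewrite big_cons; under eq_fun do rewrite big_cons.
apply: cvgD; first by apply: fl; rewrite mem_head.
by apply: IH => z zX; apply: fl; rewrite inE zX orbT.
Qed.

Section ExpSum2.
Variables (R : realType) (S : choiceType) (D : set S).
Variables (b : S -> S -> R) (nb : S -> seq S) (rho : S -> R) (A : R).
Hypothesis rho0 : forall x, 0 <= rho x.
Hypothesis A0 : 0 <= A.
Hypothesis unb : forall x, uniq (nb x).
Hypothesis nbD : forall x y, D x -> y \in nb x -> D y.
Hypothesis nbC : forall x y, D x -> D y -> y \in nb x -> x \in nb y.
Hypothesis nb_supp : forall x y, D x -> D y -> b x y != 0 -> y \in nb x.
Hypothesis bA : forall y, D y -> \sum_(x <- nb y) `|b x y| * rho x <= A * rho y.

Let colop := finop (fun y x => b x y) nb.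
Let ball y k := iter k (fun l => undup (flatten (map nb l))) [:: y].

(** The powers of the matrix of absolute values dominate those of [b]; having nonnegative entries,
    they allow the column bound [bA] to be iterated k times. *)
Lemma finpow_abs_sum k (u : S -> R) (C : R) y X : 0 <= C -> D y -> uniq X ->
  (forall x, x \in X -> D x) -> (forall x, D x -> `|u x| <= C * rho x) ->
  \sum_(x <- X) `|u x * finpow b nb k x y| <= C * A ^+ k * rho y.
Proof.
move=> C0 Dy uX XD uC.
pose b' x y := `|b x y|.
have powle x : `|finpow b nb k x y| <= finpow b' nb k x y.
  rewrite /finpow; elim: (k) x => [|m IH] x /=; first by case: eqP; rewrite ?normr1 ?normr0.
  rewrite /finop (le_trans (ler_norm_sum _ _ _))// ler_sum// => z _.
  by rewrite normrM ler_wpM2l// IH.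
have b'A z : D z -> \sum_(x <- nb z) `|b' x z| * rho x <= A * rho z.
  by move=> Dz; apply: le_trans (bA Dz); under eq_bigr do rewrite normr_id.
have supp' x z : D x -> D z -> b' x z != 0 -> z \in nb x.
  by move=> Dx Dz; rewrite normr_eq0; exact: nb_supp.
pose Y := undup (X ++ [seq x <- ball y k | x \in ball y k]).
have bD x : x \in ball y k -> D x.
  rewrite /ball; elim: (k) x => [|m IH] x /=; first by rewrite inE => /eqP ->.
  by rewrite mem_undup => /flatten_mapP[z /IH Dz]; exact: nbD.
have YD x : x \in Y -> D x.
  by rewrite mem_undup mem_cat mem_filter => /orP[/XD|/andP[/bD]].
apply: (@le_trans _ _ (\sum_(x <- Y) `|u x| * finpow b' nb k x y)).
  apply: (@le_trans _ _ (\sum_(x <- X) `|u x| * finpow b' nb k x y)).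
    by rewrite ler_sum// => x _; rewrite normrM ler_wpM2l.
  apply: sum_subset_le => //; first exact: undup_uniq.
    by move=> x xX; rewrite mem_undup mem_cat xX.
  by move=> x _; rewrite mulr_ge0// (le_trans _ (powle x)).
rewrite (@finpow_sum R S D b' nb)//; last 2 first.
- exact: undup_uniq.
- by move=> x xb; rewrite mem_undup mem_cat mem_filter xb andbb orbT.
suff gen m : forall (v : S -> R) z K, (forall x, 0 <= v x) -> D z -> 0 <= K ->
    (forall x, D x -> v x <= K * rho x) ->
    iter m (finop (fun y x => b' x y) nb) v z <= K * A ^+ m * rho z.
  exact: gen.
elim: m => [|m IH] v z K v0 Dz K0 vK; first by rewrite /= expr0 mulr1 vK.
rewrite iterSr exprS mulrA; apply: IH => //.
- by move=> x; rewrite /finop sumr_ge0// => w _; rewrite mulr_ge0// /b'.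
- exact: mulr_ge0.
- move=> x Dx; rewrite -mulrA; apply: le_trans (ler_wpM2l K0 (bA Dx)).
  rewrite mulr_sumr /finop big_seq [leRHS]big_seq ler_sum// => w wn.
  by rewrite mulrCA ler_wpM2l//; [exact: normr_ge0|apply/vK/(nbD Dx wn)].
Qed.

(* [u] is only bounded by the growing weight [rho], so [u] itself need not be
   summable; the sum converges because [finpow b nb k _ y] lives on the ball of
   radius k around y, on which [rho] grows at most geometrically in k. *)
Lemma hassum_exp (u E : S -> R) (y : S) (C t s : R) : 0 <= C -> 0 <= t -> D y ->
  (forall x, D x -> `|u x| <= C * rho x) ->
  (forall x, D x ->
    series (fun k => t ^+ k / k`!%:R * finpow b nb k x y) @ \oo --> E x) ->
  series (fun k => t ^+ k / k`!%:R * iter k colop u y) @ \oo --> s ->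
  hassum D (fun x => u x * E x) s.
Proof.
move=> C0 t0 Dy uC ES ss.
pose S_ n x : R := \sum_(0 <= k < n) t ^+ k / k`!%:R * finpow b nb k x y.
pose K n : R := \sum_(0 <= k < n) (A * t) ^+ k / k`!%:R.
have K0 := C0; pose c := C * rho y.
have c0 : 0 <= c by exact: mulr_ge0.
have Kcv : K @ \oo --> expR (A * t).
  by rewrite (_ : K = series (exp_coeff (A * t)))//; exact: (is_cvg_series_exp_coeff (A * t)).
(* A tail of the matrix series, summed over any list, is at most the same tail of the scalar series
   for exp(A t). The bound is uniform in [X], so m may tend to infinity. *)
have KS n X : uniq X -> (forall x, x \in X -> D x) ->
    forall m, (n <= m)%N -> \sum_(x <- X) `|u x * (S_ m x - S_ n x)| <= c * (K m - K n).
  move=> uX XD m nm.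
  have dS x : S_ m x - S_ n x = \sum_(n <= k < m) t ^+ k / k`!%:R * finpow b nb k x y.
    by rewrite /S_ (@big_cat_nat _ _ _ n 0%N m)//= addrAC subrr add0r.
  have -> : K m - K n = \sum_(n <= k < m) (A * t) ^+ k / k`!%:R.
    by rewrite /K (@big_cat_nat _ _ _ n 0%N m)//= addrAC subrr add0r.
  apply: (@le_trans _ _ (\sum_(x <- X) \sum_(n <= k < m)
      t ^+ k / k`!%:R * `|u x * finpow b nb k x y|)).
    apply: ler_sum => x _; rewrite dS mulr_sumr (le_trans (ler_norm_sum _ _ _))//.
    apply: ler_sum => k _; rewrite mulrCA normrM ger0_norm//.
    by rewrite divr_ge0 ?exprn_ge0.
  rewrite exchange_big mulr_sumr/=; apply: ler_sum => k _; rewrite -mulr_sumr.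
  have tk : 0 <= t ^+ k / k`!%:R by rewrite divr_ge0 ?exprn_ge0.
  apply: le_trans (ler_wpM2l tk (finpow_abs_sum k C0 Dy uX XD uC)) _.
  by rewrite exprMn /c le_eqVlt; apply/orP; left; apply/eqP; ring.
have KE n X : uniq X -> (forall x, x \in X -> D x) ->
    \sum_(x <- X) `|u x * (E x - S_ n x)| <= c * (expR (A * t) - K n).
  move=> uX XD.
  have cvl : (fun m => \sum_(x <- X) `|u x * (S_ m x - S_ n x)|) @ \oo -->
      \sum_(x <- X) `|u x * (E x - S_ n x)|.
    apply: cvg_seq_sum => x xX; apply: cvg_norm; apply: cvgM; first exact: cvg_cst.
    by apply: cvgB; [exact/ES/XD|exact: cvg_cst].
  have cvr : (fun m => c * (K m - K n)) @ \oo --> c * (expR (A * t) - K n).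
    by apply: cvgM; [exact: cvg_cst|apply: cvgB => //; exact: cvg_cst].
  apply: (ler_cvg_to cvl cvr).
  by near=> m; apply: KS => //; near: m; exact: nbhs_infty_ge.
split.
  exists (c * (expR (A * t) - K 0)) => X uX XD; apply: le_trans (KE 0 X uX XD).
  by apply: ler_sum => x _; rewrite /S_ big_nil subr0.
move=> e e0; have e2 : 0 < e / 2 by rewrite divr_gt0.
have cv2 : (fun m => c * (expR (A * t) - K m)) @ \oo --> (0 : R).
  rewrite -(mulr0 c) -(subrr (expR (A * t))).
  by apply: cvgM; [exact: cvg_cst|apply: cvgB => //; exact: cvg_cst].
have [n [nK ns]] : exists n, c * (expR (A * t) - K n) <= e / 2 /\ `|s - series (fun k => t ^+ k / k`!%:R * iter k colop u y) n| <= e / 2.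
  near \oo => n; exists n; split; near: n.
    have /cvgrPdist_le/(_ _ e2) := cv2; apply: filterS => n.
    by rewrite sub0r normrN; apply: le_trans; exact: ler_norm.
  by have /cvgrPdist_le/(_ _ e2) := ss.
(* A list containing the balls of radius less than n sums the first n terms of the series
   exactly. *)
exists (flatten [seq ball y k | k <- iota 0 n]).
  move=> x /flatten_mapP[k _]; rewrite /ball; elim: (k) x => [|m IH] x /=.
    by rewrite inE => /eqP ->.
  by rewrite mem_undup => /flatten_mapP[z /IH Dz]; exact: nbD.
move=> X uX XD bX.
have SX : \sum_(x <- X) u x * S_ n x =
    series (fun k => t ^+ k / k`!%:R * iter k colop u y) n.
  rewrite /S_ /series/=; under eq_bigr do rewrite mulr_sumr.
  rewrite exchange_big/= big_seq [RHS]big_seq; apply: eq_bigr => k.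
  rewrite mem_index_iota => /andP[_ kn].
  rewrite -(@finpow_sum R S D b nb unb nbD nbC nb_supp k u y X)//.
    by rewrite mulr_sumr; apply: eq_bigr => x _; ring.
  move=> x xb; apply: bX; apply/flatten_mapP; exists k => //.
  by rewrite mem_iota.
have -> : \sum_(x <- X) u x * E x - s =
    \sum_(x <- X) u x * (E x - S_ n x) + (\sum_(x <- X) u x * S_ n x - s).
  by rewrite addrA -big_split/=; congr (_ - _); apply: eq_bigr => x _; ring.
rewrite (le_trans (ler_normD _ _))// SX distrC (splitr e) lerD//.
  by rewrite (le_trans (ler_norm_sum _ _ _))// (le_trans (KE n X uX XD)).
Unshelve. all: by end_near. Qed.

End ExpSum2.

(** * Partitions moving by nearest-neighbour jumps *)

Section Lists.
Variable T : eqType.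
Implicit Types (c l : seq T) (cs : seq (seq T)).

Definition prodl cs : seq (seq T) :=
  foldr (fun c acc => [seq a :: l | a <- c, l <- acc]) [:: [::]] cs.

Lemma mem_prodl cs l : (l \in prodl cs) = all2 (fun a c => a \in c) l cs.
Proof.
elim: cs l => [|c cs IH] [|a l] //=.
  by apply/negP => /allpairsP[[u v]] [].
apply/allpairsP/andP => [[[u v]] /= [uc vcs [-> ->]]|[ac lcs]]; first by rewrite -IH.
by exists (a, l); rewrite IH.
Qed.

Lemma prodl_uniq cs : all uniq cs -> uniq (prodl cs).
Proof.
elim: cs => [//|c cs IH] /= /andP[uc /IH ucs].
by apply: allpairs_uniq => // -[u v] [u' v'] _ _ /= [-> ->].
Qed.

Lemma big_prodl_cons (R : realType) c cs (F : seq T -> R) :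
  \sum_(l <- prodl (c :: cs)) F l = \sum_(a <- c) \sum_(l <- prodl cs) F (a :: l).
Proof. exact: (big_allpairs_dep (r1 := c) (r2 := fun=> prodl cs)). Qed.

Lemma big_prodl_rcons (R : realType) cs c (F : seq T -> R) :
  \sum_(l <- prodl (rcons cs c)) F l = \sum_(l <- prodl cs) \sum_(a <- c) F (rcons l a).
Proof.
elim: cs F => [|c' cs IH] F.
  rewrite big_prodl_cons [RHS]big_seq1; apply: eq_bigr => a _.
  by rewrite big_seq1.
rewrite rcons_cons !big_prodl_cons; apply: eq_bigr => a _; exact: IH.
Qed.

Lemma size_prodl cs : size (prodl cs) = (\prod_(c <- cs) size c)%N.
Proof.
elim: cs => [|c cs IH]; first by rewrite big_nil.
by rewrite big_cons -IH /prodl /= size_allpairs.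
Qed.

End Lists.

Definition nb1 (a : nat) : seq nat := if a is a'.+1 then [:: a'; a; a.+1] else [:: 0%N; 1%N].

Lemma mem_nb1 (a v : nat) : (v \in nb1 a) = (v <= a.+1)%N && (a <= v.+1)%N.
Proof. by case: a => [|a]; rewrite /nb1 !inE; lia. Qed.

Lemma nb1_uniq a : uniq (nb1 a).
Proof. by case: a => [|a] //=; rewrite !inE; lia. Qed.

Definition nbl (x : seq nat) : seq (seq nat) := prodl (map nb1 x).

Lemma nbl_uniq x : uniq (nbl x).
Proof. by apply: prodl_uniq; apply/allP => _ /mapP[a _ ->]; exact: nb1_uniq. Qed.

Lemma all2_nthP (S T : Type) (s0 : S) (t0 : T) (r : S -> T -> bool) s t :
  reflect (size s = size t /\ forall i, (i < size t)%N -> r (nth s0 s i) (nth t0 t i))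
    (all2 r s t).
Proof.
elim: s t => [|a s IH] [|b t] /=; [by constructor|by constructor; case|by constructor; case|].
apply: (iffP andP) => [[rab /IH[-> H]]|[[st] H]].
  by split => // -[|i] /=; [|exact: H].
split; first exact: (H 0%N).
by apply/IH; split => // i it; exact: (H i.+1).
Qed.

Lemma mem_nbl (x y : seq nat) : reflect (size y = size x /\
  forall i, (i < size x)%N -> (nth 0%N y i <= (nth 0%N x i).+1)%N /\ (nth 0%N x i <= (nth 0%N y i).+1)%N)
  (y \in nbl x).
Proof.
rewrite /nbl mem_prodl; apply: (iffP (all2_nthP 0%N [::] _ _ _)); rewrite size_map.
  move=> [sxy H]; split => // i ix; have := H i ix.
  by rewrite (nth_map 0%N)// mem_nb1 => /andP.
move=> [sxy H]; split => // i ix.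
by rewrite (nth_map 0%N)// mem_nb1; apply/andP; exact: H.
Qed.

Lemma nbl_sym (x y : seq nat) : (y \in nbl x) = (x \in nbl y).
Proof.
have sym u v : u \in nbl v -> v \in nbl u.
  move=> /mem_nbl[s H]; apply/mem_nbl; split => // i; rewrite s => iv.
  by have [] := H i iv.
by apply/idP/idP; exact: sym.
Qed.

Lemma nbl_refl x : x \in nbl x.
Proof. by apply/mem_nbl; split => // i _; rewrite leqnSn. Qed.

Definition part (n : nat) (l : seq nat) : bool := (size l == n) && sorted geq l.

Lemma is_partP n l : is_part n l <-> part n l.
Proof. by split => [[/eqP ? ?]|/andP[/eqP ? ?]]; [apply/andP|]. Qed.

Lemma partP n l : reflect
  (size l = n /\ forall i, (i.+1 < n)%N -> (nth 0%N l i.+1 <= nth 0%N l i)%N) (part n l).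
Proof.
apply: (iffP andP) => [[/eqP s /(sortedP 0%N) H]|[s H]].
  by split => // i ik; apply: H; rewrite s.
by split; [exact/eqP|apply/(sortedP 0%N) => i; rewrite s => /H].
Qed.

Section Generator.
Variable R : realType.

(** The matrix of [kop b]. The last summand is the wall: for b = 1/2 it lowers the diagonal entry at
    0 to -3/2, for b = -1/2 it raises the rate from 0 to 1 up to 1. *)
Definition kap (b : bool) (u v : nat) : R :=
  (v == u.+1)%:R / 2 + (u == v.+1)%:R / 2 - (u == v)%:R +
  (if b then - ((u == 0%N) && (v == 0%N))%:R / 2 else ((u == 0%N) && (v == 1%N))%:R / 2).

(** Detailed balance. For b = -1/2 the value W(0) = 1, half of the others, compensates the doubled
    rate out of 0. *)
Lemma kap_sym b u v : Wt R b u * kap b u v = Wt R b v * kap b v u.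
Proof.
rewrite /kap /Wt; case: b; first by rewrite !mul1r (eq_sym u v) andbC; ring.
case: u => [|[|u]]; case: v => [|[|v]] /=; rewrite ?eqSS ?(eq_sym v) ?eqxx/=; try by field.
Qed.

Lemma kap_up b u : kap b u u.+1 = if ~~ b && (u == 0%N) then 1 else 1 / 2.
Proof.
rewrite /kap eqxx (ltn_eqF (ltnSn u)) (ltn_eqF (leqW (ltnSn u))) eqSS andbF.
by case: b; case: (u == 0%N) => /=; field.
Qed.

Lemma kap_down b u : kap b u.+1 u = 1 / 2.
Proof.
rewrite /kap eqxx (gtn_eqF (ltnSn u)) (ltn_eqF (leqW (ltnSn u))).
by case: b => /=; field.
Qed.

Lemma kap_stay b u : kap b u u = if b && (u == 0%N) then - 3 / 2 else -1.
Proof.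
rewrite /kap eqxx (ltn_eqF (ltnSn u)) andbb.
case: b; case: u => [|u] /=; rewrite ?andbF /=; by field.
Qed.

Lemma kap_far b u v : v \notin nb1 u -> kap b u v = 0.
Proof.
rewrite mem_nb1 => h; rewrite /kap.
have -> : (v == u.+1) = false by lia.
have -> : (u == v.+1) = false by lia.
have -> : (u == v) = false by lia.
have -> : (u == 0%N) && (v == 0%N) = false by lia.
have -> : (u == 0%N) && (v == 1%N) = false by lia.
by case: b; rewrite /= !mulr0n; field.
Qed.

Definition agree (n i : nat) (x y : seq nat) : bool :=
  all (fun j => (j == i) || (nth 0%N x j == nth 0%N y j)) (iota 0 n).

Lemma agreeP n i x y : reflect
  (forall j, (j < n)%N -> j != i -> nth 0%N x j = nth 0%N y j) (agree n i x y).
Proof.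
apply: (iffP allP) => H j.
  by move=> jn ji; have := H j; rewrite mem_iota (negbTE ji) => /(_ jn)/eqP.
rewrite mem_iota /= add0n => jn; have [//|ji] := eqVneq j i.
by apply/eqP/H.
Qed.

Lemma agree_sym n i x y : agree n i x y = agree n i y x.
Proof. by apply: eq_all => j; rewrite (eq_sym (nth _ x j)). Qed.

(** Between distinct partitions at most one index contributes; on the diagonal all of them do, and
    the diagonal rates of the particles add up. *)
Definition gen (b : bool) (n : nat) (x y : seq nat) : R :=
  \sum_(i < n) if agree n i x y then kap b (posn x n i) (posn y n i) else 0.

Definition upd (x : seq nat) (i v : nat) := set_nth 0%N x i v.

Lemma sum_agree n i x (P : pred (seq nat)) (F : seq nat -> R) : size x = n -> (i < n)%N ->
  \sum_(y <- nbl x | P y && agree n i x y) F y =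
  \sum_(v <- nb1 (nth 0%N x i) | P (upd x i v)) F (upd x i v).
Proof.
move=> sx lin.
have sz v : size (upd x i v) = n by rewrite size_set_nth sx; apply/maxn_idPr.
under eq_bigl do rewrite andbC.
rewrite -big_filter_cond -(big_map (upd x i) P F); apply: perm_big; apply: uniq_perm.
- by apply: filter_uniq; exact: nbl_uniq.
- rewrite map_inj_uniq ?nb1_uniq// => v w /(congr1 (fun s => nth 0%N s i)).
  by rewrite !nth_set_nth /= eqxx.
move=> y; rewrite mem_filter; apply/andP/mapP => [[/agreeP H /mem_nbl[sy yx]]|[v]].
  exists (nth 0%N y i); first by rewrite mem_nb1; apply/andP/yx; rewrite sx.
  apply: (@eq_from_nth _ 0%N); first by rewrite sz sy.
  move=> j; rewrite sy sx => jn; rewrite nth_set_nth /=.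
  by have [->//|ji] := eqVneq j i; rewrite -H.
rewrite mem_nb1 => /andP[v1 v2] ->; split.
  by apply/agreeP => j jn ji; rewrite nth_set_nth /= (negbTE ji).
apply/mem_nbl; split; first by rewrite sz.
by move=> j jn; rewrite nth_set_nth /=; have [->|] := eqVneq j i.
Qed.

Lemma part_upd n x i v : part n x -> (i < n)%N -> v \in nb1 (nth 0%N x i) ->
  part n (upd x i v) = (v <= nth 0%N x i)%N && (nth 0%N x i <= v)%N ||
    ((nth 0%N x i < v)%N && ((i == 0%N) || (v <= nth 0%N x i.-1)%N)) ||
    ((v < nth 0%N x i)%N && ((i.+1 == n) || (nth 0%N x i.+1 <= v)%N)).
Proof.
move=> /partP[sx px] lin; rewrite mem_nb1 => /andP[v1 v2].
have sz : size (upd x i v) = n by rewrite size_set_nth sx; apply/maxn_idPr.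
have H1 : i = 0%N \/ (nth 0%N x i <= nth 0%N x i.-1)%N.
  by case: (i) lin => [|k] kn; [left|right; apply: px].
have H2 : i.+1 = n \/ (nth 0%N x i.+1 <= nth 0%N x i)%N.
  have [->|n1] := eqVneq i.+1 n; first by left.
  by right; apply: px; rewrite ltn_neqAle n1.
apply/partP/idP => [[_ H]|H].
  have h1 : i = 0%N \/ (v <= nth 0%N x i.-1)%N.
    case: (i) lin H => [|k] kn H; [by left|right].
    by have := H k kn; rewrite !nth_set_nth /= eqxx (ltn_eqF (ltnSn k)).
  have h2 : i.+1 = n \/ (nth 0%N x i.+1 <= v)%N.
    have [->|n1] := eqVneq i.+1 n; first by left.
    right; have := H i; rewrite !nth_set_nth /= eqxx (gtn_eqF (ltnSn i)).
    by apply; rewrite ltn_neqAle n1.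
  by lia.
split => // k kn; rewrite !nth_set_nth /=.
have := px k kn.
have [E1|] := eqVneq k i; have [E2|] := eqVneq k.+1 i; try lia.
  by move: H1 H2 H; rewrite -E1; lia.
by move: H1 H2 H; rewrite -E2 /=; lia.
Qed.

Definition updf (p : nat -> nat) (i v : nat) : nat -> nat := fun k => if k == i then v else p k.

(* Jumps leaving the set of partitions produce equal positions, where an alternating
   function vanishes: the particles evolve as if they did not see each other. *)
Lemma gen_alternating b n x (Phi : (nat -> nat) -> R) : part n x ->
  (forall p q, (forall i, (i < n)%N -> p i = q i) -> Phi p = Phi q) ->
  (forall p i j, (i < n)%N -> (j < n)%N -> i != j -> p i = p j -> Phi p = 0) ->
  \sum_(y <- nbl x | part n y) gen b n x y * Phi (posn y n) =
  \sum_(i < n) kop b (fun v => Phi (updf (posn x n) i v)) (posn x n i).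
Proof.
move=> px ext alt.
transitivity (\sum_(i < n) \sum_(y <- nbl x | part n y && agree n i x y)
    kap b (posn x n i) (posn y n i) * Phi (posn y n)).
  under eq_bigr do rewrite mulr_suml.
  rewrite exchange_big/=; apply: eq_bigr => i _; rewrite [RHS]big_mkcondr/=.
  by apply: eq_bigr => y _; case: ifP; rewrite ?mul0r.
have [sx px'] := partP _ _ px.
apply: eq_bigr => -[i lin] _ /=; rewrite sum_agree//.
set a := nth 0%N x i; set c := (n - i.+1)%N.
pose T v := Phi (updf (posn x n) i v).
have PhiE v : Phi (posn (upd x i v) n) = T (v + c)%N.
  by apply: ext => k kn; rewrite /updf /posn nth_set_nth /=; case: eqP => [->|].
have T0 v : v \in nb1 a -> ~~ part n (upd x i v) -> T (v + c)%N = 0.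
  move=> va; rewrite (part_upd px)// -/a => H; move: va; rewrite mem_nb1 => va.
  have [av|av|av] := ltngtP a v; last by lia.
    have i0 : (0 < i)%N by lia.
    have h := px' i.-1; rewrite prednK// in h; have {}h := h lin.
    apply: (alt _ i i.-1) => //; [lia|lia|].
    by rewrite /updf eqxx /posn /c; case: eqP; lia.
  have i1 : (i.+1 < n)%N by lia.
  have h := px' i i1.
  apply: (alt _ i i.+1) => //; [lia|].
  by rewrite /updf eqxx /posn /c; case: eqP; lia.
transitivity (\sum_(v <- nb1 a) kap b (a + c) (v + c) * T (v + c)%N).
  rewrite big_mkcond/= big_seq [RHS]big_seq; apply: eq_bigr => v va.
  case: ifP => pv; last by rewrite T0 ?pv// mulr0.
  by rewrite PhiE /posn nth_set_nth/= eqxx.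
rewrite -/T -[posn x n i]/(a + c)%N.
case Ea: a => [|a'].
  rewrite /nb1 !big_cons big_nil add0n add1n addr0 kap_stay kap_up.
  case Ec: c => [|c']; first by case: (b); rewrite /kop /=; field.
  (* An entry 0 cannot decrease, yet [kop] contains the downward jump of its position. The next
     particle sits exactly there, so the alternating function vanishes. *)
  have T1 : T c' = 0.
    have i1 : (i.+1 < n)%N by lia.
    have h := px' i i1.
    apply: (alt _ i i.+1) => //; [lia|].
    by rewrite /updf eqxx /posn; case: eqP; lia.
  by rewrite /kop T1 andbF /= andbF; field.
rewrite /nb1 !big_cons big_nil !addSn kap_stay kap_up kap_down /= !andbF addr0.
by field.
Qed.
End Generator.

(** * Interlacing determinants and the intertwining relation *)

Section Interlacing.
Variable R : realType.

Definition sdecr (n : nat) (X : nat -> nat) := forall i j, (i < j < n)%N -> (X j < X i)%N.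

(** Interlacing makes the matrix upper triangular with ones on the diagonal. *)
Lemma det_le_mx n (X Y : nat -> nat) : sdecr n X -> sdecr n Y ->
  (forall i, (i < n)%N -> (Y i <= X i)%N /\ ((0 < i)%N -> (X i < Y i.-1)%N)) ->
  \det (\matrix_(i < n, j < n) ((Y j <= X i)%N%:R : R)) = 1.
Proof.
move=> dX dY H; rewrite -det_tr det_trig.
  by apply: big1 => i _; rewrite !mxE; case: (H i (ltn_ord i)) => -> _.
apply/is_trig_mxP => i j ij; rewrite !mxE.
have [_ Hj] := H j (ltn_ord j); have {}Hj := Hj (leq_ltn_trans (leq0n i) ij).
suff -> : (Y i <= X j)%N = false by [].
have [ij1|ij1] := eqVneq (i : nat) j.-1; first by rewrite ij1; lia.
have : (i < j.-1 < n)%N by have := ltn_ord j; lia.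
by move/dY; lia.
Qed.

Lemma det_eq_row n (A : 'M[R]_n) (i k : 'I_n) : i != k -> (forall j, A i j = A k j) -> \det A = 0.
Proof. by move=> ik H; exact: (determinant_alternate ik H). Qed.

Lemma det_eq_col n (A : 'M[R]_n) (i k : 'I_n) : i != k -> (forall j, A j i = A j k) -> \det A = 0.
Proof. by move=> ik H; rewrite -det_tr; apply: (det_eq_row ik) => j; rewrite !mxE. Qed.

(** If some X_k < Y_k, then for the least such k the columns k - 1 and k coincide, or column 0
    vanishes when k = 0. Otherwise some Y_k <= X_(k+1), and for the least such k the rows k and k +
    1 coincide. *)
Lemma det_le_mx0 n (X Y : nat -> nat) : sdecr n X -> sdecr n Y ->
  ~ (forall i, (i < n)%N -> (Y i <= X i)%N /\ ((0 < i)%N -> (X i < Y i.-1)%N)) ->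
  \det (\matrix_(i < n, j < n) ((Y j <= X i)%N%:R : R)) = 0.
Proof.
move=> dX dY H.
have wX i j : (i <= j < n)%N -> (X j <= X i)%N.
  move=> /andP[]; rewrite leq_eqVlt => /predU1P[->//|ij jn].
  by apply/ltnW/dX; rewrite ij.
have wY i j : (i <= j < n)%N -> (Y j <= Y i)%N.
  move=> /andP[]; rewrite leq_eqVlt => /predU1P[->//|ij jn].
  by apply/ltnW/dY; rewrite ij.
have [exA|noA] := boolP [exists i : 'I_n, (X i < Y i)%N].
  have ex : exists k, (k < n)%N && (X k < Y k)%N.
    by case/existsP: exA => i iX; exists i; rewrite ltn_ord.
  have [k /andP[kn kX] kmin] := ex_minnP ex.
  case: k kn kX kmin => [|k] kn kX kmin.
    rewrite (expand_det_col _ (Ordinal kn)) big1// => i _; rewrite !mxE /=.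
    suff -> : (Y 0%N <= X i)%N = false by rewrite mul0r.
    by have := wX 0%N i; rewrite leq0n ltn_ord => /(_ isT); lia.
  have k1 : (Y k <= X k)%N.
    rewrite leqNgt; apply/negP => h; have := kmin k; rewrite (ltnW kn) h => /(_ isT).
    by rewrite ltnn.
  apply: (@det_eq_col _ _ (Ordinal (ltnW kn)) (Ordinal kn)).
    by rewrite -val_eqE /= ltn_eqF.
  move=> i; rewrite !mxE /=; congr (nat_of_bool _)%:R.
  have dk : (Y k.+1 < Y k)%N by apply: dY; rewrite ltnSn.
  have [ik|ki] := leqP i k.
    by have := wX i k; rewrite ik (ltnW kn) => /(_ isT); lia.
  by have := wX k.+1 i; rewrite ki ltn_ord => /(_ isT); lia.
have A i : (i < n)%N -> (Y i <= X i)%N.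
  move=> lin; rewrite leqNgt; apply: contra noA => h.
  by apply/existsP; exists (Ordinal lin).
have ex : exists k, (k.+1 < n)%N && (Y k <= X k.+1)%N.
  apply: contrapT => nex; apply: H => i lin; split; first exact: A.
  case: i lin => [//|i] lin _; rewrite ltnNge; apply/negP => h.
  by apply: nex; exists i; rewrite lin.
have [k /andP[kn kX] kmin] := ex_minnP ex.
apply: (@det_eq_row _ _ (Ordinal (ltnW kn)) (Ordinal kn)).
  by rewrite -val_eqE /= ltn_eqF.
move=> j; rewrite !mxE /=; congr (nat_of_bool _)%:R.
have dk : (X k.+1 < X k)%N by apply: dX; rewrite ltnSn.
have [kj|jk] := leqP k j.
  by have := wY k j; rewrite kj ltn_ord => /(_ isT); lia.
have h : (X k < Y k.-1)%N.
  rewrite ltnNge; apply/negP => h; have := kmin k.-1.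
  rewrite (ltn_predK jk) (ltnW kn) h => /(_ isT); lia.
have := wY j k.-1; have -> : (j <= k.-1 < n)%N by lia.
by move=> /(_ isT); lia.
Qed.

(* Both kinds of interlacing at once: [m] is padded with zeros, so it may have one
   entry less than [x]. *)
Definition il (m x : seq nat) : bool :=
  all (fun i => (nth 0%N m i <= nth 0%N x i)%N && ((i == 0%N) || (nth 0%N x i <= nth 0%N m i.-1)%N))
    (iota 0 (size x)).

Lemma ilP m x : reflect (forall i, (i < size x)%N ->
  (nth 0%N m i <= nth 0%N x i)%N /\ ((0 < i)%N -> (nth 0%N x i <= nth 0%N m i.-1)%N)) (il m x).
Proof.
apply: (iffP allP) => H i.
  move=> ix; have := H i; rewrite mem_iota => /(_ ix)/andP[-> h]; split => //.
  by case: (i) h.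
rewrite mem_iota => ix; have [//|-> h] := H i; apply/andP; split => //.
by case: (i) h => //= k; apply.
Qed.

(** Unlike [part n] it leaves the length free, so a partition with one entry less, padded with 0,
    qualifies. *)
Definition wdecr (n : nat) (l : seq nat) :=
  forall i, (i.+1 < n)%N -> (nth 0%N l i.+1 <= nth 0%N l i)%N.

Lemma wdecr_posn n l : wdecr n l -> sdecr n (posn l n).
Proof.
move=> H i j /andP[ij jn].
have le : (nth 0%N l j <= nth 0%N l i)%N.
  elim: j ij jn => [//|j IH]; rewrite ltnS leq_eqVlt => /predU1P[->|ij] jn; first exact: H.
  by apply: leq_trans (IH ij (ltnW jn)); exact: H.
by rewrite /posn; lia.
Qed.

Lemma part_wdecr n l : part n l -> wdecr n l.
Proof. by case/partP. Qed.

Lemma part_wdecr_pred n l : part n.-1 l -> wdecr n l.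
Proof.
move=> /partP[s H] i lin; have [h|h] := ltnP i.+1 n.-1; first exact: H.
by rewrite nth_default ?s.
Qed.

(** In positions the upper interlacing inequality becomes strict, as [det_le_mx] requires. If [m] is
    padded, its last position is 0 and gives a column of ones. *)
Lemma det_il n m x : wdecr n m -> part n x ->
  \det (\matrix_(i < n, j < n) ((posn m n j <= posn x n i)%N%:R : R)) = (il m x)%:R.
Proof.
move=> dm px; have dX := wdecr_posn (part_wdecr px); have dY := wdecr_posn dm.
have [sx _] := partP _ _ px.
have eqv : (forall i, (i < n)%N -> (posn m n i <= posn x n i)%N /\
     ((0 < i)%N -> (posn x n i < posn m n i.-1)%N)) <-> il m x.
  split => [H|/ilP H].
    apply/ilP => i; rewrite sx => lin; have [] := H i lin; rewrite /posn => h1 h2.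
    by split => [|i0]; [|have := h2 i0]; lia.
  move=> i lin; have := H i; rewrite sx => /(_ lin)[]; rewrite /posn => h1 h2.
  by split => [|i0]; [|have := h2 i0]; lia.
have [h|h] := boolP (il m x); first by apply: det_le_mx => //; apply/eqv.
by apply: det_le_mx0 => // /eqv; rewrite (negbTE h).
Qed.

Lemma kop_sum (b : bool) (I : finType) (c : I -> R) (f : I -> nat -> R) u :
  kop b (fun v => \sum_i f i v * c i) u = \sum_i kop b (f i) u * c i.
Proof.
have E (k1 k2 k3 : R) a b' d : k1 * (\sum_i f i a * c i) + k2 * (\sum_i f i b' * c i) +
    k3 * (\sum_i f i d * c i) = \sum_i (k1 * f i a + k2 * f i b' + k3 * f i d) * c i.
  by rewrite !mulr_sumr -!big_split/=; apply: eq_bigr => i _; ring.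
case: u => [|u] /=.
  case: b.
    transitivity (2^-1 * (\sum_i f i 1%N * c i) + - (3 / 2) * (\sum_i f i 0%N * c i) +
       0 * (\sum_i f i 0%N * c i)); first by field.
    by rewrite E; apply: eq_bigr => i _; field.
  transitivity (1 * (\sum_i f i 1%N * c i) + (-1) * (\sum_i f i 0%N * c i) +
       0 * (\sum_i f i 0%N * c i)); first by ring.
  by rewrite E; apply: eq_bigr => i _; ring.
transitivity (2^-1 * (\sum_i f i u.+2 * c i) + 2^-1 * (\sum_i f i u * c i) +
       (-1) * (\sum_i f i u.+1 * c i)); first by field.
by rewrite E; apply: eq_bigr => i _; field.
Qed.

(** Only row [i] moves and the determinant is linear in it, so [kop] passes to the entries. The map
    [g] makes room for positions shifted by one. *)
Lemma det_row_kop n (b : bool) (f : nat -> 'I_n -> R) (p g : nat -> nat) (i : 'I_n) u :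
  kop b (fun v => \det (\matrix_(k < n, j < n) f (updf p i (g v) k) j)) u =
  \sum_(j < n) kop b (fun v => f (g v) j) u * cofactor (\matrix_(k < n, j < n) f (p k) j) i j.
Proof.
rewrite -kop_sum; apply: eq_kop => v; rewrite (expand_det_row _ i).
apply: eq_bigr => j _; rewrite mxE /updf eqxx; congr (_ * _).
rewrite /cofactor; congr (_ * \det _); apply/matrixP => k l; rewrite !mxE.
by have := neq_lift i k; rewrite -val_eqE eq_sym => /negbTE ->.
Qed.

Lemma det_col_kop n (b : bool) (f : nat -> 'I_n -> R) (p g : nat -> nat) (i : 'I_n) u :
  kop b (fun v => \det (\matrix_(k < n, j < n) f (updf p i (g v) j) k)) u =
  \sum_(j < n) kop b (fun v => f (g v) j) u * cofactor (\matrix_(k < n, j < n) f (p j) k) j i.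
Proof.
rewrite (@eq_kop _ _ _ (fun v => \det (\matrix_(k < n, j < n) f (updf p i (g v) k) j))).
  rewrite det_row_kop; apply: eq_bigr => j _; congr (_ * _).
  rewrite -cofactor_tr; congr (cofactor _ _ _).
  by apply/matrixP => k l; rewrite !mxE.
by move=> v; rewrite -det_tr; congr (\det _); apply/matrixP => k l; rewrite !mxE.
Qed.

(** Siegmund duality at the level of generators: the reflected walk acting on the lower variable of
    the indicator Y <= X equals the killed walk acting on the upper one. *)
Lemma kop_le_odd X Y : kop false (fun v => (v <= X)%N%:R : R) Y = kop true (fun v => (Y <= v)%N%:R) X.
Proof.
case: Y => [|Y]; case: X => [|X]; rewrite /kop ?ltnS ?leq0n ?ltn0.
- by rewrite ?mulr0n ?mulr1n; field.
- by rewrite ?mulr0n ?mulr1n; field.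
- by case: Y => [|Y]; rewrite ?ltnS ?leq0n ?ltn0 ?mulr0n ?mulr1n; field.
- by field.
Qed.

(** The dual pair in the other order, with positions shifted by one. The killing leaves a defect at
    0, which cancels only in the whole determinant, see [intertwine]. *)
Lemma kop_le_even X q : kop true (fun v => (v.+1 <= X)%N%:R : R) q =
  kop false (fun v => (q.+1 <= v)%N%:R) X - (q == 0%N)%:R.
Proof.
case: q => [|q]; case: X => [|X]; rewrite /kop ?eqxx ?ltnS ?leq0n ?ltn0 /=.
- by rewrite ?mulr0n ?mulr1n; field.
- by rewrite ?mulr0n ?mulr1n; field.
- by rewrite ?mulr0n ?mulr1n; field.
- by rewrite ?mulr0n ?mulr1n; field.
Qed.

(* [M] counts the levels used so far: the M-th level of the paper has n = uphalf M and
   b = 1/2 iff M is even. *)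
Definition sgen (M : nat) : seq nat -> seq nat -> R := gen R (~~ odd M) (uphalf M).

Lemma gen_il_row b n m x : wdecr n m -> part n x ->
  \sum_(y <- nbl x | part n y) gen R b n x y * (il m y)%:R =
  \sum_(i < n) \sum_(j < n) kop b (fun v => (posn m n j <= v)%N%:R) (posn x n i) *
    cofactor (\matrix_(k < n, l < n) ((posn m n l <= posn x n k)%N%:R : R)) i j.
Proof.
move=> dm px; pose Phi (p : nat -> nat) : R :=
  \det (\matrix_(i < n, j < n) ((posn m n j <= p i)%N%:R : R)).
rewrite (eq_bigr (fun y => gen R b n x y * Phi (posn y n))); last first.
  by move=> y py; rewrite /Phi det_il.
rewrite gen_alternating//.
- apply: eq_bigr => i _.
  exact: (@det_row_kop n b (fun v j => (posn m n j <= v)%N%:R) (posn x n) id i).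
- move=> p q pq; congr (\det _); apply/matrixP => i j; rewrite !mxE pq//.
- move=> p i j lin ljn ij pij; apply: (@det_eq_row _ _ (Ordinal lin) (Ordinal ljn)) => //.
  by move=> k; rewrite !mxE /= pij.
Qed.

(** Both sides expand into entries of the interlacing matrix acted on by [kop], multiplied by the
    same cofactors; the one-particle dualities match them entry by entry. *)
Lemma intertwine M m x : part (uphalf M) m -> part (uphalf M.+1) x ->
  \sum_(z <- nbl m | part (uphalf M) z) sgen M m z * (il z x)%:R =
  \sum_(y <- nbl x | part (uphalf M.+1) y) sgen M.+1 x y * (il m y)%:R.
Proof.
rewrite /sgen [uphalf M.+1]/= uphalf_half; move: (M./2) => n'.
set n := n'.+1 => pm px.
have dm : wdecr n m.
  by move: pm; case: (odd M) => /=; [exact: part_wdecr|exact: (@part_wdecr_pred n)].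
rewrite gen_il_row//.
set A := \matrix_(k < n, l < n) _.
case: (boolP (odd M)) pm => oM /=; rewrite ?add1n ?add0n => pm.
  pose Phi (q : nat -> nat) : R := \det (\matrix_(i < n, j < n) ((q j <= posn x n i)%N%:R : R)).
  rewrite (eq_bigr (fun z => gen R false n m z * Phi (posn z n))); last first.
    by move=> z pz; rewrite /Phi det_il//; exact: part_wdecr.
  rewrite gen_alternating//; last 2 first.
  - by move=> p q pq; congr (\det _); apply/matrixP => i j; rewrite !mxE pq.
  - move=> p i j lin ljn ij pij; apply: (@det_eq_col _ _ (Ordinal lin) (Ordinal ljn)) => //.
    by move=> k; rewrite !mxE /= pij.
  rewrite [RHS]exchange_big/=; apply: eq_bigr => j _.
  rewrite (@det_col_kop n false (fun v k => (v <= posn x n k)%N%:R) (posn m n) id j).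
  by apply: eq_bigr => i _; rewrite kop_le_odd oM.
(* Seen among n particles, the n' positions move up by one and the padding entry sits at position
   0. *)
pose ext (z : seq nat) j := if (j < n')%N then (posn z n' j).+1 else 0%N.
have psE z j : part n' z -> (j < n)%N -> ext z j = posn z n j.
  move=> /partP[sz _] jn; rewrite /ext; case: ifP => h; first by rewrite /posn; lia.
  by rewrite /posn nth_default ?sz; lia.
pose Phi (q : nat -> nat) : R := \det (\matrix_(i < n, j < n)
    (((if (j < n')%N then (q j).+1 else 0%N) <= posn x n i)%N%:R : R)).
rewrite (eq_bigr (fun z => gen R true n' m z * Phi (posn z n'))); last first.
  move=> z pz; rewrite -(@det_il n)//; last exact: (@part_wdecr_pred n).
  by congr (_ * \det _); apply/matrixP => i j; rewrite !mxE -(psE z).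
rewrite gen_alternating//; last 2 first.
- move=> p q pq; congr (\det _); apply/matrixP => i j; rewrite !mxE.
  by case: ifP => // h; rewrite pq.
- move=> p i j lin ljn ij pij.
  apply: (@det_eq_col _ _ (Ordinal (leqW lin : (i < n)%N)) (Ordinal (leqW ljn : (j < n)%N))) => // k.
  by rewrite !mxE /= lin ljn pij.
(* The column of the padding entry is constantly 1, and the reflected generator annihilates
   constants. *)
rewrite [RHS]exchange_big big_ord_recr/= [X in _ + X]big1 ?addr0; last first.
  move=> i _; rewrite (negbTE oM) (@eq_kop _ _ _ (fun=> 1)).
    by rewrite /kop; case: (posn x n i) => [|u]; rewrite ?subrr ?mul0r//; field.
  by move=> v; rewrite -(psE m) // /ext ltnn leq0n.
rewrite (negbTE oM); apply: eq_bigr => j _; set j' := widen_ord _ j.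
have jn := ltn_ord j.
rewrite (@eq_kop _ _ _ (fun v => \det (\matrix_(k < n, l < n)
   (((updf (posn m n) j' v.+1 l) <= posn x n k)%N%:R : R)))); last first.
  move=> v; congr (\det _); apply/matrixP => k l; rewrite !mxE /updf /=.
  case: eqP => [->|_]; first by rewrite jn.
  by rewrite -(psE m).
rewrite (@det_col_kop n true (fun v k => (v <= posn x n k)%N%:R) (posn m n) S j').
rewrite -/A; set q := posn m n' j.
have qE : posn m n j = q.+1 by rewrite -(psE m) /ext ?jn// leqW.
rewrite (eq_bigr (fun i : 'I_n =>
   kop false (fun v => (posn m n j <= v)%N%:R) (posn x n i) * cofactor A i j' -
   (q == 0%N)%:R * cofactor A i j')); last first.
  by move=> i _; rewrite -mulrBl qE -kop_le_even.
rewrite sumrB -[RHS]subr0; congr (_ - _).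
rewrite -mulr_sumr.
(* The defects add up to the cofactors of column [j'] paired with the last column, which consists of
   ones: an off-diagonal entry of adj(A) A, hence 0. *)
have := congr1 (fun B : 'M[R]_n => B j' ord_max) (mul_adj_mx A).
rewrite !mxE (_ : (j' == ord_max) = false); last first.
  by apply/negbTE; rewrite -val_eqE /= ltn_eqF.
rewrite mulr0n => H; rewrite (_ : \sum_(i < n) _ = 0) ?mulr0// -[RHS]H.
apply: eq_bigr => i _; rewrite !mxE -(psE m)// /ext ltnn leq0n mulr1.
by [].
Qed.

End Interlacing.

(** * The generator on interlacing arrays *)

Section Paths.

(** A decidable form of [JN]. The list [[::]] put in front serves as a level below the first one; it
    interlaces with every one-entry list. *)
Definition pathb (M : nat) (s : seq (seq nat)) : bool :=
  (size s == M) && all (fun k => part (lvn k) (nth [::] s k) &&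
     il (nth [::] ([::] :: s) k) (nth [::] s k)) (iota 0 M).

Lemma nlev_stage M : nlev (uphalf M) (~~ odd M) = M.
Proof. by rewrite /nlev; case: ifP => h; lia. Qed.

Lemma stage_nlev N a : (0 < N)%N -> uphalf (nlev N a) = N /\ ~~ odd (nlev N a) = a.
Proof. by rewrite /nlev; case: a => h; split; lia. Qed.

Lemma lvnE k : lvn k = uphalf k.+1. Proof. by []. Qed.

Lemma interlace_il k lam mu : part (lvn k) lam -> part (lvn k.+1) mu ->
  interlace k lam mu <-> il lam mu.
Proof.
move=> /partP[sl _] /partP[sm _]; rewrite /interlace /lvb.
have sE : lvn k.+1 = (odd k + lvn k)%N by rewrite /lvn /=; lia.
split.
  move=> H; apply/ilP => i; rewrite sm sE => lin; case: (odd k) lin H => /= lin H.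
    split; last by case: i lin => // i lin _; have [] := H i lin.
    have [h|h] := ltnP i (lvn k); first by have [] := H i h.
    by rewrite nth_default ?sl.
  by have [] := H i lin.
move=> /ilP; rewrite sm sE; case: (odd k) => /= H i lin.
  by split; [have [_] := H i.+1 lin; apply|have [] := H i (leqW lin)].
exact: H.
Qed.

Lemma JN_pathb M s : JN (uphalf M) (~~ odd M) s <-> pathb M s.
Proof.
rewrite /JN nlev_stage /pathb; split.
  move=> [sM [P I]]; apply/andP; split; first exact/eqP.
  apply/allP => k; rewrite mem_iota add0n => /= kM.
  have pk : part (lvn k) (nth [::] s k) by apply/is_partP/P.
  rewrite pk /=; case: k kM pk => [|k] kM pk /=.
    by apply/ilP; have [-> _] := partP _ _ pk; case.
  by apply/(interlace_il _ pk); [apply/is_partP/P/ltnW|apply: I].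
move=> /andP[/eqP sM /allP H]; split => //.
have P k : (k < M)%N -> part (lvn k) (nth [::] s k).
  by move=> kM; have := H k; rewrite mem_iota => /(_ kM)/andP[].
split=> k kM; first exact/is_partP/P.
have := H k.+1; rewrite mem_iota => /(_ kM)/andP[_ h].
by apply/interlace_il => //; apply: P => //; exact: ltnW.
Qed.

Lemma pathb_rcons M s x : pathb M.+1 (rcons s x) =
  [&& pathb M s, part (lvn M) x & il (last [::] s) x].
Proof.
rewrite /pathb size_rcons eqSS; case: (size s =P M) => // sM; rewrite !andTb.
rewrite -(addn1 M) iotaD all_cat /= andbT add0n.
rewrite nth_rcons sM ltnn eqxx.
have -> : nth [::] ([::] :: rcons s x) M = last [::] s.
  by rewrite -rcons_cons nth_rcons /= sM ltnS leqnn -[X in nth _ _ X]sM (last_nth [::]).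
rewrite -andbA; congr (_ && _).
apply: eq_in_all => k; rewrite mem_iota add0n => /= kM.
by rewrite -rcons_cons !nth_rcons /= sM kM ltnS ltnW.
Qed.

Lemma pathb_size M s : pathb M s -> size s = M.
Proof. by case/andP => /eqP. Qed.

Lemma pathb_part M s k : pathb M s -> (k < M)%N -> part (lvn k) (nth [::] s k).
Proof.
by move=> /andP[_ /allP H] kM; have := H k; rewrite mem_iota => /(_ kM)/andP[].
Qed.

Lemma pathb_last M s : pathb M s -> part (uphalf M) (last [::] s).
Proof.
case: M => [|M] p; first by move: (pathb_size p) => /size0nil ->.
have sM := pathb_size p; rewrite (last_nth [::]) sM.
by have := pathb_part p (ltnSn M); case: s {p} sM.
Qed.

(* How a level [x] reacts to a jump bringing the level below to [t]: it is clamped to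
   the intervals prescribed by [t], which is the pushing rule. *)
Definition cl (x t : seq nat) : seq nat :=
  mkseq (fun i => if i is i'.+1 then maxn (nth 0%N t i) (minn (nth 0%N x i) (nth 0%N t i'))
                  else maxn (nth 0%N t 0%N) (nth 0%N x 0%N)) (size x).

Lemma size_cl x t : size (cl x t) = size x. Proof. exact: size_mkseq. Qed.

Lemma nth_cl x t i : (i < size x)%N -> nth 0%N (cl x t) i =
  if i is i'.+1 then maxn (nth 0%N t i) (minn (nth 0%N x i) (nth 0%N t i'))
  else maxn (nth 0%N t 0%N) (nth 0%N x 0%N).
Proof. by move=> ix; rewrite nth_mkseq. Qed.

Lemma cl_id x t : il t x -> cl x t = x.
Proof.
move=> /ilP H; apply: (@eq_from_nth _ 0%N); first exact: size_cl.
move=> i; rewrite size_cl => ix; rewrite nth_cl//.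
case: i ix => [|i] ix; move: (H _ ix) => [h1 h2]; [lia|]. by move: (h2 isT) h1; rewrite /=; lia.
Qed.

Lemma il_cl x t : wdecr (size x) t -> il t (cl x t).
Proof.
move=> dt; apply/ilP => i; rewrite size_cl => ix; rewrite nth_cl//.
by case: i ix => [|i] ix; split => //; [lia| |move: (dt _ ix)]; rewrite /=; lia.
Qed.

Lemma part_il n t y : wdecr n t -> size y = n -> il t y -> part n y.
Proof.
move=> dt sy /ilP H; apply/partP; split => // i lin.
have [_ h1] := H i.+1 (ltac:(by rewrite sy)).
have [h2 _] := H i (ltac:(by rewrite sy ltnW)).
exact: leq_trans (h1 isT) h2.
Qed.

Lemma cl_nbl x u t : il u x -> wdecr (size x) t -> (forall i,
    (nth 0%N t i <= (nth 0%N u i).+1)%N /\ (nth 0%N u i <= (nth 0%N t i).+1)%N) ->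
  cl x t \in nbl x.
Proof.
move=> /ilP iux dt ut; apply/mem_nbl; split; first exact: size_cl.
move=> i ix; rewrite nth_cl//; move: (iux i ix).
case: i ix => [|i] ix [h1 h2]; first by move: (ut 0%N); lia.
by move: (ut i.+1) (ut i) (h2 isT) (dt i ix); rewrite /=; lia.
Qed.

(** [M] counts levels and [i] is the zero-based index k - 1; in this form arrays with M and M + 1
    levels can be compared. *)
Definition case1P (M : nat) (lam mu : seq (seq nat)) (p q i : nat) (c : int) : Prop :=
  (p <= q < M)%N /\ (i < lvn p)%N /\
  forall j m, (j < M)%N -> (m < lvn j)%N ->
    if (p <= j <= q)%N && (m == i) then ent lam j m = c /\ ent mu j m = c + 1
    else ent lam j m = ent mu j m.

Definition case2P (M : nat) (lam mu : seq (seq nat)) (p q i : nat) (c : int) : Prop :=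
  (p <= q < M)%N /\ (i < lvn p)%N /\
  (forall j, (p <= j <= q)%N -> (i + (j - p) < lvn j)%N) /\
  forall j m, (j < M)%N -> (m < lvn j)%N ->
    if (p <= j <= q)%N && (m == i + (j - p))%N then ent lam j m = c /\ ent mu j m = c - 1
    else ent lam j m = ent mu j m.

Lemma Case1E M lam mu : Case1 (uphalf M) (~~ odd M) lam mu <->
  exists p q i c, case1P M lam mu p q i c.
Proof.
rewrite /Case1 /Case1w nlev_stage; split => [[p [q [k [c [h1 [h2 h3]]]]]]|[p [q [i [c [h1 [h2 h3]]]]]]].
  by exists p, q, k.-1, c; split => //; split => //; lia.
by exists p, q, i.+1, c; split => //; split => //; lia.
Qed.

Lemma Case1aE M lam mu : Case1a (uphalf M) (~~ odd M) lam mu <->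
  exists p q, lvb p = false /\ case1P M lam mu p q (lvn p).-1 0.
Proof.
rewrite /Case1a /Case1w nlev_stage; split.
  move=> [p [q [k [c [[h1 [h2 h3]] [b [kE c0]]]]]]]; subst k c.
  by exists p, q; split => //; split => //; split => //; lia.
move=> [p [q [b [h1 [h2 h3]]]]]; exists p, q, (lvn p), 0.
by split; [split; [exact: h1|split; [rewrite leqnn|exact: h3]]|].
Qed.

Lemma Case2E M lam mu : Case2 (uphalf M) (~~ odd M) lam mu <->
  exists p q i c, case2P M lam mu p q i c.
Proof.
rewrite /Case2 nlev_stage; split => [[p [q [k [c [h1 [h2 [h3 h4]]]]]]]|[p [q [i [c [h1 [h2 [h3 h4]]]]]]]].
  exists p, q, k.-1, c; split => //; split; first by lia.
  by split => // j /h3; lia.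
exists p, q, i.+1, c; split; first exact: h1.
by split; [lia|split; [move=> j /h3; lia|exact: h4]].
Qed.

Lemma lvn_le j k : (j <= k)%N -> (lvn j <= lvn k)%N.
Proof. by rewrite /lvn ltnS; lia. Qed.

Lemma entrL l x j m : (j < size l)%N -> ent (rcons l x) j m = ent l j m.
Proof. by move=> jl; rewrite /ent nth_rcons jl. Qed.

Lemma entrR n l x m : size l = n -> ent (rcons l x) n m = (nth 0%N x m)%:Z.
Proof. by move=> <-; rewrite /ent nth_rcons ltnn eqxx. Qed.

Lemma eq_part n x y : size x = n -> size y = n ->
  (forall m, (m < n)%N -> (nth 0%N x m)%:Z = (nth 0%N y m)%:Z) -> x = y.
Proof.
move=> sx sy H; apply: (@eq_from_nth _ 0%N); first by rewrite sx sy.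
by move=> i; rewrite sx => /H[].
Qed.

Lemma pathb_ext M l m : pathb M l -> pathb M m ->
  (forall j k, (j < M)%N -> (k < lvn j)%N -> ent l j k = ent m j k) -> l = m.
Proof.
move=> pl pm H; apply: (@eq_from_nth _ [::]); first by rewrite !(pathb_size pl, pathb_size pm).
move=> j; rewrite (pathb_size pl) => jM.
have [sl _] := partP _ _ (pathb_part pl jM).
have [sm _] := partP _ _ (pathb_part pm jM).
by apply: (eq_part sl sm) => k kj; exact: H.
Qed.

End Paths.

(** * Jumps of an array, one level at a time *)

Section Steps.

Lemma part_wdecr_next M t : part (uphalf M) t -> wdecr (lvn M) t.
Proof.
rewrite uphalf_half /lvn; case: (odd M); first exact: part_wdecr.
exact: (@part_wdecr_pred M./2.+1).
Qed.

Lemma ent_last M l k : size l = M.+1 -> ent l M k = (nth 0%N (last [::] l) k)%:Z.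
Proof. by move=> sl; rewrite /ent -nth_last sl. Qed.

Variables (M : nat) (l m : seq (seq nat)) (x y : seq nat).
Hypotheses (plx : pathb M.+1 (rcons l x)) (pmy : pathb M.+1 (rcons m y)).
Hypothesis lm : l <> m.

Let pl : pathb M l. Proof. by move: plx; rewrite pathb_rcons => /and3P[]. Qed.
Let pm : pathb M m. Proof. by move: pmy; rewrite pathb_rcons => /and3P[]. Qed.
Let sl : size l = M. Proof. exact: pathb_size pl. Qed.
Let sm : size m = M. Proof. exact: pathb_size pm. Qed.
Let sx : size x = lvn M.
Proof. by move: plx; rewrite pathb_rcons => /and3P[_ /partP[]]. Qed.
Let sy : size y = lvn M.
Proof. by move: pmy; rewrite pathb_rcons => /and3P[_ /partP[]]. Qed.
Let ilx : forall i, (i < lvn M)%N -> (nth 0%N (last [::] l) i <= nth 0%N x i)%N /\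
  ((0 < i)%N -> (nth 0%N x i <= nth 0%N (last [::] l) i.-1)%N).
Proof. by move: plx; rewrite pathb_rcons -sx => /and3P[_ _ /ilP]. Qed.
Let ily : forall i, (i < lvn M)%N -> (nth 0%N (last [::] m) i <= nth 0%N y i)%N /\
  ((0 < i)%N -> (nth 0%N y i <= nth 0%N (last [::] m) i.-1)%N).
Proof. by move: pmy; rewrite pathb_rcons -sy => /and3P[_ _ /ilP]. Qed.
Let ty : wdecr (lvn M) (last [::] m).
Proof. exact/part_wdecr_next/(pathb_last pm). Qed.
Let cly : cl y (last [::] m) = y.
Proof. by apply: cl_id; move: pmy; rewrite pathb_rcons => /and3P[]. Qed.

(** The top level has no choice once the levels below move. Start level, index and value stay fixed
    on both sides, because the rate depends on them; only the last level [q] may change. *)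
Lemma case1_step p i c : (exists q, case1P M.+1 (rcons l x) (rcons m y) p q i c) <->
  (exists q, case1P M l m p q i c) /\ y = cl x (last [::] m).
Proof.
split.
  move=> [q [/andP[pq qM] [ip H]]].
  have low j k : (j < M)%N -> (k < lvn j)%N ->
      if (p <= j <= q)%N && (k == i) then ent l j k = c /\ ent m j k = c + 1
      else ent l j k = ent m j k.
    by move=> jM kj; have := H j k (ltnW jM) kj; rewrite !entrL ?sl ?sm.
  have top k : (k < lvn M)%N ->
      if (p <= M <= q)%N && (k == i) then (nth 0%N x k)%:Z = c /\ (nth 0%N y k)%:Z = c + 1
      else (nth 0%N x k)%:Z = (nth 0%N y k)%:Z.
    by move=> kj; have := H M k (ltnSn M) kj; rewrite !entrR.
  have [qM'|Mq] := ltnP q M.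
    have xy : x = y.
      by apply: (eq_part sx sy) => k kM; have := top k kM; rewrite (leqNgt M) qM' andbF.
    by split; [exists q; split; [rewrite pq|split]|rewrite xy cly].
  have qE : q = M by lia.
  (* A jump that starts at the top level would leave the lower levels equal, against [lm]. *)
  subst q; have [pM|Mp] := ltnP p M; last first.
    case: lm; apply: (pathb_ext pl pm) => j k jM kj.
    by have := low j k jM kj; rewrite (leqNgt p) (leq_trans jM Mp).
  split.
    exists M.-1; split; first by lia.
    split => // j k jM kj; have := low j k jM kj.
    by have -> : (j <= M)%N = (j <= M.-1)%N by lia.
  have iM : (i < lvn M.-1)%N by apply: leq_trans ip (lvn_le _); lia.
  have iM' : (i < lvn M)%N by apply: leq_trans iM (lvn_le _); lia.
  have : (M.-1 < M)%N by lia.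
  move=> /low/(_ iM); have -> : (p <= M.-1 <= M)%N by lia.
  rewrite eqxx /= => -[l1 m1].
  rewrite ent_last in m1; last by rewrite sm prednK//; lia.
  have := top i iM'; rewrite (ltnW pM) leqnn eqxx /= => -[x1 y1].
  apply: (@eq_from_nth _ 0%N); first by rewrite size_cl sx sy.
  move=> j; rewrite sy => jM; rewrite nth_cl ?sx//; have [yj1 yj2] := ily jM.
  have := top j jM; have [->|ji] := eqVneq j i.
    by rewrite (ltnW pM) leqnn /= => _; move: (m1) (x1) (y1); case: (i) => [|i']; lia.
  rewrite andbF /= => xj; move: yj1 yj2 xj.
  by case: (j) => [|j']; rewrite /=; [|move=> h1 /(_ isT) h2]; lia.
move=> [[q [/andP[pq qM] [ip low]]] yE].
have M0 : (0 < M)%N by lia.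
have iM : (i < lvn M.-1)%N by apply: leq_trans ip (lvn_le _); lia.
have iM' : (i < lvn M)%N by apply: leq_trans iM (lvn_le _); lia.
have MM : (M.-1 < M)%N by lia.
have sM : M.-1.+1 = M by lia.
have lowtop k : (k < lvn M.-1)%N -> if (M.-1 <= q)%N && (k == i) then
     (nth 0%N (last [::] l) k)%:Z = c /\ (nth 0%N (last [::] m) k)%:Z = c + 1
   else (nth 0%N (last [::] l) k)%:Z = (nth 0%N (last [::] m) k)%:Z.
  move=> kM; have := low M.-1 k MM kM; rewrite !ent_last ?sM//.
  by have -> : (p <= M.-1)%N by lia.
have sL : size (last [::] l) = lvn M.-1 by have /partP[-> _] := pathb_last pl; rewrite lvnE sM.
have sT : size (last [::] m) = lvn M.-1 by have /partP[-> _] := pathb_last pm; rewrite lvnE sM.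
have ext q' : (p <= q' <= M)%N -> (forall j, (j < M)%N -> (j <= q')%N = (j <= q)%N) ->
   (forall k, (k < lvn M)%N ->
      if (p <= M <= q')%N && (k == i) then (nth 0%N x k)%:Z = c /\ (nth 0%N y k)%:Z = c + 1
      else (nth 0%N x k)%:Z = (nth 0%N y k)%:Z) ->
   exists q, case1P M.+1 (rcons l x) (rcons m y) p q i c.
  move=> /andP[pq' q'M] qq top; exists q'; split; first by rewrite pq'.
  split => // j k; rewrite ltnS leq_eqVlt => /predU1P[->|jM] kj.
    by have := top k kj; rewrite !entrR.
  by have := low j k jM kj; rewrite !entrL ?sl ?sm// qq.
have [qM1|qM1] := ltnP q M.-1.
  have LT : last [::] l = last [::] m.
    by apply: (eq_part sL sT) => k kM; have := lowtop k kM; rewrite (leqNgt M.-1) qM1.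
  apply: (ext q); [lia|by []|move=> k kM].
  rewrite (leqNgt M) qM andbF yE cl_id// -LT.
  by apply/ilP; rewrite sx; exact: ilx.
have qE : q = M.-1 by lia.
have := lowtop i iM; rewrite qM1 eqxx /= => -[l1 m1].
have LT k : k != i -> nth 0%N (last [::] l) k = nth 0%N (last [::] m) k.
  move=> ki; have [kM|kM] := ltnP k (lvn M.-1); last by rewrite !nth_default ?sL ?sT.
  by have := lowtop k kM; rewrite (negbTE ki) andbF => -[].
have bnd k : (k < lvn M)%N -> k != i ->
    (nth 0%N (last [::] m) k <= nth 0%N x k)%N /\ ((0 < k)%N -> (nth 0%N x k <= nth 0%N (last [::] m) k.-1)%N).
  move=> kM ki; have [h1 h2] := ilx kM; split; first by rewrite -LT.
  move=> k0; have := h2 k0; have [E|E] := eqVneq k.-1 i; last by rewrite LT.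
  by move: l1 m1; rewrite E; lia.
have [xi1 xi2] := ilx iM'.
(* The entry below rises to c + 1, so a top entry equal to c is pushed and the jump reaches level M;
   a larger one stays. *)
have [xc|xc] := eqVneq (nth 0%N x i)%:Z c.
  apply: (ext M); [lia|by lia|move=> k kM].
  rewrite leqnn andbT; have -> : (p <= M)%N by lia.
  rewrite yE nth_cl ?sx//; have [->|ki] := eqVneq k i.
    by split => //; move: (m1) (xc); case: (i) => [|i']; lia.
  have [h1 h2] := bnd k kM ki; move: h1 h2.
  by case: (k) => [|k'] /=; [|move=> h1 /(_ isT) h2]; lia.
apply: (ext M.-1); [lia|by move=> j jM; rewrite qE|move=> k kM].
have -> : (M <= M.-1)%N = false by lia.
rewrite andbF yE cl_id//; apply/ilP; rewrite sx => j jM.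
have [E|E] := eqVneq j i; last exact: bnd.
subst j; split; first by move: xi1 l1 m1 xc; lia.
move=> i0; have := xi2 i0; rewrite LT//; by lia.
Qed.

(** As for right jumps, except that a left jump pushes the next index of the next level: entry h
    below bounds entry h + 1 above. *)
Lemma case2_step p i c : (exists q, case2P M.+1 (rcons l x) (rcons m y) p q i c) <->
  (exists q, case2P M l m p q i c) /\ y = cl x (last [::] m).
Proof.
split.
  move=> [q [/andP[pq qM] [ip [idx H]]]].
  have low j k : (j < M)%N -> (k < lvn j)%N ->
      if (p <= j <= q)%N && (k == i + (j - p))%N then ent l j k = c /\ ent m j k = c - 1
      else ent l j k = ent m j k.
    by move=> jM kj; have := H j k (ltnW jM) kj; rewrite !entrL ?sl ?sm.
  have top k : (k < lvn M)%N ->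
      if (p <= M <= q)%N && (k == i + (M - p))%N then
        (nth 0%N x k)%:Z = c /\ (nth 0%N y k)%:Z = c - 1
      else (nth 0%N x k)%:Z = (nth 0%N y k)%:Z.
    by move=> kj; have := H M k (ltnSn M) kj; rewrite !entrR.
  have [qM'|Mq] := ltnP q M.
    have xy : x = y.
      by apply: (eq_part sx sy) => k kM; have := top k kM; rewrite (leqNgt M) qM' andbF.
    by split; [exists q; split; [rewrite pq|split; [|split]]|rewrite xy cly].
  have qE : q = M by lia.
  subst q; have [pM|Mp] := ltnP p M; last first.
    case: lm; apply: (pathb_ext pl pm) => j k jM kj.
    by have := low j k jM kj; rewrite (leqNgt p) (leq_trans jM Mp).
  split.
    exists M.-1; split; first by lia.
    split => //; split; first by move=> j jM; apply: idx; lia.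
    move=> j k jM kj; have := low j k jM kj.
    by have -> : (j <= M)%N = (j <= M.-1)%N by lia.
  have iM : (i + (M.-1 - p) < lvn M.-1)%N by apply: idx; lia.
  have iM' : (i + (M - p) < lvn M)%N by apply: idx; lia.
  have iE : (i + (M - p) = (i + (M.-1 - p)).+1)%N by lia.
  have : (M.-1 < M)%N by lia.
  move=> /low/(_ iM); have -> : (p <= M.-1 <= M)%N by lia.
  rewrite eqxx /= => -[l1 m1].
  rewrite ent_last in m1; last by rewrite sm prednK//; lia.
  have := top _ iM'; rewrite (ltnW pM) leqnn eqxx /= => -[x1 y1].
  apply: (@eq_from_nth _ 0%N); first by rewrite size_cl sx sy.
  move=> j; rewrite sy => jM; rewrite nth_cl ?sx//; have [yj1 yj2] := ily jM.
  have := top j jM; have [E|ji] := eqVneq j (i + (M - p))%N.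
    rewrite E iE in x1 y1 yj1 *; rewrite (ltnW pM) leqnn /= => _.
    by move: yj1 m1 x1 y1; lia.
  rewrite andbF /= => xj; move: yj1 yj2 xj.
  by case: (j) => [|j'] /=; [|move=> h1 /(_ isT) h2]; lia.
move=> [[q [/andP[pq qM] [ip [idx low]]]] yE].
have M0 : (0 < M)%N by lia.
have MM : (M.-1 < M)%N by lia.
have sM : M.-1.+1 = M by lia.
have lowtop k : (k < lvn M.-1)%N -> if (M.-1 <= q)%N && (k == i + (M.-1 - p))%N then
     (nth 0%N (last [::] l) k)%:Z = c /\ (nth 0%N (last [::] m) k)%:Z = c - 1
   else (nth 0%N (last [::] l) k)%:Z = (nth 0%N (last [::] m) k)%:Z.
  move=> kM; have := low M.-1 k MM kM; rewrite !ent_last ?sM//.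
  by have -> : (p <= M.-1)%N by lia.
have sL : size (last [::] l) = lvn M.-1 by have /partP[-> _] := pathb_last pl; rewrite lvnE sM.
have sT : size (last [::] m) = lvn M.-1 by have /partP[-> _] := pathb_last pm; rewrite lvnE sM.
have ext q' : (p <= q' <= M)%N -> (forall j, (j < M)%N -> (j <= q')%N = (j <= q)%N) ->
   ((M <= q')%N -> (i + (M - p) < lvn M)%N) ->
   (forall k, (k < lvn M)%N ->
      if (p <= M <= q')%N && (k == i + (M - p))%N then
        (nth 0%N x k)%:Z = c /\ (nth 0%N y k)%:Z = c - 1
      else (nth 0%N x k)%:Z = (nth 0%N y k)%:Z) ->
   exists q, case2P M.+1 (rcons l x) (rcons m y) p q i c.
  move=> /andP[pq' q'M] qq idxM top; exists q'; split; first by rewrite pq'.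
  split => //; split.
    move=> j /andP[pj jq']; have [jM|Mj] := ltnP j M; first by apply: idx; rewrite pj -qq.
    have -> : j = M by lia.
    by apply: idxM; lia.
  move=> j k; rewrite ltnS leq_eqVlt => /predU1P[->|jM] kj.
    by have := top k kj; rewrite !entrR.
  by have := low j k jM kj; rewrite !entrL ?sl ?sm// qq.
have [qM1|qM1] := ltnP q M.-1.
  have LT : last [::] l = last [::] m.
    by apply: (eq_part sL sT) => k kM; have := lowtop k kM; rewrite (leqNgt M.-1) qM1.
  apply: (ext q); [lia|by []|by lia|move=> k kM].
  rewrite (leqNgt M) qM andbF yE cl_id// -LT.
  by apply/ilP; rewrite sx; exact: ilx.
have qE : q = M.-1 by lia.
set h := (i + (M.-1 - p))%N in lowtop.
have iM : (h < lvn M.-1)%N by apply: idx; lia.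
have iE : (i + (M - p) = h.+1)%N by rewrite /h; lia.
have := lowtop h iM; rewrite qM1 eqxx /= => -[l1 m1].
have LT k : k != h -> nth 0%N (last [::] l) k = nth 0%N (last [::] m) k.
  move=> ki; have [kM|kM] := ltnP k (lvn M.-1); last by rewrite !nth_default ?sL ?sT.
  by have := lowtop k kM; rewrite (negbTE ki) andbF => -[].
have bnd k : (k < lvn M)%N -> k != h.+1 ->
    (nth 0%N (last [::] m) k <= nth 0%N x k)%N /\ ((0 < k)%N -> (nth 0%N x k <= nth 0%N (last [::] m) k.-1)%N).
  move=> kM ki; have [h1 h2] := ilx kM; split.
    have [E|E] := eqVneq k h; last by rewrite -LT.
    by move: h1; rewrite E; lia.
  by move=> k0; rewrite -LT ?h2//; lia.
(* Entry [h.+1] of the top level, if it exists, is pushed exactly when it equals c; otherwise the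
   jump ends at level M - 1. *)
have [xc|xc] := boolP ((h.+1 < lvn M)%N && ((nth 0%N x h.+1)%:Z == c)).
  move: xc => /andP[hM /eqP xc].
  apply: (ext M); [lia|by lia|by rewrite iE|move=> k kM].
  rewrite leqnn andbT iE; have -> : (p <= M)%N by lia.
  rewrite yE nth_cl ?sx//; have [->|ki] := eqVneq k h.+1.
    by split => //; move: (ty hM) m1 xc; lia.
  have [h1 h2] := bnd k kM ki; move: h1 h2.
  by case: (k) => [|k'] /=; [|move=> h1 /(_ isT) h2]; lia.
apply: (ext M.-1); [lia|by move=> j jM; rewrite qE|by lia|move=> k kM].
have -> : (M <= M.-1)%N = false by lia.
rewrite andbF yE cl_id//; apply/ilP; rewrite sx => j jM.
have [E|E] := eqVneq j h.+1; last exact: bnd.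
subst j; have [h1 h2] := ilx jM; split; first by rewrite -LT//; lia.
by move=> _ /=; move: (h2 isT) xc; rewrite jM /=; lia.
Qed.

End Steps.

Lemma rsum_list (R : realType) (S : choiceType) (D : set S) (f : S -> R) (X : seq S) :
  uniq X -> (forall x, D x -> f x != 0 -> x \in X) ->
  rsum D f = \sum_(x <- X | `[< D x >]) f x.
Proof.
move=> uX supp; pose Y := [seq x <- X | `[< D x >]].
rewrite (_ : \sum_(x <- X | _) f x = \sum_(x <- Y) f x); last by rewrite big_filter.
have uY : uniq Y by exact: filter_uniq.
have YP x : (x \in Y) = `[< D x >] && (x \in X) by rewrite mem_filter.
suff : hassum D f (\sum_(x <- Y) f x) by case/hassum_rsum.
have ext (g : S -> R) Z : uniq Z -> (forall x, x \in Z -> D x) -> {subset Y <= Z} ->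
    (forall x, f x = 0 -> g x = 0) -> \sum_(x <- Z) g x = \sum_(x <- Y) g x.
  move=> uZ ZD YZ fg; apply: sum_subset_eq => // z /ZD Dz zY; apply: fg.
  apply/eqP/negPn/negP => fz; move: zY; rewrite YP (supp _ Dz fz) andbT.
  by move/negP; apply; exact/asboolP.
split.
  exists (\sum_(x <- Y) `|f x|) => Z uZ ZD; pose W := undup (Y ++ Z).
  have uW : uniq W by exact: undup_uniq.
  have WD x : x \in W -> D x.
    by rewrite mem_undup mem_cat => /orP[|/ZD//]; rewrite YP => /andP[/asboolP].
  rewrite -(ext (fun x => `|f x|) W)//.
  - by apply: sum_subset_le => // x xZ; rewrite mem_undup mem_cat xZ orbT.
  - by move=> x xY; rewrite mem_undup mem_cat xY.
  - by move=> x ->; rewrite normr0.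
move=> e e0; exists Y; first by move=> x; rewrite YP => /andP[/asboolP].
move=> Z uZ ZD YZ; rewrite (ext f Z)// subrr normr0; exact: ltW.
Qed.

Section Qsteps.
Variable R : realType.

Definition sQoff M := Qoff R (uphalf M) (~~ odd M).
Definition sQ M := Qgen R (uphalf M) (~~ odd M).

Lemma sQoffE M lam mu : sQoff M lam mu =
  if `[< exists p q, lvb p = false /\ case1P M lam mu p q (lvn p).-1 0 >] then 1
  else if `[< (exists p q i c, case1P M lam mu p q i c) \/
              (exists p q i c, case2P M lam mu p q i c) >] then 1 / 2 else 0.
Proof.
rewrite /sQoff /Qoff (asbool_equiv_eq (Case1aE _ _ _)).
have := asbool_equiv_eq (_ : (Case1 (uphalf M) (~~ odd M) lam mu \/
   Case2 (uphalf M) (~~ odd M) lam mu) <-> ((exists p q i c, case1P M lam mu p q i c) \/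
              (exists p q i c, case2P M lam mu p q i c))).
by move=> -> //; rewrite Case1E Case2E.
Qed.

(** The rate is fixed by where the jump starts and is therefore inherited from the lower levels,
    while the top level follows deterministically. *)
Lemma sQoff_step M l x m y : pathb M.+1 (rcons l x) -> pathb M.+1 (rcons m y) -> l <> m ->
  sQoff M.+1 (rcons l x) (rcons m y) = sQoff M l m * (y == cl x (last [::] m))%:R.
Proof.
move=> plx pmy lm; rewrite !sQoffE; have c1 := case1_step plx pmy lm.
have c2 := case2_step plx pmy lm.
set P1 := exists p q, _; set P2 := _ \/ _; set P1' := exists p q, _; set P2' := _ \/ _.
have e1 : P1 <-> P1' /\ y = cl x (last [::] m).
  split=> [[p [q [b H]]]|[[p [q [b H]]] yE]].
    by have [|[q' H'] yE] := (c1 p (lvn p).-1 0).1; [exists q|split => //; exists p, q'].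
  by have [|q' H'] := (c1 p (lvn p).-1 0).2; [split => //; exists q|exists p, q'].
have e2 : P2 <-> P2' /\ y = cl x (last [::] m).
  split=> [[[p [q [i [c H]]]]|[p [q [i [c H]]]]]|[[[p [q [i [c H]]]]|[p [q [i [c H]]]]] yE]].
  - have [|[q' H'] yE] := (c1 p i c).1; first by exists q.
    by split => //; left; exists p, q', i, c.
  - have [|[q' H'] yE] := (c2 p i c).1; first by exists q.
    by split => //; right; exists p, q', i, c.
  - have [|q' H'] := (c1 p i c).2; first by split => //; exists q.
    by left; exists p, q', i, c.
  - have [|q' H'] := (c2 p i c).2; first by split => //; exists q.
    by right; exists p, q', i, c.
rewrite (asbool_equiv_eq e1) (asbool_equiv_eq e2) !asbool_and.
have -> : `[< y = cl x (last [::] m) >] = (y == cl x (last [::] m)).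
  by apply/asboolP/eqP.
case: eqP => _; rewrite ?andbT ?andbF ?mulr1 ?mulr0//.
Qed.

Lemma gen_agree b n x y i : x <> y -> size x = n -> size y = n -> (i < n)%N -> agree n i x y ->
  gen R b n x y = kap R b (posn x n i) (posn y n i).
Proof.
move=> xy sx sy lin ag; rewrite /gen (bigD1 (Ordinal lin))//= ag big1 ?addr0// => j ji.
case: ifP => // /agreeP ag'; case: xy; apply: (@eq_from_nth _ 0%N); first by rewrite sx sy.
move=> k; rewrite sx => kn; have [->|ki] := eqVneq k i.
  by apply: ag' => //; rewrite eq_sym.
exact: (agreeP _ _ _ _ ag).
Qed.

Lemma gen_notagree b n x y : (forall i, (i < n)%N -> ~~ agree n i x y) -> gen R b n x y = 0.
Proof. by move=> H; rewrite /gen big1// => i _; rewrite (negbTE (H _ _)). Qed.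

Lemma case1P_top M l x y p q i c : pathb M l ->
  case1P M.+1 (rcons l x) (rcons l y) p q i c <->
  [/\ p = M, q = M, (i < lvn M)%N & (forall k, (k < lvn M)%N -> if k == i then
     (nth 0%N x k)%:Z = c /\ (nth 0%N y k)%:Z = c + 1 else nth 0%N x k = nth 0%N y k)].
Proof.
move=> pl; have sl := pathb_size pl; split.
  move=> [/andP[pq qM] [ip H]].
  have pM : p = M.
    apply/eqP; rewrite eqn_leq; apply/andP; split; first by lia.
    rewrite leqNgt; apply/negP => pM; have := H p i (ltnW pM) ip.
    by rewrite pq leqnn eqxx /= !entrL ?sl//; lia.
  subst p; have qE : q = M by lia.
  subst q; split => // k kM; have := H M k (ltnSn M) kM; rewrite leqnn !entrR//=.
  by case: eqP => // _ [].
move=> [-> -> iM H]; split; first by rewrite leqnn ltnSn.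
split => // j k; rewrite ltnS [X in is_true X -> _]leq_eqVlt => /predU1P[->|jM] kj.
  by have := H k kj; rewrite leqnn !entrR//=; case: (k =P i) => [_ //|_ ->].
by rewrite (leqNgt M) jM !entrL ?sl.
Qed.

Lemma case2P_top M l x y p q i c : pathb M l ->
  case2P M.+1 (rcons l x) (rcons l y) p q i c <->
  [/\ p = M, q = M, (i < lvn M)%N & (forall k, (k < lvn M)%N -> if k == i then
     (nth 0%N x k)%:Z = c /\ (nth 0%N y k)%:Z = c - 1 else nth 0%N x k = nth 0%N y k)].
Proof.
move=> pl; have sl := pathb_size pl; split.
  move=> [/andP[pq qM] [ip [idx H]]].
  have pM : p = M.
    apply/eqP; rewrite eqn_leq; apply/andP; split; first by lia.
    rewrite leqNgt; apply/negP => pM; have := H p i (ltnW pM) ip.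
    by rewrite pq leqnn subnn addn0 eqxx /= !entrL ?sl//; lia.
  subst p; have qE : q = M by lia.
  subst q; split => // k kM; have := H M k (ltnSn M) kM.
  by rewrite leqnn subnn addn0 !entrR//=; case: eqP => // _ [].
move=> [-> -> iM H]; split; first by rewrite leqnn ltnSn.
split => //; split => [j /andP[Mj jM]|j k].
  have -> : j = M by lia.
  by rewrite subnn addn0.
rewrite ltnS [X in is_true X -> _]leq_eqVlt => /predU1P[->|jM] kj.
  by have := H k kj; rewrite leqnn subnn addn0 !entrR//=; case: (k =P i) => [_ //|_ ->].
by rewrite (leqNgt M) jM !entrL ?sl.
Qed.

(** With equal lower levels only p = q = M is possible, so one entry of the top level moves. Case 1a
    is a particle at position 0 on a level with b = -1/2, precisely where [kap_up] is 1. *)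
Lemma sQoff_top M l x y : pathb M l -> part (lvn M) x -> part (lvn M) y -> x <> y ->
  sQoff M.+1 (rcons l x) (rcons l y) = sgen R M.+1 x y.
Proof.
move=> pl /partP[sx _] /partP[sy _] xy.
rewrite /sgen -/(lvn M) sQoffE.
set P1 := exists p q, _; set P2 := _ \/ _.
have noP (P : Prop) : ~ P -> `[< P >] = false by move=> nP; apply/asboolP.
have yesP (P : Prop) : P -> `[< P >] = true by move=> pP; apply/asboolP.
have ag1 p q i c : case1P M.+1 (rcons l x) (rcons l y) p q i c ->
   [/\ (i < lvn M)%N, agree (lvn M) i x y & (nth 0%N y i = (nth 0%N x i).+1 /\ (nth 0%N x i)%:Z = c)].
  move=> /(case1P_top _ _ _ _ _ _ pl)[_ _ iM H]; split => //.
    by apply/agreeP => k kM ki; have := H k kM; rewrite (negbTE ki).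
  by have := H i iM; rewrite eqxx; lia.
have ag2 p q i c : case2P M.+1 (rcons l x) (rcons l y) p q i c ->
   [/\ (i < lvn M)%N, agree (lvn M) i x y & (nth 0%N y i).+1 = nth 0%N x i].
  move=> /(case2P_top _ _ _ _ _ _ pl)[_ _ iM H]; split => //.
    by apply/agreeP => k kM ki; have := H k kM; rewrite (negbTE ki).
  by have := H i iM; rewrite eqxx; lia.
have [ex|nex] := pselect (exists2 i, (i < lvn M)%N & agree (lvn M) i x y); last first.
  rewrite gen_notagree; last by move=> i iM; apply/negP => ag; apply: nex; exists i.
  rewrite (noP P1); last by move=> [p [q [_ /ag1[? ? _]]]]; apply: nex; exists (lvn p).-1.
  rewrite (noP P2)// => -[[p [q [i [c /ag1[? ? _]]]]]|[p [q [i [c /ag2[? ? _]]]]]];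
  by apply: nex; exists i.
case: ex => i iM ag; rewrite (gen_agree _ xy sx sy iM ag).
have uniqi j : (j < lvn M)%N -> agree (lvn M) j x y -> j = i.
  move=> jM /agreeP ag'; apply/eqP/negPn/negP => ji; case: xy.
  apply: (@eq_from_nth _ 0%N); first by rewrite sx sy.
  move=> k; rewrite sx => kn; have [->|ki] := eqVneq k i.
    by apply: ag' => //; rewrite eq_sym.
  exact: (agreeP _ _ _ _ ag).
have [yx|yx] := eqVneq (nth 0%N y i) (nth 0%N x i).+1.
  have -> : posn y (lvn M) i = (posn x (lvn M) i).+1 by rewrite /posn yx.
  have C1 : case1P M.+1 (rcons l x) (rcons l y) M M i (nth 0%N x i)%:Z.
    apply/(case1P_top _ _ _ _ _ _ pl); split => // k kM; have [->|ki] := eqVneq k i.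
      by rewrite yx; lia.
    exact: (agreeP _ _ _ _ ag).
  rewrite kap_up (yesP P2); last by left; exists M, M, i, (nth 0%N x i)%:Z.
  have -> : `[< P1 >] = ~~ ~~ odd M.+1 && (posn x (lvn M) i == 0%N); last by [].
  apply/asboolP/andP.
    move=> [p [q [b H]]]; have [iM' ag' [_ x0]] := ag1 _ _ _ _ H.
    move/(case1P_top _ _ _ _ _ _ pl): H => [pM _ _ _].
    have E := uniqi _ iM' ag'; subst p; rewrite E in x0.
    split; first by rewrite negbK /= -/(lvb M) b.
    by apply/eqP; move: x0 E iM; rewrite /posn; lia.
  rewrite /= negbK => -[oM /eqP x0]; exists M, M; split; first exact/negbTE.
  have -> : (lvn M).-1 = i by move: x0; rewrite /posn; lia.
  by have -> : 0 = (nth 0%N x i)%:Z by move: x0; rewrite /posn; lia.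
rewrite (noP P1); last first.
  by move=> [p [q [_ /ag1[jM ag' [yE _]]]]]; move: yE yx; rewrite (uniqi _ jM ag') => ->; rewrite eqxx.
have [xy'|xy'] := eqVneq (nth 0%N y i).+1 (nth 0%N x i).
  have -> : posn x (lvn M) i = (posn y (lvn M) i).+1 by rewrite /posn -xy'.
  rewrite kap_down (yesP P2)//; right; exists M, M, i, (nth 0%N x i)%:Z.
  apply/(case2P_top _ _ _ _ _ _ pl); split => // k kM; have [->|ki] := eqVneq k i.
    by rewrite -xy'; lia.
  exact: (agreeP _ _ _ _ ag).
have xyi : nth 0%N x i <> nth 0%N y i.
  move=> E; case: xy; apply: (@eq_from_nth _ 0%N); first by rewrite sx sy.
  move=> k; rewrite sx => kn; have [->//|ki] := eqVneq k i.
  exact: (agreeP _ _ _ _ ag).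
rewrite kap_far; last by rewrite mem_nb1 /posn; lia.
rewrite (noP P2)// => -[[p [q [j [c /ag1[jM ag' [yE _]]]]]]|[p [q [j [c /ag2[jM ag' yE]]]]]].
  by move: yx; rewrite -(uniqi _ jM ag') yE eqxx.
by move: xy'; rewrite -(uniqi _ jM ag') yE eqxx.
Qed.

End Qsteps.

Lemma bigD1_seq_cond (R : realType) (T : eqType) (r : seq T) (j : T) (P : pred T) (F : T -> R) :
  j \in r -> uniq r -> P j ->
  \sum_(i <- r | P i) F i = F j + \sum_(i <- r | P i && (i != j)) F i.
Proof.
move=> jr ur Pj; rewrite big_mkcond (bigD1_seq j)//= Pj; congr (_ + _).
rewrite [LHS]big_mkcond [RHS]big_mkcond; apply: eq_bigr => i _.
by case: (P i); case: (i != j).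
Qed.

Section Qgenerator.
Variable R : realType.

Definition nbs (s : seq (seq nat)) : seq (seq (seq nat)) := prodl (map nbl s).

Lemma nbs_uniq s : uniq (nbs s).
Proof. by apply: prodl_uniq; apply/allP => _ /mapP[a _ ->]; exact: nbl_uniq. Qed.

Lemma mem_nbs (s t : seq (seq nat)) : reflect (size t = size s /\
  forall i, (i < size s)%N -> nth [::] t i \in nbl (nth [::] s i)) (t \in nbs s).
Proof.
rewrite /nbs mem_prodl; apply: (iffP (all2_nthP [::] [::] _ _ _)); rewrite size_map.
  by move=> [sst H]; split => // i ix; have := H i ix; rewrite (nth_map [::]).
by move=> [sst H]; split => // i ix; rewrite (nth_map [::])//; exact: H.
Qed.

Lemma nbs_sym (s t : seq (seq nat)) : (s \in nbs t) = (t \in nbs s).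
Proof.
have sym u v : u \in nbs v -> v \in nbs u.
  move=> /mem_nbs[e H]; apply/mem_nbs; split => // i; rewrite e => iv.
  by rewrite nbl_sym; exact: H.
by apply/idP/idP; exact: sym.
Qed.

Lemma nbs_refl s : s \in nbs s.
Proof. by apply/mem_nbs; split => // i _; exact: nbl_refl. Qed.

Lemma nbs_last (s t : seq (seq nat)) : t \in nbs s -> last [::] t \in nbl (last [::] s).
Proof.
move=> /mem_nbs[e H]; rewrite -!nth_last e; case: s e H => [|a s] e H.
  by move/size0nil: e => ->; exact: nbl_refl.
exact: H.
Qed.

Lemma big_nbs_rcons s x (F : seq (seq nat) -> R) :
  \sum_(t <- nbs (rcons s x)) F t = \sum_(t <- nbs s) \sum_(y <- nbl x) F (rcons t y).
Proof. by rewrite /nbs map_rcons big_prodl_rcons. Qed.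

Lemma sQoff_supp M lam mu : pathb M lam -> pathb M mu -> sQoff R M lam mu != 0 -> mu \in nbs lam.
Proof.
move=> pl pm; rewrite sQoffE => H.
suff ent1 j k : (j < M)%N -> (k < lvn j)%N ->
    ent lam j k = ent mu j k \/ ent mu j k = ent lam j k + 1 \/ ent mu j k = ent lam j k - 1.
  apply/mem_nbs; split; first by rewrite (pathb_size pl) (pathb_size pm).
  rewrite (pathb_size pl) => j jM.
  have [sl _] := partP _ _ (pathb_part pl jM); have [sm _] := partP _ _ (pathb_part pm jM).
  apply/mem_nbl; split; first by rewrite sl sm.
  by rewrite sl => k kj; have := ent1 j k jM kj; rewrite /ent /=; lia.
move=> jM kj; move: H.
have c1 : (exists p q i c, case1P M lam mu p q i c) ->
    ent lam j k = ent mu j k \/ ent mu j k = ent lam j k + 1 \/ ent mu j k = ent lam j k - 1.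
  by move=> [p [q [i [c [_ [_ H]]]]]]; have := H j k jM kj; case: ifP => _; lia.
have c2 : (exists p q i c, case2P M lam mu p q i c) ->
    ent lam j k = ent mu j k \/ ent mu j k = ent lam j k + 1 \/ ent mu j k = ent lam j k - 1.
  by move=> [p [q [i [c [_ [_ [_ H]]]]]]]; have := H j k jM kj; case: ifP => _; lia.
case: asboolP => [[p [q [_ H]]] _|_]; first by apply: c1; exists p, q, (lvn p).-1, 0.
by case: asboolP => [[/c1|/c2]//|_]; rewrite eqxx.
Qed.

Lemma sQ_diag M lam : pathb M lam ->
  sQ R M lam lam = - \sum_(nu <- nbs lam | pathb M nu && (nu != lam)) sQoff R M lam nu.
Proof.
move=> pl; rewrite /sQ /Qgen eqxx; congr (- _).
rewrite (@rsum_list _ _ _ _ (nbs lam)); last 2 first.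
- exact: nbs_uniq.
- by move=> nu [/JN_pathb pn _] q0; exact: sQoff_supp q0.
apply: eq_bigl => nu; apply/asboolP/andP => [[/JN_pathb ? ?]|[? /eqP ?]].
  by split => //; exact/eqP.
by split => //; exact/JN_pathb.
Qed.

Lemma sQ_off M lam mu : lam != mu -> sQ R M lam mu = sQoff R M lam mu.
Proof. by rewrite /sQ /Qgen => /negbTE ->. Qed.

Lemma sQ_supp M lam mu : pathb M lam -> pathb M mu -> sQ R M lam mu != 0 -> mu \in nbs lam.
Proof.
move=> pl pm; have [->|ne] := eqVneq lam mu; first by rewrite nbs_refl.
by rewrite sQ_off//; exact: sQoff_supp.
Qed.

(* Autonomous jumps of the top level, blocked by the level [t] below. *)
Definition topgen (M : nat) (t x y : seq nat) : R :=
  if x == y then - \sum_(z <- nbl y | [&& part (lvn M) z, il t z & z != y]) sgen R M.+1 y z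
  else sgen R M.+1 x y.

(** Either the lower levels move and the top level follows, or they rest and the top level jumps by
    itself. On the diagonal the exit rates of the two mechanisms add up. *)
Lemma sQ_step M l x m y : pathb M.+1 (rcons l x) -> pathb M.+1 (rcons m y) ->
  sQ R M.+1 (rcons l x) (rcons m y) = sQ R M l m * (y == cl x (last [::] m))%:R +
    (l == m)%:R * topgen M (last [::] m) x y.
Proof.
move=> plx pmy.
have [lm|lm] := eqVneq l m; last first.
  rewrite sQ_off; last by apply: contra lm; rewrite eqseq_rcons => /andP[].
  by rewrite sQoff_step//; [rewrite sQ_off// mul0r addr0|exact/eqP].
subst l.
move: (pmy) (plx); rewrite !pathb_rcons => /and3P[pm py ily] /and3P[_ px ilx].
rewrite (cl_id ilx) /topgen; have [xy|xy] := eqVneq x y; last first.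
  rewrite sQ_off; last by rewrite eqseq_rcons (negbTE xy) andbF.
  rewrite sQoff_top//; last exact/eqP.
  by rewrite mulr0 mul1r add0r.
subst x; rewrite mulr1 mul1r !sQ_diag// -opprD; congr (- _).
rewrite big_mkcond big_nbs_rcons (bigD1_seq m)/=; [|exact: nbs_refl|exact: nbs_uniq].
rewrite addrC; congr (_ + _); last first.
  rewrite [RHS]big_mkcond/=; apply: eq_bigr => z _.
  rewrite pathb_rcons pm /= eqseq_rcons eqxx /= -andbA.
  case: ifP => // /and3P[pz ilz zy]; rewrite sQoff_top//.
  by apply/eqP; rewrite eq_sym.
rewrite [LHS]big_mkcond [RHS]big_mkcond /= big_seq [RHS]big_seq.
apply: eq_bigr => nu nunb; case: (eqVneq nu m) => [//|num] /=; first by rewrite andbF.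
rewrite andbT; have [pn|npn] := boolP (pathb M nu); last first.
  by rewrite big1// => z _; rewrite pathb_rcons (negbTE npn).
have [sy _] := partP _ _ py.
have wt : wdecr (size y) (last [::] nu) by rewrite sy; exact/part_wdecr_next/(pathb_last pn).
(* Every move of the lower levels extends to exactly one move of the array, so its rate is counted
   once in the total exit rate. *)
set c := cl y (last [::] nu).
have ilc : il (last [::] nu) c by exact: il_cl.
have pc : part (lvn M) c by apply: part_il ilc => //; [rewrite -sy|rewrite size_cl].
have cn : c \in nbl y.
  apply: (cl_nbl ily wt) => i.
  have /mem_nbl[e H] := nbs_last nunb.
  have [h|h] := ltnP i (size (last [::] m)); first exact: H.
  by rewrite !nth_default ?e.
rewrite (bigD1_seq c)/=; [|exact: cn|exact: nbl_uniq].
rewrite big1 ?addr0; last first.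
  move=> z zc; case: ifP => // /andP[pz _]; rewrite sQoff_step//.
    by rewrite (negbTE zc) mulr0.
  by move=> E; rewrite E eqxx in num.
have pnc : pathb M.+1 (rcons nu c) by rewrite pathb_rcons pn pc ilc.
rewrite pnc eqseq_rcons (negbTE num) /= sQoff_step//; last by move=> E; rewrite E eqxx in num.
by rewrite eqxx mulr1.
Qed.

Definition lweight (b : bool) (n : nat) (x : seq nat) : R := \prod_(i < n) Wt R b (posn x n i).
Definition pweight (M : nat) (s : seq (seq nat)) : R :=
  \prod_(k < M) lweight (lvb k) (lvn k) (nth [::] s k).

Lemma lweight_gt0 b n x : 0 < lweight b n x.
Proof. by apply: prodr_gt0 => i _; exact: Wt_gt0. Qed.

Lemma pweight_gt0 M s : 0 < pweight M s.
Proof. by apply: prodr_gt0 => i _; exact: lweight_gt0. Qed.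

(** Detailed balance, inherited from the single particle that moves. It turns the equation for
    functions into the equation for measures. *)
Lemma gen_sym b n x y : lweight b n x * gen R b n x y = lweight b n y * gen R b n y x.
Proof.
rewrite /gen !mulr_sumr; apply: eq_bigr => i _; rewrite agree_sym.
case: ifP => ag; last by rewrite !mulr0.
rewrite /lweight (bigD1 i)//= [in RHS](bigD1 i)//= mulrAC kap_sym -mulrAC; congr (_ * _).
congr (_ * _); apply: eq_bigr => j ji; congr (Wt R b _).
by rewrite /posn (agreeP _ _ _ _ ag).
Qed.

Lemma gen_supp b n x y : size x = n -> size y = n -> gen R b n x y != 0 -> y \in nbl x.
Proof.
move=> sx sy H.
have [ex|nex] := pselect (exists2 i, (i < n)%N & agree n i x y); last first.
  move: H; rewrite gen_notagree ?eqxx// => i lin; apply/negP => ag.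
  by apply: nex; exists i.
case: ex => i lin ag.
have [->|/eqP xy] := eqVneq x y; first exact: nbl_refl.
move: H; rewrite (gen_agree _ _ xy sx sy lin ag).
have [|nk] := boolP (posn y n i \in nb1 (posn x n i)); last by rewrite kap_far ?eqxx.
rewrite mem_nb1 /posn => h _; apply/mem_nbl; split; first by rewrite sx sy.
move=> k; rewrite sx => kn; have [->|ki] := eqVneq k i; first by lia.
by rewrite (agreeP _ _ _ _ ag)//; lia.
Qed.

(** If one jump restores interlacing, it moves the only offending entry, by one step, to the nearest
    admissible value. *)
Lemma gen_cl b n t x z : size x = n -> size z = n -> il t z -> ~~ il t x ->
  gen R b n x z != 0 -> z = cl x t.
Proof.
move=> sx sz /ilP ilz nil g0.
have xz : x <> z by move=> E; move/negP: nil; apply; rewrite E; exact/ilP.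
have znb := gen_supp sx sz g0.
have [ex|nex] := pselect (exists2 i, (i < n)%N & agree n i x z); last first.
  move: g0; rewrite gen_notagree ?eqxx// => i lin; apply/negP => ag.
  by apply: nex; exists i.
case: ex => i lin /agreeP ag.
rewrite sz in ilz.
have /mem_nbl[_ /(_ i)] := znb; rewrite sx => /(_ lin) [n1 n2].
apply: (@eq_from_nth _ 0%N); first by rewrite size_cl sx sz.
move=> j; rewrite sz => jn; rewrite nth_cl ?sx//; move: (ilz j jn).
have [E|ji] := eqVneq j i; last first.
  by rewrite -(ag _ jn ji); case: (j) => [|j'] /= [h1 h2]; [|have := h2 isT]; lia.
subst j; have xzi : nth 0%N x i <> nth 0%N z i.
  move=> E; apply: xz; apply: (@eq_from_nth _ 0%N); first by rewrite sx sz.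
  by move=> k; rewrite sx => kn; have [->//|ki] := eqVneq k i; exact: ag.
have bad : ~~ ((nth 0%N t i <= nth 0%N x i)%N &&
     ((i == 0%N) || (nth 0%N x i <= nth 0%N t i.-1)%N)).
  apply: contra nil => /andP[b1 b2]; apply/ilP => k; rewrite sx => kn.
  have [->|ki] := eqVneq k i; last by rewrite ag//; exact: ilz.
  by split => // i0; move: b2 i0; case: (i).
move: bad n1 n2 xzi; case: (i) => [|i'] /= bad n1 n2 xzi [h1 h2]; first by lia.
by have := h2 isT; lia.
Qed.

(** Pushing and autonomous jumps together give the free generator of the top level. By [intertwine]
    the sum is that generator applied to the indicator of interlacing with [t]. If [x] interlaces,
    this is the diagonal entry plus the admissible exit rates that [topgen] subtracts; if not, the
    only admissible exit is the push. *)
Lemma topgen_sum M t x y : part (uphalf M) t -> part (lvn M) x -> part (lvn M) y -> il t y ->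
  (y == cl x t)%:R * (\sum_(z <- nbl t | part (uphalf M) z) sgen R M t z * (il z x)%:R) +
    (il t x)%:R * topgen M t x y = sgen R M.+1 x y.
Proof.
move=> pt px py ilty; rewrite (intertwine R pt px).
have [sx _] := partP _ _ px; have [sy _] := partP _ _ py.
have [iltx|niltx] := boolP (il t x).
  rewrite (cl_id iltx) mul1r /topgen; have [xy|xy] := eqVneq x y; last first.
    by rewrite mul0r add0r.
  subst y; rewrite mul1r (bigD1_seq_cond _ (nbl_refl x) (nbl_uniq x))//=.
  rewrite iltx mulr1 -addrA -[RHS]addr0; congr (_ + _).
  rewrite [X in X - _]big_mkcond [X in _ - X]big_mkcond /= -sumrB big1// => z _.
  case: (part _ z); rewrite /= ?subr0 ?andbT//.
  by case: (z != x); case: (il t z); rewrite ?mulr1 ?mulr0 ?subrr ?subr0.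
rewrite mul0r addr0.
have [yE|yE] := eqVneq y (cl x t); last first.
  rewrite mul0r; apply/esym/eqP/negPn/negP => g0.
  by move/eqP: yE; apply; apply: (gen_cl sx sy ilty niltx g0).
rewrite mul1r; have termE z : part (lvn M) z ->
    sgen R M.+1 x z * (il t z)%:R = (z == y)%:R * sgen R M.+1 x y.
  move=> /partP[sz _]; have [->|zy] := eqVneq z y; first by rewrite ilty mulr1 mul1r.
  have [ilz|] := boolP (il t z); last by rewrite mulr0 mul0r.
  have [->|g0] := eqVneq (sgen R M.+1 x z) 0; first by rewrite !mul0r.
  by move/eqP: zy; case; rewrite yE; apply: (gen_cl sx sz ilz niltx g0).
rewrite (eq_bigr _ termE) -mulr_suml.
have [->|g0] := eqVneq (sgen R M.+1 x y) 0; first by rewrite mulr0.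
have ynb := gen_supp sx sy g0.
rewrite (bigD1_seq_cond _ ynb (nbl_uniq x))//= eqxx big1 ?addr0 ?mul1r// => z /andP[_ zy].
by rewrite (negbTE zy).
Qed.

(* Summing out the level below through the intertwining relation, the weights that are
   uniform (up to the factors W) given the top level are preserved by [sQ]. *)
Lemma path_generator M (V : seq nat -> R) mu : pathb M mu ->
  \sum_(lam <- nbs mu | pathb M lam) V (last [::] lam) * pweight M lam * sQ R M lam mu =
  pweight M mu * \sum_(z <- nbl (last [::] mu) | part (uphalf M) z) sgen R M (last [::] mu) z * V z.
Proof.
elim: M V mu => [|M IH] V mu pmu.
  have -> : mu = [::] by apply/size0nil; exact: pathb_size pmu.
  rewrite big_mkcond big_seq1 /= sQ_diag// big_mkcond big_seq1 /= oppr0 mulr0.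
  by rewrite big1 ?mulr0// => z _; rewrite /sgen /gen big_ord0 mul0r.
case/lastP: mu pmu => [/pathb_size//|m y] pmy.
move: (pmy); rewrite pathb_rcons => /and3P[pm py ily].
have sm := pathb_size pm.
have pwE s x : size s = M -> pweight M.+1 (rcons s x) = pweight M s * lweight (lvb M) (lvn M) x.
  move=> ss; rewrite /pweight big_ord_recr /= nth_rcons ss ltnn eqxx; congr (_ * _).
  by apply: eq_bigr => i _; rewrite nth_rcons ss ltn_ord.
have pt := pathb_last pm.
set t := last [::] m in ily pt *.
rewrite last_rcons pwE// big_mkcond big_nbs_rcons exchange_big/=.
transitivity (\sum_(x <- nbl y | part (lvn M) x)
    V x * lweight (lvb M) (lvn M) x * (pweight M m * sgen R M.+1 x y)).
  rewrite [RHS]big_mkcond; apply: eq_bigr => x _.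
  case: ifP => px; last first.
    by rewrite big1// => s _; rewrite pathb_rcons px andbF.
  rewrite -(topgen_sum pt px py ily) mulrDr mulrDr.
  transitivity (\sum_(s <- nbs m | pathb M s) (V x * lweight (lvb M) (lvn M) x) *
     ((y == cl x t)%:R * ((il (last [::] s) x)%:R * pweight M s * sQ R M s m) +
      (s == m)%:R * ((il t x)%:R * pweight M m * topgen M t x y))).
    rewrite [RHS]big_mkcond; apply: eq_bigr => s _; rewrite pathb_rcons px /=.
    case: (boolP (pathb M s)) => //= ps; rewrite last_rcons (pwE _ _ (pathb_size ps)).
    have [ils|nils] := boolP (il (last [::] s) x); last first.
      rewrite !mul0r mulr0 add0r; have [E|_] := eqVneq s m; last by rewrite mul0r mulr0.
      by move: nils; rewrite E -/t => /negbTE ->; rewrite !mul0r !mulr0.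
    have psx : pathb M.+1 (rcons s x) by rewrite pathb_rcons ps px ils.
    rewrite (sQ_step psx pmy) -/t; have [E|_] := eqVneq s m; last by rewrite /= ?mulr1n ?mulr0n; ring.
    by subst s; move: ils; rewrite -/t => ->; rewrite /= ?mulr1n ?mulr0n; ring.
  (* The induction hypothesis is used for the indicator of interlacing with [x]; this is why [V] is
     arbitrary. *)
  rewrite -mulr_sumr big_split/= -mulr_sumr (IH (fun z => (il z x)%:R) m pm) -/t.
  have deltaE (c : R) : \sum_(s <- nbs m | pathb M s) (s == m)%:R * c = c.
    rewrite (bigD1_seq_cond _ (nbs_refl m) (nbs_uniq m))//= eqxx mul1r big1 ?addr0//.
    by move=> s /andP[_ sm0]; rewrite (negbTE sm0) mul0r.
  rewrite deltaE.
  by ring.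
rewrite mulr_sumr; apply: eq_bigr => x px.
(* Detailed balance moves the weight from [x] to [y] and reverses the generator. *)
have := gen_sym (odd M) (lvn M) x y.
rewrite /sgen /= negbK -/(lvn M) /lvb => H.
transitivity (pweight M m * V x * (lweight (odd M) (lvn M) x * gen R (odd M) (lvn M) x y)).
  by ring.
by rewrite H; ring.
Qed.

End Qgenerator.

(** * Determinants of moments *)

Section DerDet.
Variable R : realType.

Lemma is_derive_sum_seq (I : Type) (r : seq I) (F : I -> R -> R) (F' : I -> R) (t : R) :
  (forall i, is_derive t 1 (F i) (F' i)) ->
  is_derive t 1 (fun s => \sum_(i <- r) F i s) (\sum_(i <- r) F' i).
Proof.
move=> dF; elim: r => [|i r IH].
  under eq_fun do rewrite big_nil.
  by rewrite big_nil; exact: is_derive_cst.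
under eq_fun do rewrite big_cons.
by rewrite big_cons; apply: is_deriveD.
Qed.

Lemma is_derive_prod_seq (I : eqType) (r : seq I) (F : I -> R -> R) (F' : I -> R) (t : R) :
  uniq r -> (forall i, is_derive t 1 (F i) (F' i)) ->
  is_derive t 1 (fun s => \prod_(i <- r) F i s)
    (\sum_(i <- r) F' i * \prod_(k <- r | k != i) F k t).
Proof.
move=> ur dF; elim: r ur => [_|a r IH] /=.
  under eq_fun do rewrite big_nil.
  by rewrite big_nil; exact: is_derive_cst.
move=> /andP[ar /IH{}IH].
under eq_fun do rewrite big_cons.
have H := is_deriveM (dF a) IH.
apply: (is_derive_eq H); rewrite /GRing.scale/= big_cons addrC; congr (_ + _).
  rewrite big_cons eqxx /= mulrC; congr (_ * _).
  rewrite big_seq [RHS]big_seq_cond; apply: eq_bigl => k.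
  by have [->|] := eqVneq k a; rewrite ?andbT // (negbTE ar).
rewrite mulr_sumr [LHS]big_seq [RHS]big_seq; apply: eq_bigr => i ir.
rewrite big_cons; have [E|_] := eqVneq a i; first by rewrite E ir in ar.
by rewrite /=; ring.
Qed.

Lemma is_derive_det n (A : R -> 'M[R]_n) (A' : 'M[R]_n) (t : R) :
  (forall i j, is_derive t 1 (fun s => A s i j) (A' i j)) ->
  is_derive t 1 (fun s => \det (A s))
    (\sum_(i < n) \det (\matrix_(k, j) if k == i then A' k j else A t k j)).
Proof.
move=> dA; rewrite /determinant.
pose F (s : 'S_n) := fun u : R => (-1) ^+ s * \prod_(i <- index_enum 'I_n) A u i (s i).
have dF s : is_derive t 1 (F s) ((-1) ^+ s * \sum_(i <- index_enum 'I_n)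
    A' i (s i) * \prod_(k <- index_enum 'I_n | k != i) A t k (s k)).
  apply: is_derive_cM.
  exact: (@is_derive_prod_seq _ (index_enum 'I_n) (fun i u => A u i (s i))
     (fun i => A' i (s i)) t (index_enum_uniq _)).
apply: (is_derive_eq (is_derive_sum_seq (index_enum _) dF)).
rewrite [RHS]exchange_big/=; apply: eq_bigr => s _.
rewrite -mulr_sumr; congr (_ * _); apply: eq_bigr => i _.
rewrite [RHS](bigD1 i)//= mxE eqxx; congr (_ * _).
by apply: eq_bigr => k ki; rewrite mxE (negbTE ki).
Qed.

Lemma det_bound n (A : 'M[R]_n) (r : 'I_n -> R) : (forall i j, `|A i j| <= r i) ->
  `|\det A| <= n`!%:R * \prod_(i < n) r i.
Proof.
move=> Ar; rewrite /determinant (le_trans (ler_norm_sum _ _ _))//.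
apply: (@le_trans _ _ (\sum_(s : 'S_n) \prod_(i < n) r i)).
  apply: ler_sum => s _; rewrite normrM normrX normrN1 expr1n mul1r normr_prod.
  by apply: ler_prod => i _; rewrite normr_ge0 Ar.
rewrite sumr_const -[X in _ <= X * _]/(n`!%:R) mulr_natl.
by rewrite card_Sn.
Qed.

Lemma det_scale_col n (A : 'M[R]_n) (d : 'I_n -> R) :
  \det (\matrix_(i, j) (A i j * d j)) = \det A * \prod_(j < n) d j.
Proof.
have -> : \matrix_(i, j) (A i j * d j) = A *m diag_mx (\row_j d j).
  by rewrite mul_mx_diag; apply/matrixP => i j; rewrite !mxE.
by rewrite det_mulmx det_diag; congr (_ * _); apply: eq_bigr => j _; rewrite mxE.
Qed.

Lemma det_scale_row n (A : 'M[R]_n) (d : 'I_n -> R) :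
  \det (\matrix_(i, j) (d i * A i j)) = (\prod_(j < n) d j) * \det A.
Proof.
rewrite -det_tr mulrC -(det_tr A) -det_scale_col; congr (\det _).
by apply/matrixP => i j; rewrite !mxE mulrC.
Qed.

End DerDet.

Section Moments.
Variable R : realType.
Variables (b : bool) (n : nat).

Definition nbP (x : seq nat) := [seq y <- nbl x | part n y].
(** Extended by 0 to lists that are not partitions, since the Taylor estimates quantify over the
    whole type. *)
Definition pgen (x z : seq nat) : R := if part n x && part n z then gen R b n x z else 0.
(** One jump changes this weight by a bounded factor, and for K >= 3 it dominates products of
    Chebyshev values. *)
Definition rho (K : R) (x : seq nat) : R := \prod_(i < n) K ^+ posn x n i.

Lemma nbP_uniq x : uniq (nbP x).
Proof. by apply: filter_uniq; exact: nbl_uniq. Qed.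

Lemma rho_gt0 K x : 0 < K -> 0 < rho K x.
Proof. by move=> K0; apply: prodr_gt0 => i _; rewrite exprn_gt0. Qed.

Lemma rho_nbl K x z : 1 <= K -> size x = n -> z \in nbl x -> rho K z <= K ^+ n * rho K x.
Proof.
move=> K1 sx /mem_nbl[sz H].
have -> : K ^+ n = \prod_(i < n) K by rewrite prodr_const card_ord.
rewrite /rho -big_split/=; apply: ler_prod => i _.
have K0 : 0 <= K by exact: le_trans K1.
rewrite exprn_ge0//= -exprS ler_weXn2l//.
by have := H i; rewrite sx ltn_ord => /(_ isT); rewrite /posn; lia.
Qed.

Lemma kap_le u v : `|kap R b u v| <= 2.
Proof.
have [|nuv] := boolP (v \in nb1 u); last by rewrite kap_far// normr0.
rewrite mem_nb1 => uv.
have [->|[->|->]] : v = u \/ v = u.+1 \/ u = v.+1 by lia.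
- by rewrite kap_stay; case: ifP => _; rewrite ?mulNr !normrN ?normr1 ?ger0_norm//; lra.
- by rewrite kap_up; case: ifP => _; rewrite ?normr1 ?ger0_norm//; lra.
- by rewrite kap_down ger0_norm//; lra.
Qed.

Lemma gen_le x z : `|gen R b n x z| <= 2 * n%:R.
Proof.
rewrite /gen (le_trans (ler_norm_sum _ _ _))//.
apply: (@le_trans _ _ (\sum_(i < n) 2)).
  by apply: ler_sum => i _; case: ifP => _; [exact: kap_le|rewrite normr0].
by rewrite sumr_const card_ord mulr_natr.
Qed.

Lemma size_nbl x : (size (nbl x) <= 3 ^ size x)%N.
Proof.
rewrite /nbl; elim: x => [//|a x IH]; rewrite [map _ _]/= [prodl _]/=.
rewrite size_allpairs [size (a :: x)]/= expnS; apply: leq_mul => //.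
by case: a.
Qed.

(** At most 3^n neighbours, entries of size at most 2n, and a change of weight by at most K^n. *)
Definition rate (K : R) : R := 3 ^+ n * (2 * n%:R * K ^+ n).

Lemma rate_ge0 K : 1 <= K -> 0 <= rate K.
Proof.
move=> K1; have K0 : 0 <= K by exact: le_trans K1.
by rewrite /rate !mulr_ge0// exprn_ge0.
Qed.

Lemma sum_nbP_le K (F : seq nat -> R) x : 1 <= K ->
  (forall z, `|F z| <= 2 * n%:R) -> \sum_(z <- nbP x) `|F z| * rho K z <= rate K * rho K x.
Proof.
move=> K1 F2; have K0 : 0 < K by exact: lt_le_trans K1.
have [sx|sx] := eqVneq (size x) n; last first.
  have -> : nbP x = [::].
    apply/eqP; rewrite -(negbK (_ == _)) -has_filter; apply/negP => /hasP[z /mem_nbl[sz _]].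
    by move=> /partP[sz' _]; move: sx; rewrite -sz sz' eqxx.
  by rewrite big_nil mulr_ge0 ?rate_ge0// ltW// rho_gt0.
apply: (@le_trans _ _ (\sum_(z <- nbP x) 2 * n%:R * K ^+ n * rho K x)).
  rewrite big_seq [leRHS]big_seq; apply: ler_sum => z; rewrite mem_filter => /andP[_ zn].
  rewrite -mulrA ler_pM//; first by rewrite ltW// rho_gt0.
  exact: rho_nbl.
rewrite big_const_seq count_predT iter_addr addr0 -[leLHS]mulr_natl /rate -!mulrA.
rewrite ler_wpM2r//.
  by rewrite !mulr_ge0 ?exprn_ge0 ?(ltW K0) ?(ltW (rho_gt0 _ K0)).
rewrite -natrX ler_nat (leq_trans _ (_ : size (nbl x) <= _)%N)//.
  by rewrite size_filter count_size.
by rewrite -sx size_nbl.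
Qed.

Lemma pgen_row_le K x : 1 <= K -> \sum_(z <- nbP x) `|pgen x z| * rho K z <= rate K * rho K x.
Proof.
move=> K1; apply: sum_nbP_le => // z; rewrite /pgen; case: ifP => _; first exact: gen_le.
by rewrite normr0 mulr_ge0.
Qed.

Definition momdet (g : 'I_n -> R -> R) (t : R) (p : nat -> nat) : R :=
  \det (\matrix_(i < n, j < n) mom b (g j) t (p i)).

(** Differentiating row by row yields one [kop] per particle. Equal positions give equal rows, so
    [gen_alternating] recombines these into the generator on partitions. *)
Lemma is_derive_momdet g (t : R) x : (forall j, cont11 (g j)) -> part n x ->
  is_derive t 1 (fun s => momdet g s (posn x n))
    (\sum_(y <- nbP x) gen R b n x y * momdet g t (posn y n)).
Proof.
move=> cg px; pose A (s : R) : 'M[R]_n := \matrix_(i < n, j < n) mom b (g j) s (posn x n i).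
pose A' : 'M[R]_n := \matrix_(i < n, j < n) kop b (mom b (g j) t) (posn x n i).
have dA i j : is_derive t 1 (fun s => A s i j) (A' i j).
  rewrite mxE; under eq_fun do rewrite mxE.
  exact: is_derive_mom.
apply: (is_derive_eq (is_derive_det dA)).
rewrite big_filter gen_alternating//; last 2 first.
- by move=> p q pq; congr (\det _); apply/matrixP => i j; rewrite !mxE pq.
- move=> p i j lin ljn ij pij; apply: (@det_eq_row _ _ _ (Ordinal lin) (Ordinal ljn)) => //.
  by move=> k; rewrite !mxE /= pij.
apply: eq_bigr => i _.
rewrite (@det_row_kop _ n b (fun v j => mom b (g j) t v) (posn x n) id i).
rewrite (expand_det_row _ i); apply: eq_bigr => j _; rewrite !mxE eqxx; congr (_ * _).
rewrite /cofactor; congr (_ * \det _); apply/matrixP => k l; rewrite !mxE.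
by have := neq_lift i k; rewrite -val_eqE eq_sym -val_eqE => /negbTE ->.
Qed.

Lemma momdet_bound g K : 3 <= K -> (forall j, cont11 (g j)) ->
  exists2 C, 0 <= C & forall t x, 0 <= t -> `|momdet g t (posn x n)| <= C * rho K x.
Proof.
move=> K3 cg.
have [C C0 HC] : exists2 C, 0 <= C &
    forall j t l, 0 <= t -> `|mom b (g j) t l| <= C * 3 ^+ l.
  have /choice[c cP] : forall j, exists c : R, 0 <= c /\
      forall t l, 0 <= t -> `|mom b (g j) t l| <= c * 3 ^+ l.
    by move=> j; have [c c0 cP] := mom_bound b (cg j); exists c.
  exists (\sum_j c j); first by apply: sumr_ge0 => j _; case: (cP j).
  move=> j t l t0; have [_ /(_ t l t0) h] := cP j; apply: (le_trans h).
  rewrite ler_wpM2r ?exprn_ge0// (bigD1 j)//= lerDl.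
  by apply: sumr_ge0 => k _; case: (cP k).
exists (n`!%:R * C ^+ n); first by rewrite mulr_ge0// exprn_ge0.
move=> t x t0; have K0 : 0 <= K by lra.
apply: (le_trans (@det_bound _ _ _ (fun i => C * K ^+ posn x n i) _)).
  move=> i j; rewrite mxE (le_trans (HC _ _ _ t0))// ler_wpM2l//.
  by rewrite lerXn2r// nnegrE.
rewrite -mulrA ler_wpM2l// /rho big_split/= prodr_const card_ord//.
Qed.

Definition phdet g (t : R) (x : seq nat) : R := if part n x then momdet g t (posn x n) else 0.

Lemma is_derive_phdet g (t : R) x : (forall j, cont11 (g j)) ->
  is_derive t 1 (fun s => phdet g s x) (finop pgen nbP (phdet g t) x).
Proof.
move=> cg; rewrite /phdet /finop /pgen; case px : (part n x); last first.
  by rewrite big1 => [|z _]; [exact: is_derive_cst|rewrite mul0r].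
apply: (is_derive_eq (is_derive_momdet t cg px)).
rewrite big_seq [RHS]big_seq; apply: eq_bigr => y; rewrite mem_filter => /andP[py _].
by rewrite py.
Qed.

End Moments.

(** * Transition determinants *)

Section Transition.
Variable R : realType.
Variables (b : bool) (n : nat).
Local Notation nbP := (nbP n).
Local Notation pgen := (pgen R b n).
Local Notation rho := (@rho R n).

Definition Udet (t : R) (x y : seq nat) : R :=
  \det (\matrix_(i < n, j < n) Iint b (phit t) (posn x n i) (posn y n j)).

Lemma Udet_momdet t x y : Udet t x y =
  lweight R b n y / pi ^+ n * momdet b (fun j : 'I_n => cheb b (posn y n j)) t (posn x n).
Proof.
rewrite /Udet /momdet mulrC.
have -> : lweight R b n y / pi ^+ n = \prod_(j < n) (Wt R b (posn y n j) / pi).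
  by rewrite big_split/= prodr_const card_ord exprVn.
rewrite -det_scale_col; congr (\det _); apply/matrixP => i j; rewrite !mxE.
by rewrite Iint_mom mulrC.
Qed.

(** By orthogonality the entries are indicators of equal positions. At the first index where two
    decreasing sequences differ, a row or a column vanishes. *)
Lemma Udet0 x y : part n x -> part n y -> Udet 0 x y = (x == y)%:R.
Proof.
move=> px py; rewrite /Udet.
have dX := wdecr_posn (part_wdecr px); have dY := wdecr_posn (part_wdecr py).
have [<-|xy] := eqVneq x y.
  rewrite (_ : \matrix_(_, _) _ = 1%:M) ?det1//; apply/matrixP => i j.
  rewrite !mxE Iint_phit0; congr (nat_of_bool _)%:R.
  apply/eqP/eqP => [pij|->//]; apply/val_inj => /=.
  have [ij|ij|//] := ltngtP i j.
    by have := dX i j; rewrite ij ltn_ord => /(_ isT); lia.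
  by have := dX j i; rewrite ij ltn_ord => /(_ isT); lia.
have ex : exists k, (k < n)%N && (posn x n k != posn y n k).
  apply: contrapT => nex; move/eqP: xy; apply.
  have [sx _] := partP _ _ px; have [sy _] := partP _ _ py.
  apply: (@eq_from_nth _ 0%N); first by rewrite sx sy.
  move=> k; rewrite sx => kn; apply/eqP/negPn/negP => ne; apply: nex; exists k.
  by rewrite kn /posn eqn_add2r.
have [k /andP[kn kne] kmin] := ex_minnP ex.
have eqk j : (j < k)%N -> posn x n j = posn y n j.
  move=> jk; apply/eqP/negPn/negP => ne; have := kmin j.
  by rewrite ne (ltn_trans jk kn) => /(_ isT); rewrite leqNgt jk.
have [lt|lt|e] := ltngtP (posn x n k) (posn y n k); last by rewrite e eqxx in kne.
  rewrite (expand_det_col _ (Ordinal kn)) big1// => i _; rewrite mxE Iint_phit0 /=.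
  suff -> : (posn x n i == posn y n k) = false by rewrite mul0r.
  have [ik|ik] := ltnP i k.
    by rewrite eqk//; have := dY i k; rewrite ik kn => /(_ isT); lia.
  have [ik'|ki] := eqVneq (i : nat) k; first by rewrite ik'; lia.
  by have := dX k i; rewrite ltn_ord ltn_neqAle eq_sym ki ik => /(_ isT); lia.
rewrite (expand_det_row _ (Ordinal kn)) big1// => i _; rewrite mxE Iint_phit0 /=.
suff -> : (posn x n k == posn y n i) = false by rewrite mul0r.
have [ik|ik] := ltnP i k.
  by rewrite -eqk//; have := dX i k; rewrite ik kn => /(_ isT); lia.
have [ik'|ki] := eqVneq (i : nat) k; first by rewrite ik'; lia.
by have := dY k i; rewrite ltn_ord ltn_neqAle eq_sym ki ik => /(_ isT); lia.
Qed.

Definition pUdet (y : seq nat) (t : R) (x : seq nat) : R := if part n x then Udet t x y else 0.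

Lemma pUdetE y t x : pUdet y t x =
  lweight R b n y / pi ^+ n * phdet b (fun j : 'I_n => cheb b (posn y n j)) t x.
Proof. by rewrite /pUdet /phdet; case: (part n x); rewrite ?mulr0// Udet_momdet. Qed.

Lemma finopZ (S : eqType) (c : S -> S -> R) (r : S -> seq S) (k : R) f x :
  finop c r (fun z => k * f z) x = k * finop c r f x.
Proof. by rewrite /finop mulr_sumr; apply: eq_bigr => z _; rewrite mulrCA. Qed.

Lemma is_derive_pUdet y (t : R) x :
  is_derive t 1 (fun s => pUdet y s x) (finop pgen nbP (pUdet y t) x).
Proof.
under eq_fun do rewrite pUdetE.
rewrite (_ : pUdet y t = fun z => lweight R b n y / pi ^+ n *
   phdet b (fun j : 'I_n => cheb b (posn y n j)) t z); last first.
  by apply/funext => z; rewrite pUdetE.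
rewrite finopZ; apply: is_derive_cM; apply: is_derive_phdet => j; exact: cheb_cont.
Qed.

Lemma phdet_bound g K : 3 <= K -> (forall j, cont11 (g j)) ->
  exists2 C, 0 <= C & forall t x, 0 <= t -> `|@phdet R b n g t x| <= C * rho K x.
Proof.
move=> K3 cg; have [C C0 HC] := momdet_bound b K3 cg; exists C => // t x t0.
rewrite /phdet; case: (part n x); first exact: HC.
by rewrite normr0 mulr_ge0// ltW// rho_gt0//; lra.
Qed.

Lemma pUdet_bound y K : 3 <= K ->
  exists2 C, 0 <= C & forall t x, 0 <= t -> `|pUdet y t x| <= C * rho K x.
Proof.
move=> K3; have [j|C C0 HC] := @phdet_bound (fun j : 'I_n => cheb b (posn y n j)) K K3.
  exact: cheb_cont.
have c0 : 0 <= lweight R b n y / pi ^+ n.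
  by rewrite divr_ge0 ?exprn_ge0 ?pi_ge0// ltW// lweight_gt0.
exists (lweight R b n y / pi ^+ n * C); first exact: mulr_ge0.
by move=> t x t0; rewrite pUdetE normrM ger0_norm// -[leRHS]mulrA ler_wpM2l// HC.
Qed.

Lemma pUdet0 y : part n y -> pUdet y 0 = fun x => (x == y)%:R.
Proof.
move=> py; apply/funext => x; rewrite /pUdet; case: (boolP (part n x)) => px.
  by rewrite Udet0.
by case: eqP => // E; rewrite E py in px.
Qed.

Lemma rate_bound (K : R) : 1 <= K -> forall x, \sum_(z <- nbP x) `|pgen x z| * rho K z <= rate n K * rho K x.
Proof. by move=> K1 x; exact: pgen_row_le. Qed.

Lemma pgen_off x z : z != x -> 0 <= pgen x z.
Proof.
move=> /eqP zx; rewrite /pgen; case: (boolP (part n x && part n z)) => // /andP[px pz].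
have [sx _] := partP _ _ px; have [sz _] := partP _ _ pz.
have [ex|nex] := pselect (exists2 i, (i < n)%N & agree n i x z); last first.
  by rewrite gen_notagree// => i lin; apply/negP => ag; apply: nex; exists i.
case: ex => i lin ag; have xz : x <> z by move=> E; apply: zx.
rewrite (gen_agree _ _ xz sx sz lin ag).
have [|nk] := boolP (posn z n i \in nb1 (posn x n i)); last by rewrite kap_far.
rewrite mem_nb1 => nb.
have [E|[->|->]] : posn z n i = posn x n i \/ posn z n i = (posn x n i).+1 \/
  posn x n i = (posn z n i).+1 by lia.
- case: xz; apply: (@eq_from_nth _ 0%N); first by rewrite sx sz.
  move=> j; rewrite sx => jn; have [->|ji] := eqVneq j i.
    by apply/eqP; rewrite -(eqn_add2r (n - i.+1)); apply/eqP; exact: esym E.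
  exact: (agreeP _ _ _ _ ag).
- by rewrite kap_up; case: ifP => _ //; lra.
- by rewrite kap_down; lra.
Qed.

Lemma pgen_diag x : - (2 * n%:R) <= pgen x x.
Proof.
rewrite /pgen; case: ifP => _; last by rewrite lerNl oppr0 mulr_ge0.
by rewrite lerNl (le_trans (ler_norm _))// normrN gen_le.
Qed.

Lemma nbP_refl x : part n x -> x \in nbP x.
Proof. by move=> px; rewrite mem_filter px nbl_refl. Qed.

Lemma finop_pgen_pos K (h : R -> seq nat -> R) (C T : R) : 1 <= K ->
  (forall (t : R) x, is_derive t 1 (fun s => h s x) (finop pgen nbP (h t) x)) ->
  (forall t x, 0 <= t <= T -> `|h t x| <= C * rho K x) ->
  (forall x, 0 <= h 0 x) ->
  forall t x, 0 <= t <= T -> 0 <= h t x.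
Proof.
move=> K1 dh bh h0; have K0 : 0 < K by exact: lt_le_trans K1.
(* [finop_pos] wants the diagonal in every row, also for lists that are not partitions; there the
   added coefficient is 0. *)
pose r x := undup (x :: nbP x).
have finE f x : finop pgen r f x = finop pgen nbP f x.
  apply: sum_subset_eq; [exact: nbP_uniq|exact: undup_uniq| |].
    by move=> z zn; rewrite mem_undup inE zn orbT.
  move=> z; rewrite mem_undup inE => /orP[/eqP->|->//] xn.
  rewrite /pgen; case: (boolP (part n x)) => [/nbP_refl px|]; first by rewrite px in xn.
  by rewrite mul0r.
have rowE x : \sum_(z <- r x) `|pgen x z| * rho K z <= rate n K * rho K x.
  rewrite (_ : \sum_(_ <- _) _ = \sum_(z <- nbP x) `|pgen x z| * rho K z); first exact: pgen_row_le.
  apply: sum_subset_eq; [exact: nbP_uniq|exact: undup_uniq| |].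
    by move=> z zn; rewrite mem_undup inE zn orbT.
  move=> z; rewrite mem_undup inE => /orP[/eqP->|->//] xn.
  rewrite /pgen; case: (boolP (part n x)) => [/nbP_refl px|]; first by rewrite px in xn.
  by rewrite normr0 mul0r.
apply: (@finop_pos _ _ pgen r (rho K) (rate n K) (2 * n%:R) T _ rowE _ _ _ _ _ h C _ bh h0).
- by move=> x; rewrite ltW// rho_gt0.
- by rewrite mulr_ge0.
- by move=> x; exact: undup_uniq.
- by move=> x; rewrite mem_undup mem_head.
- by move=> x z; exact: pgen_off.
- exact: pgen_diag.
- by move=> t x; rewrite finE.
Qed.

(** The initial value is an indicator and the off-diagonal rates are nonnegative, so no count of
    nonintersecting paths is required. *)
Lemma Udet_ge0 t x y : 0 <= t -> part n x -> part n y -> 0 <= Udet t x y.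
Proof.
move=> t0 px py; have [C C0 HC] := @pUdet_bound y 3 (lexx _).
have := @finop_pgen_pos 3 (pUdet y) C t (ltac:(by rewrite ler1n)) (is_derive_pUdet y).
rewrite /pUdet => H; have := H _ _ t x; rewrite px; apply.
- by move=> s z /andP[s0 _]; exact: HC.
- by move=> z; have := pUdet0 py; rewrite /pUdet => /(congr1 (fun f => f z)) ->.
- by rewrite t0 lexx.
Qed.

Lemma Udet_series t x y : 0 <= t -> part n x -> part n y ->
  series (fun k => t ^+ k / k`!%:R * finpow pgen nbP k x y) @ \oo --> Udet t x y.
Proof.
move=> t0 px py; have [C C0 HC] := @pUdet_bound y 3 (lexx _).
have rho0 z : 0 <= rho 3 z by rewrite ltW// rho_gt0.
have tt : 0 <= t <= t by rewrite t0 lexx.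
have K1 : (1 : R) <= 3 by rewrite ler1n.
have := finop_taylor rho0 (rate_bound K1) (is_derive_pUdet y)
  (fun s z (sT : 0 <= s <= t) => HC s z (proj1 (andP sT))) (x := x) tt.
by rewrite pUdet0// /pUdet px.
Qed.

(** Up to constants this is the top marginal without its dimension factor. The weight W turns a
    solution of the equation for functions into one of the transposed equation. *)
Definition topmass (g : 'I_n -> R -> R) (t : R) (x : seq nat) : R :=
  lweight R b n x * phdet b g t x.

Lemma lweight_le x : lweight R b n x <= 2 ^+ n.
Proof.
rewrite /lweight (_ : 2 ^+ n = \prod_(i < n) (2 : R)); last by rewrite prodr_const card_ord.
apply: ler_prod => i _; rewrite (ltW (Wt_gt0 _ _ _))/= /Wt.
by case: b; rewrite ?ler1n//; case: eqP; rewrite ?ler1n.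
Qed.

Lemma topmass_bound g K : 3 <= K -> (forall j, cont11 (g j)) ->
  exists2 C, 0 <= C & forall t x, 0 <= t -> `|topmass g t x| <= C * rho K x.
Proof.
move=> K3 cg; have [C C0 HC] := phdet_bound K3 cg.
exists (2 ^+ n * C); first by rewrite mulr_ge0// exprn_ge0.
move=> t x t0; rewrite normrM -mulrA ler_pM// ?HC//.
by rewrite ger0_norm ?lweight_le// ltW// lweight_gt0.
Qed.

Lemma is_derive_topmass g (t : R) y : (forall j, cont11 (g j)) ->
  is_derive t 1 (fun s => topmass g s y) (finop (fun y x => pgen x y) nbP (topmass g t) y).
Proof.
move=> cg; have := is_derive_cM (lweight R b n y) (is_derive_phdet b t y cg).
move/is_derive_eq; apply; rewrite /finop mulr_sumr big_seq [RHS]big_seq.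
apply: eq_bigr => x _; rewrite /topmass /pgen andbC.
by case: ifP => _; rewrite ?mul0r ?mulr0// mulrA gen_sym; ring.
Qed.

Lemma topmass_evolves g t y : (forall j, cont11 (g j)) -> 0 <= t -> part n y ->
  hassum [set x | part n x] (fun x => topmass g 0 x * Udet t x y) (topmass g t y).
Proof.
move=> cg t0 py; have [C C0 HC] := topmass_bound (lexx 3) cg.
have rho0 z : 0 <= rho 3 z by rewrite ltW// rho_gt0.
have K1 : (1 : R) <= 3 by rewrite ler1n.
have col z : \sum_(x <- nbP z) `|pgen x z| * rho 3 x <= rate n 3 * rho 3 z.
  apply: sum_nbP_le => // x; rewrite /pgen; case: ifP => _; first exact: gen_le.
  by rewrite normr0 mulr_ge0.
have tt : 0 <= t <= t by rewrite t0 lexx.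
apply: (@hassum_exp _ _ _ pgen nbP (rho 3) (rate n 3) _ _ _ _ _ _ _ _ _ y C t) => //=.
- exact: rate_ge0.
- by move=> x; exact: nbP_uniq.
- by move=> x z _; rewrite mem_filter => /andP[].
- by move=> x z px pz; rewrite !mem_filter px pz /= nbl_sym.
- move=> x z px pz; rewrite /pgen px pz mem_filter pz /=.
  by case/partP: px => sx _; case/partP: pz => sz _; exact: gen_supp.
- by move=> x _; exact: HC.
- by move=> x px; exact: Udet_series.
- exact: (finop_taylor rho0 col (fun s z => is_derive_topmass s z cg)
    (fun s z (sT : 0 <= s <= t) => HC s z (proj1 (andP sT))) tt).
Qed.

End Transition.

Section Box.

(** Interlacing bounds every lower entry by the first entry of the level above, so sums over a lower
    level reduce to a box. *)
Definition boxp (n r : nat) : seq (seq nat) := [seq z <- prodl (nseq n (iota 0 r.+1)) | part n z].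

Lemma boxp_uniq n r : uniq (boxp n r).
Proof.
apply/filter_uniq/prodl_uniq/allP => c; rewrite mem_nseq => /andP[_ /eqP ->].
exact: iota_uniq.
Qed.

Lemma mem_boxp n r z : reflect (part n z /\ forall i, (i < n)%N -> (nth 0%N z i <= r)%N)
  (z \in boxp n r).
Proof.
rewrite mem_filter mem_prodl; apply: (iffP andP) => -[pz].
  move=> /(all2_nthP 0%N [::])[_]; rewrite size_nseq => H; split => // i lin.
  by have := H i lin; rewrite nth_nseq lin mem_iota add0n ltnS.
move=> H; split => //; apply/(all2_nthP 0%N [::]); rewrite size_nseq.
have [sz _] := partP _ _ pz; split => // i lin.
by rewrite nth_nseq lin mem_iota add0n ltnS; exact: H.
Qed.

Lemma size_boxp n r : (size (boxp n r) <= r.+1 ^ n)%N.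
Proof.
rewrite /boxp size_filter (leq_trans (count_size _ _))//.
by rewrite size_prodl big_nseq iter_muln_1 size_iota.
Qed.

Lemma part_le_head n x i : part n x -> (nth 0%N x i <= nth 0%N x 0%N)%N.
Proof.
move=> /partP[sx H]; elim: i => [//|i IH]; have [h|h] := ltnP i.+1 n.
  exact: leq_trans (H _ h) IH.
by rewrite nth_default ?sx.
Qed.

Lemma il_boxp M r z x : part (uphalf M) z -> part (lvn M) x -> il z x ->
  (nth 0%N x 0%N <= r)%N -> z \in boxp (uphalf M) r.
Proof.
move=> pz px /ilP H xr; apply/mem_boxp; split => // i lin.
have [sx _] := partP _ _ px.
have [h _] := H i (ltac:(rewrite sx lvnE; lia)).
exact: leq_trans h (leq_trans (part_le_head i px) xr).
Qed.

End Box.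

(** * Comparison of two consecutive levels *)

Section Intertwined.
Variable R : realType.
Variable M : nat.
Local Notation bm := (~~ odd M).
Local Notation nm := (uphalf M).
Local Notation bx := (~~ odd M.+1).
Local Notation nx := (uphalf M.+1).
Local Notation wm := (lweight R bm nm).

(* By [intertwine] this solves the same equation as [Udet] on the upper level, so their
   difference stays nonnegative if it is so at time 0. *)
Definition downsum (y : seq nat) (t : R) (x : seq nat) : R :=
  if part nx x then
    \sum_(z <- boxp nm (nth 0%N x 0%N)) wm z * (il z x)%:R * Udet bm nm t z y
  else 0.

Lemma sum_boxp_il x r (F : seq nat -> R) : part nx x -> (nth 0%N x 0%N <= r)%N ->
  \sum_(z <- boxp nm r) wm z * (il z x)%:R * F z =
  \sum_(z <- boxp nm (nth 0%N x 0%N)) wm z * (il z x)%:R * F z.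
Proof.
move=> px xr; apply: sum_subset_eq; [exact: boxp_uniq|exact: boxp_uniq| |].
  by move=> z /mem_boxp[pz H]; apply/mem_boxp; split => // i lin; exact: leq_trans (H i lin) xr.
move=> z /mem_boxp[pz _] nz; have [ilz|] := boolP (il z x); last by rewrite mulr0 mul0r.
by rewrite (il_boxp pz px ilz) in nz.
Qed.

Lemma is_derive_downsum y (t : R) x :
  is_derive t 1 (fun s => downsum y s x) (finop (pgen R bx nx) (nbP nx) (downsum y t) x).
Proof.
rewrite /downsum; case: (boolP (part nx x)) => px; last first.
  rewrite /finop big1 => [|z _]; first exact: is_derive_cst.
  by rewrite /pgen (negbTE px) mul0r.
(* One box serves for [x], for its neighbours and for the neighbours of the lists below [x]; by
   [sum_boxp_il] enlarging the box changes nothing. *)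
pose r := (nth 0%N x 0%N).+1; pose B := boxp nm r.+1.
have H : is_derive t 1 (fun s => \sum_(z <- boxp nm (nth 0%N x 0%N)) wm z * (il z x)%:R * pUdet bm nm y s z)
   (\sum_(z <- boxp nm (nth 0%N x 0%N)) wm z * (il z x)%:R * finop (pgen R bm nm) (nbP nm) (pUdet bm nm y t) z).
  apply: is_derive_sum_seq => z; apply: is_derive_cM; exact: is_derive_pUdet.
rewrite (_ : (fun s => _) = (fun s => \sum_(z <- boxp nm (nth 0%N x 0%N)) wm z * (il z x)%:R * pUdet bm nm y s z)); last first.
  apply/funext => s; rewrite big_seq [RHS]big_seq; apply: eq_bigr => z /mem_boxp[pz _].
  by rewrite /pUdet pz.
apply: (is_derive_eq H).
rewrite -(@sum_boxp_il x r.+1)//; last by rewrite /r; lia.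
have inB z : z \in nbP nm z -> z \in B -> True by [].
(* Detailed balance transposes the lower generator so that it acts on the interlacing indicator;
   [intertwine] then turns it into the upper generator. *)
transitivity (\sum_(z' <- B) wm z' * pUdet bm nm y t z' *
    \sum_(z <- nbP nm z' | part nm z) sgen R M z' z * (il z x)%:R).
  transitivity (\sum_(z <- B) \sum_(z' <- B) wm z * (il z x)%:R *
      (pgen R bm nm z z' * pUdet bm nm y t z')).
    rewrite big_seq [RHS]big_seq; apply: eq_bigr => z /mem_boxp[pz zr].
    rewrite -mulr_sumr; have [ilz|] := boolP (il z x); last by rewrite mulr0 !mul0r.
    congr (_ * _); apply/esym.
    have zb := il_boxp pz px ilz (leqnn _).
    apply: sum_subset_eq; [exact: nbP_uniq|exact: boxp_uniq| |].
      move=> z'; rewrite mem_filter => /andP[pz' /mem_nbl[_ nb]]; apply/mem_boxp; split => // i lin.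
      have [sz _] := partP _ _ pz; have [h _] := nb i (ltac:(by rewrite sz)).
      have [_ /(_ i lin) h2] := mem_boxp _ _ _ zb.
      by rewrite /r; lia.
    move=> z' /mem_boxp[pz' _] nz'; rewrite /pgen pz pz' /=.
    have [->|g0] := eqVneq (gen R bm nm z z') 0; first by rewrite mul0r.
    have [sz _] := partP _ _ pz; have [sz' _] := partP _ _ pz'.
    by rewrite mem_filter pz' (gen_supp sz sz' g0) in nz'.
  rewrite exchange_big /= big_seq [RHS]big_seq; apply: eq_bigr => z' /mem_boxp[pz' zr'].
  rewrite mulr_sumr.
  transitivity (\sum_(z <- B) wm z' * pUdet bm nm y t z' * (sgen R M z' z * (il z x)%:R)).
    rewrite big_seq [RHS]big_seq; apply: eq_bigr => z /mem_boxp[pz _].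
    rewrite /pgen pz pz' /= /sgen.
    transitivity (wm z * gen R bm nm z z' * ((il z x)%:R * pUdet bm nm y t z')); first by ring.
    by rewrite gen_sym; ring.
  rewrite [RHS]big_mkcond /= [RHS]big_seq.
  pose W := undup (B ++ nbP nm z').
  transitivity (\sum_(z <- W) wm z' * pUdet bm nm y t z' * (sgen R M z' z * (il z x)%:R)).
    apply/esym/sum_subset_eq; [exact: boxp_uniq|exact: undup_uniq| |].
      by move=> z zB; rewrite mem_undup mem_cat zB.
    move=> z; rewrite mem_undup mem_cat => /orP[->//|]; rewrite mem_filter => /andP[pz _] nzB.
    have [ilz|] := boolP (il z x); last by rewrite !mulr0.
    by rewrite (il_boxp pz px ilz) in nzB; rewrite /r; lia.
  rewrite (_ : \sum_(i <- nbP nm z' | _) _ = \sum_(z <- nbP nm z') wm z' * pUdet bm nm y t z' * (sgen R M z' z * (il z x)%:R)); last first.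
    rewrite [RHS]big_seq; apply: eq_bigr => z; rewrite mem_filter => /andP[pz _].
    by rewrite pz.
  apply: sum_subset_eq; [exact: nbP_uniq|exact: undup_uniq| |].
    by move=> z zB; rewrite mem_undup mem_cat zB orbT.
  move=> z; rewrite mem_undup mem_cat => /orP[|->//] /mem_boxp[pz _] nz.
  have [->|g0] := eqVneq (sgen R M z' z) 0; first by rewrite mul0r mulr0.
  have [sz _] := partP _ _ pz; have [sz' _] := partP _ _ pz'.
  by rewrite mem_filter pz (gen_supp sz' sz g0) in nz.
transitivity (\sum_(z' <- B) wm z' * pUdet bm nm y t z' *
    \sum_(x' <- nbl x | part nx x') sgen R M.+1 x x' * (il z' x')%:R).
  rewrite big_seq [RHS]big_seq; apply: eq_bigr => z' /mem_boxp[pz' _].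
  rewrite -(intertwine R pz' px) big_filter_cond; congr (_ * _); apply: eq_bigl => z.
  by rewrite andbb.
under eq_bigr do rewrite mulr_sumr.
rewrite exchange_big /= /finop big_filter [LHS]big_seq_cond [RHS]big_seq_cond.
apply: eq_bigr => x' /andP[/mem_nbl[_ nb] px'].
have x'r : (nth 0%N x' 0%N <= r.+1)%N.
  have [sx _] := partP _ _ px; have [h _] := nb 0%N (ltac:(by rewrite sx)).
  by rewrite /r; lia.
rewrite px' /pgen px px' /= /sgen.
transitivity (gen R bx nx x x' * \sum_(z' <- B) wm z' * (il z' x')%:R * pUdet bm nm y t z').
  by rewrite mulr_sumr; apply: eq_bigr => z' _; ring.
congr (_ * _); rewrite sum_boxp_il// big_seq [RHS]big_seq.
by apply: eq_bigr => z' /mem_boxp[pz' _]; rewrite /pUdet pz'.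
Qed.

Lemma il_rho (K : R) z x : 1 <= K -> size x = nx -> il z x -> rho nm K z <= rho nx K x.
Proof.
move=> K1 sx /ilP H; have K0 : 0 <= K by exact: le_trans K1.
rewrite /rho.
have nE : nx = (nm + (nx - nm))%N by rewrite /=; lia.
apply: (@le_trans _ _ (\prod_(i < nm) K ^+ posn x nx i)).
  apply: ler_prod => i _; rewrite exprn_ge0//= ler_weXn2l//.
  have := ltn_ord i; have [h _] := H i (ltac:(rewrite sx /=; have := ltn_ord i; lia)).
  by move: h; rewrite /posn; lia.
rewrite -(big_mkord xpredT (fun i => K ^+ posn x nx i)) -(big_mkord xpredT (fun i => K ^+ posn x nx i)).
rewrite (@big_cat_nat _ _ _ nm 0%N nx)//=; last by lia.
rewrite ler_peMr//; first by rewrite prodr_ge0// => i _; rewrite exprn_ge0.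
by apply: (big_ind (fun u : R => 1 <= u)) => // [u v u1 v1|i _]; [exact: mulr_ege1|exact: exprn_ege1].
Qed.

Lemma downsum_bound y : exists2 K, 3 <= K & exists2 C, 0 <= C &
  forall t x, 0 <= t -> `|downsum y t x| <= C * rho nx K x.
Proof.
have [C C0 HC] := pUdet_bound bm nm y (lexx (3 : R)).
(* One factor 3 per position bounds [Udet]; the remaining 3^nm absorbs the size of the box, at most
   (x_0 + 1)^nm with x_0 the first entry of [x]. *)
pose K : R := 3 ^+ nm.+1.
have K3 : 3 <= K by rewrite /K -[leLHS]expr1 ler_weXn2l// ler1n.
exists K => //; exists (2 ^+ nm * C); first by rewrite mulr_ge0// exprn_ge0.
move=> t x t0; rewrite /downsum; case: (boolP (part nx x)) => px; last first.
  by rewrite normr0 !mulr_ge0 ?exprn_ge0// ltW// rho_gt0//; lra.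
have [sx _] := partP _ _ px.
rewrite (le_trans (ler_norm_sum _ _ _))//.
apply: (@le_trans _ _ (\sum_(z <- boxp nm (nth 0%N x 0%N)) 2 ^+ nm * (C * rho nx 3 x))).
  rewrite big_seq [leRHS]big_seq; apply: ler_sum => z /mem_boxp[pz _].
  rewrite -mulrA normrM; apply: ler_pM => //.
    rewrite ger0_norm; last by rewrite ltW// lweight_gt0.
    rewrite /lweight (_ : 2 ^+ nm = \prod_(i < nm) (2 : R)); last by rewrite prodr_const card_ord.
    apply: ler_prod => i _; rewrite (ltW (Wt_gt0 _ _ _))/= /Wt.
    by case: bm; rewrite ?ler1n//; case: eqP; rewrite ?ler1n.
  have [ilz|] := boolP (il z x); last first.
    by rewrite mul0r normr0 mulr_ge0// ltW// rho_gt0.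
  rewrite mul1r; have := HC t z t0; rewrite /pUdet pz => h; apply: (le_trans h).
  by rewrite ler_wpM2l// il_rho// ler1n.
rewrite big_const_seq count_predT iter_addr addr0 -[leLHS]mulr_natl.
rewrite mulrCA -mulrA ler_wpM2l ?exprn_ge0//= mulrCA ler_wpM2l//.
have -> : rho nx K x = rho nx (3 ^+ nm) x * rho nx 3 x.
  rewrite /rho -big_split/=; apply: eq_bigr => i _.
  by rewrite /K exprS exprMn mulrC.
rewrite ler_wpM2r//; first by rewrite ltW// rho_gt0.
apply: (@le_trans _ _ ((nth 0%N x 0%N).+1 ^ nm)%N%:R).
  by rewrite ler_nat size_boxp.
rewrite natrX.
apply: (@le_trans _ _ ((3 ^+ nm) ^+ posn x nx 0%N)).
  rewrite -exprM mulnC exprM lerXn2r// ?nnegrE ?exprn_ge0//.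
  rewrite -natrX ler_nat; apply: (@leq_trans (posn x nx 0%N).+1).
    by rewrite ltnS /posn leq_addr.
  by elim: (posn x nx 0%N) => [//|k IH]; rewrite expnS; lia.
rewrite /rho /= big_ord_recl /= ler_peMr ?exprn_ge0 ?exprn_ge0//.
apply: (big_ind (fun u : R => 1 <= u)) => // [u v u1 v1|i _]; first exact: mulr_ege1.
by rewrite !exprn_ege1// ler1n.
Qed.

(** The difference of the two sides solves the upper equation and is nonnegative at time 0. It
    compares a single summand of T Lambda with Lambda T. *)
Lemma Udet_downsum_le t x y y' : 0 <= t -> part nx x -> part nm y -> part nx y' ->
  wm y * (il y y')%:R * Udet bx nx t x y' <=
  \sum_(z <- boxp nm (nth 0%N x 0%N)) wm z * (il z x)%:R * Udet bm nm t z y.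
Proof.
move=> t0 px py py'.
have [K K3 [C C0 HC]] := downsum_bound y.
have [C' C'0 HC'] := pUdet_bound bx nx y' K3.
pose c : R := wm y * (il y y')%:R.
have c0 : 0 <= c by rewrite mulr_ge0// ltW// lweight_gt0.
pose h s z := downsum y s z - c * pUdet bx nx y' s z.
have K1 : 1 <= K by lra.
have dh (s : R) z : is_derive s 1 (fun s => h s z) (finop (pgen R bx nx) (nbP nx) (h s) z).
  have E : finop (pgen R bx nx) (nbP nx) (h s) z = finop (pgen R bx nx) (nbP nx) (downsum y s) z -
      c * finop (pgen R bx nx) (nbP nx) (pUdet bx nx y' s) z.
    by rewrite /finop mulr_sumr -sumrB; apply: eq_bigr => w _; rewrite /h; ring.
  rewrite E; apply: is_deriveB; first exact: is_derive_downsum.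
  by apply: is_derive_cM; exact: is_derive_pUdet.
have bh s z : 0 <= s <= t -> `|h s z| <= (C + c * C') * rho nx K z.
  move=> /andP[s0 _]; rewrite (le_trans (ler_normB _ _))// mulrDl lerD ?HC//.
  by rewrite normrM ger0_norm// -[leRHS]mulrA ler_wpM2l// HC'.
have h0 z : 0 <= h 0 z.
  rewrite /h pUdet0// /downsum; case: (boolP (part nx z)) => pz; last first.
    by case: eqP pz => [->|_]; rewrite ?py'// mulr0 subrr.
  rewrite (eq_big_seq (fun u => wm u * (il u z)%:R * (u == y)%:R)); last first.
    by move=> u /mem_boxp[pu _]; rewrite Udet0.
  have nn u : 0 <= wm u * (il u z)%:R * (u == y)%:R.
    by rewrite !mulr_ge0// ltW// lweight_gt0.
  have [E|_] := eqVneq z y'; last by rewrite mulr0 subr0 sumr_ge0.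
  subst z; rewrite mulr1 /c; have [ily|] := boolP (il y y'); last by rewrite mulr0 subr0 sumr_ge0.
  rewrite mulr1 subr_ge0 (bigD1_seq y)/=; [|exact: (il_boxp py py' ily)|exact: boxp_uniq].
  by rewrite ily eqxx !mulr1 lerDl sumr_ge0.
have := finop_pgen_pos K1 dh bh h0 (t := t) x; rewrite t0 lexx => /(_ isT).
by rewrite /h /downsum /pUdet px subr_ge0 /c.
Qed.

End Intertwined.

(** * Telescoping along the levels *)

Section Links.
Variable R : realType.

Lemma sqr_diff_gt0 (u v : R) : 0 <= v -> v < u -> 0 < u ^+ 2 - v ^+ 2.
Proof. by move=> v0 vu; rewrite subr_gt0 ltrXn2r// nnegrE// ltW// (le_lt_trans v0). Qed.

Lemma dimSO_gt0 b n l : part n l -> 0 < dimSO R b n l.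
Proof.
move=> pl; have dl := wdecr_posn (part_wdecr pl).
have key (e : R) : 0 <= e -> 0 < \prod_(i < n) \prod_(j < n | (i < j)%N)
   ((((posn l n i)%:R + e) ^+ 2 - ((posn l n j)%:R + e) ^+ 2) /
    (((n - i.+1)%:R + e) ^+ 2 - ((n - j.+1)%:R + e) ^+ 2)).
  move=> e0; apply: prodr_gt0 => i _; apply: prodr_gt0 => j ij; apply: divr_gt0.
    by apply: sqr_diff_gt0; [exact: addr_ge0|rewrite ltrD2r ltr_nat; apply: dl; rewrite ij /=].
  apply: sqr_diff_gt0; [exact: addr_ge0|rewrite ltrD2r ltr_nat].
  by have := ltn_ord j; lia.
rewrite /dimSO; case: b.
  rewrite /dimB; apply: mulr_gt0.
    have := key (1 / 2) (ltac:(lra)); congr (0 < _); apply: eq_bigr => i _.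
    by apply: eq_bigr => j _; rewrite /lB /mB /posn !natrD.
  by apply: prodr_gt0 => i _; rewrite /lB /mB divr_gt0// ltr_wpDl ?addr_ge0.
have := key 0 (lexx _); rewrite /dimD; congr (0 < _); apply: eq_bigr => i _.
by apply: eq_bigr => j _; rewrite /lD /mD /posn !natrD !addr0.
Qed.

Local Notation dimk k := (dimSO R (lvb k) (lvn k)).
Local Notation wk k := (lweight R (lvb k) (lvn k)).

(** [calT] is the 0-1 matrix with its columns scaled by W for b = -1/2; the other link has a 0-1
    matrix, in accordance with W = 1 for b = 1/2. *)
Lemma LamE k x y : part (lvn k.+1) x -> part (lvn k) y ->
  Lam R k.+1 x y = dimk k y / dimk k.+1 x * (wk k y * (il y x)%:R).
Proof.
rewrite /Lam /lvb /=; case: (boolP (odd k)) => ok /= px py.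
  have nE : (lvn k.+1).-1 = lvn k by rewrite /lvn /=; lia.
  rewrite /Tminus nE /dimSO; congr (_ * _).
  have -> : lweight R true (lvn k) y = 1 by rewrite /lweight big1.
  rewrite mul1r -(@det_il _ (lvn k.+1))//; last by apply: part_wdecr_pred; rewrite nE.
  congr (\det _); apply/matrixP => i j; rewrite !mxE.
  (* The strict inequality of shifted integers is a weak one of positions; for the padding entry the
     left-hand side is -1. *)
  have -> : (posz y (lvn k.+1) j - 1 < posz x (lvn k.+1) i) =
      (posn y (lvn k.+1) j <= posn x (lvn k.+1) i)%N.
    by rewrite /posz /posn; have := ltn_ord i; have := ltn_ord j; lia.
  by case: ifP.
have nE : lvn k.+1 = lvn k by rewrite /lvn /=; lia.
rewrite nE in px *.
rewrite /Tplus /dimSO; congr (_ * _).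
rewrite mulrC -(@det_il _ (lvn k))//; last exact: part_wdecr.
rewrite -det_scale_col; congr (\det _); apply/matrixP => i j; rewrite !mxE /calT /Wt ltnNge.
by case: leqP => _; rewrite ?mul1r ?mul0r.
Qed.

Lemma Lam_ge0 k x y : part (lvn k.+1) x -> part (lvn k) y -> 0 <= Lam R k.+1 x y.
Proof.
move=> px py; rewrite LamE// mulr_ge0//.
  by rewrite divr_ge0// ltW// dimSO_gt0.
by rewrite mulr_ge0// ltW// lweight_gt0.
Qed.

Lemma TlevE (t : R) k x y : Tlev (phit t) k x y = Udet (lvb k) (lvn k) t x y * dimk k y / dimk k x.
Proof. by []. Qed.

Lemma Tlev_ge0 (t : R) k x y : 0 <= t -> part (lvn k) x -> part (lvn k) y ->
  0 <= Tlev (phit t) k x y.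
Proof.
move=> t0 px py; rewrite TlevE divr_ge0// ?mulr_ge0//; try by rewrite ltW// dimSO_gt0.
exact: Udet_ge0.
Qed.

Lemma Delta_sum (t : R) k x y : part (lvn k.+1) x ->
  Delta (phit t) k.+1 x y =
  \sum_(z <- boxp (lvn k) (nth 0%N x 0%N) | il z x) Lam R k.+1 x z * Tlev (phit t) k z y.
Proof.
move=> px; rewrite /Delta /= (@rsum_list _ _ _ _ (boxp (lvn k) (nth 0%N x 0%N))); last 2 first.
- exact: boxp_uniq.
- move=> z /is_partP pz; rewrite LamE//.
  have [ilz _|] := boolP (il z x); last by rewrite !mulr0 mul0r eqxx.
  exact: (@il_boxp k.+1 _ z x).
rewrite big_seq_cond [RHS]big_seq_cond [LHS]big_mkcond [RHS]big_mkcond; apply: eq_bigr => z _.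
case: (boolP (z \in boxp (lvn k) (nth 0%N x 0%N))) => //= /mem_boxp[pz _].
have -> : `[< is_part (lvn k) z >] by apply/asboolP/is_partP.
by case: ifP => // nil; rewrite LamE// nil !mulr0 mul0r.
Qed.

Lemma Delta_ge0 (t : R) k x y : 0 <= t -> part (lvn k.+1) x -> part (lvn k) y ->
  0 <= Delta (phit t) k.+1 x y.
Proof.
move=> t0 px py; rewrite Delta_sum// big_seq_cond sumr_ge0// => z /andP[/mem_boxp[pz _] _].
by rewrite mulr_ge0 ?Lam_ge0 ?Tlev_ge0.
Qed.

(** Used only when [Delta] vanishes, to make the numerator of the corresponding factor of A vanish
    as well. *)
Lemma Delta_ge (t : R) k x y x' : 0 <= t -> part (lvn k.+1) x -> part (lvn k) y ->
  part (lvn k.+1) x' ->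
  Tlev (phit t) k.+1 x x' * Lam R k.+1 x' y <= Delta (phit t) k.+1 x y.
Proof.
move=> t0 px py px'; rewrite Delta_sum// LamE// TlevE.
have := @Udet_downsum_le R k.+1 t x y x' t0 px py px'; rewrite /= !negbK => H.
have d1 := dimSO_gt0 (lvb k.+1) px; have d2 := dimSO_gt0 (lvb k) py.
have d3 := dimSO_gt0 (lvb k.+1) px'.
have -> : Udet (lvb k.+1) (lvn k.+1) t x x' * dimk k.+1 x' / dimk k.+1 x *
    (dimk k y / dimk k.+1 x' * (wk k y * (il y x')%:R)) =
   dimk k y / dimk k.+1 x * (wk k y * (il y x')%:R * Udet (lvb k.+1) (lvn k.+1) t x x').
  by field; rewrite !gt_eqF.
have -> : \sum_(z <- boxp (lvn k) (nth 0%N x 0%N) | il z x) Lam R k.+1 x z * Tlev (phit t) k z y =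
  dimk k y / dimk k.+1 x * \sum_(z <- boxp (lvn k) (nth 0%N x 0%N)) wk k z * (il z x)%:R * Udet (lvb k) (lvn k) t z y.
  rewrite mulr_sumr [LHS]big_mkcond big_seq [RHS]big_seq; apply: eq_bigr => z /mem_boxp[pz _].
  have d4 := dimSO_gt0 (lvb k) pz.
  case: ifP => ilz; last by rewrite mulr0 mul0r mulr0.
  by rewrite LamE// ilz TlevE; field; rewrite !gt_eqF.
by rewrite ler_wpM2l// divr_ge0// ltW.
Qed.

Definition linkprod (M : nat) (s : seq (seq nat)) : R :=
  \prod_(1 <= k < M) Lam R k (nth [::] s k) (nth [::] s k.-1).

Definition Aprod (t : R) (M : nat) (lam mu : seq (seq nat)) : R :=
  Tlev (phit t) 0 (nth [::] lam 0) (nth [::] mu 0) *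
  \prod_(1 <= k < M) (Tlev (phit t) k (nth [::] lam k) (nth [::] mu k) *
     Lam R k (nth [::] mu k) (nth [::] mu k.-1) / Delta (phit t) k (nth [::] lam k) (nth [::] mu k.-1)).

(* The convention A = 0 when some Delta vanishes is the one of [x / 0 = 0]. *)
Lemma Amat_prod t N a lam mu : Amat (phit t) N a lam mu = Aprod t (nlev N a) lam mu.
Proof.
rewrite /Amat /Aprod; case: asboolP => // H.
have [k kM /eqP D0] : exists2 k, (0 < k < nlev N a)%N &
    Delta (phit t) k (nth [::] lam k) (nth [::] mu k.-1) == 0.
  apply: contrapT => nex; apply: H => k kM; apply/negP => D0; apply: nex.
  by exists k.
apply/esym; rewrite (bigD1_seq k)/=; [|by rewrite mem_index_iota|exact: iota_uniq].
by rewrite D0 invr0 mulr0 mul0r mulr0.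
Qed.

(** The fibre of [last] over [x], built from the top level downwards; it is finite because
    interlacing bounds all lower levels. *)
Fixpoint fibp (k : nat) (x : seq nat) : seq (seq (seq nat)) :=
  match k with
  | 0%N => [:: [:: x]]
  | k'.+1 => flatten [seq [seq rcons l x | l <- fibp k' z] |
                       z <- boxp (lvn k') (nth 0%N x 0%N) & il z x]
  end.

Lemma mem_fibp k x l : part (lvn k) x -> (l \in fibp k x) = pathb k.+1 l && (last [::] l == x).
Proof.
elim: k x l => [|k IH] x l px.
  rewrite inE; apply/eqP/andP => [->|[]].
    rewrite (pathb_rcons 0 [::] x) px /=; split => //; apply/ilP => i.
    by have [-> _] := partP _ _ px; case: i.
  by case: l => [|a [|b l]]// _ /eqP /= ->.
apply/flatten_mapP/andP => [[z]|[pl /eqP lx]].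
  rewrite mem_filter => /andP[ilz /mem_boxp[pz _]] /mapP[s sf ->].
  move: sf; rewrite IH// => /andP[ps /eqP lz].
  by rewrite pathb_rcons ps px lz ilz last_rcons.
case/lastP: l pl lx => [/pathb_size//|s u]; rewrite last_rcons => psu uE; subst u.
move: psu; rewrite pathb_rcons => /and3P[ps _ ils].
have pz := pathb_last ps.
exists (last [::] s).
  by rewrite mem_filter ils; apply: (@il_boxp k.+1 _ _ x).
by apply/mapP; exists s => //; rewrite IH// ps eqxx.
Qed.

Lemma fibp_uniq k x : part (lvn k) x -> uniq (fibp k x).
Proof.
elim: k x => [//|k IH] x px /=.
set Z := [seq z <- _ | _].
have ZP z : z \in Z -> part (lvn k) z by rewrite mem_filter => /andP[_ /mem_boxp[]].
have uZ : uniq Z by apply: filter_uniq; exact: boxp_uniq.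
elim: Z ZP uZ => [//|z Z IHZ] ZP /= /andP[zZ uZ].
have pz := ZP z (mem_head _ _).
have ZP' w : w \in Z -> part (lvn k) w by move=> wZ; apply: ZP; rewrite inE wZ orbT.
rewrite cat_uniq IHZ// andbT map_inj_uniq; last by move=> s s' /rcons_inj[].
rewrite IH//=; apply/hasPn => l /flatten_mapP[w wZ /mapP[s sf ->]].
apply/negP => /mapP[s' sf' /rcons_inj[E]]; subst s'.
move: sf sf'; rewrite (mem_fibp _ (ZP' w wZ)) (mem_fibp _ pz) => /andP[_ /eqP lw] /andP[_ /eqP lz].
by rewrite -lz lw wZ in zZ.
Qed.

(** Once the levels below have been summed, the sum of Lambda T over the next level is [Delta], the
    denominator of the following factor. *)
Lemma sum_fibp t k x mu : 0 <= t -> part (lvn k) x ->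
  (forall j, (j <= k)%N -> part (lvn j) (nth [::] mu j)) ->
  \sum_(l <- fibp k x) linkprod k.+1 l * Aprod t k.+1 l mu =
  Tlev (phit t) k x (nth [::] mu k) * linkprod k.+1 mu.
Proof.
move=> t0; elim: k x => [|k IH] x px pmu.
  by rewrite big_seq1 /linkprod /Aprod !big_geq// mul1r.
rewrite /= big_flatten big_map big_filter.
set c := Tlev (phit t) k.+1 x (nth [::] mu k.+1) * Lam R k.+1 (nth [::] mu k.+1) (nth [::] mu k) /
   Delta (phit t) k.+1 x (nth [::] mu k).
have recE l : size l = k.+1 -> linkprod k.+2 (rcons l x) * Aprod t k.+2 (rcons l x) mu =
    linkprod k.+1 l * Aprod t k.+1 l mu * (Lam R k.+1 x (last [::] l) * c).
  move=> sl; rewrite /linkprod /Aprod !(big_nat_recr k.+1)//=.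
  have nl j : (j < k.+1)%N -> nth [::] (rcons l x) j = nth [::] l j.
    by move=> jk; rewrite nth_rcons sl jk.
  have -> : nth [::] (rcons l x) k.+1 = x by rewrite nth_rcons sl ltnn eqxx.
  rewrite (nl 0%N)// (nl k)//.
  have -> : nth [::] l k = last [::] l by rewrite -nth_last sl.
  rewrite (@eq_big_nat _ _ _ _ _ _ (fun j => Lam R j (nth [::] l j) (nth [::] l j.-1))); last first.
    by move=> j /andP[j0 jk]; rewrite !nl//; lia.
  rewrite (@eq_big_nat _ _ _ _ _ (fun j => Tlev (phit t) j (nth [::] (rcons l x) j) (nth [::] mu j) *
     Lam R j (nth [::] mu j) (nth [::] mu j.-1) / Delta (phit t) j (nth [::] (rcons l x) j) (nth [::] mu j.-1))
   (fun j => Tlev (phit t) j (nth [::] l j) (nth [::] mu j) *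
     Lam R j (nth [::] mu j) (nth [::] mu j.-1) / Delta (phit t) j (nth [::] l j) (nth [::] mu j.-1))); last first.
    by move=> j /andP[j0 jk]; rewrite !nl//; lia.
  by rewrite /c; ring.
have pmk : part (lvn k) (nth [::] mu k) by apply: pmu.
have pmk1 : part (lvn k.+1) (nth [::] mu k.+1) by apply: pmu.
transitivity (\sum_(z <- boxp (lvn k) (nth 0%N x 0%N) | il z x)
   Lam R k.+1 x z * Tlev (phit t) k z (nth [::] mu k) * (linkprod k.+1 mu * c)).
  rewrite big_seq_cond [RHS]big_seq_cond; apply: eq_bigr => z /andP[/mem_boxp[pz _] ilz].
  rewrite big_map.
  transitivity (\sum_(l <- fibp k z) linkprod k.+1 l * Aprod t k.+1 l mu * (Lam R k.+1 x z * c)).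
    rewrite big_seq [RHS]big_seq; apply: eq_bigr => l; rewrite mem_fibp// => /andP[pl /eqP lz].
    by rewrite recE ?(pathb_size pl)// lz.
  rewrite -mulr_suml IH//; first by ring.
  by move=> j jk; apply: pmu; exact: leqW.
rewrite -mulr_suml -Delta_sum//.
have -> : linkprod k.+2 mu = linkprod k.+1 mu * Lam R k.+1 (nth [::] mu k.+1) (nth [::] mu k).
  by rewrite /linkprod (big_nat_recr k.+1).
(* If [Delta] is 0, the left side is 0 by convention and the right side because T Lambda lies
   between 0 and [Delta]. *)
have [D0|D0] := eqVneq (Delta (phit t) k.+1 x (nth [::] mu k)) 0; last first.
  by rewrite /c; field.
have := Delta_ge t0 px pmk pmk1; rewrite D0 => le0.
have : Tlev (phit t) k.+1 x (nth [::] mu k.+1) * Lam R k.+1 (nth [::] mu k.+1) (nth [::] mu k) = 0.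
  by apply/eqP; rewrite eq_le le0 mulr_ge0// ?Tlev_ge0 ?Lam_ge0.
by move=> e0; rewrite mul0r mulrCA e0 mulr0.
Qed.

Lemma linkAprod_ge0 t M lam mu : 0 <= t -> (0 < M)%N -> pathb M lam -> pathb M mu ->
  0 <= linkprod M lam * Aprod t M lam mu.
Proof.
move=> t0 M0 pl pm.
have Lge s k : pathb M s -> (0 < k < M)%N -> 0 <= Lam R k (nth [::] s k) (nth [::] s k.-1).
  move=> ps /andP[]; case: k => // k _ kM.
  by apply: Lam_ge0; [exact: (pathb_part ps kM)|exact: (pathb_part ps (ltnW kM))].
apply: mulr_ge0.
  by rewrite /linkprod big_nat_cond prodr_ge0// => k /andP[kM _]; exact: Lge.
apply: mulr_ge0; first by apply: Tlev_ge0 => //; [exact: (pathb_part pl M0)|exact: (pathb_part pm M0)].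
rewrite big_nat_cond prodr_ge0// => k /andP[kM _]; apply: divr_ge0.
  rewrite mulr_ge0 ?Lge//; have /andP[_ kM'] := kM.
  by apply: Tlev_ge0 => //; [exact: (pathb_part pl kM')|exact: (pathb_part pm kM')].
case: k kM => // k /= kM.
by apply: Delta_ge0 => //; [exact: (pathb_part pl kM)|exact: (pathb_part pm (ltnW kM))].
Qed.

End Links.

(** * The measure moved by A *)

Section AHassum.
Variable R : realType.

Lemma hassumZ (S : choiceType) (D : set S) (c : R) (f f' : S -> R) (s : R) :
  hassum D f s -> (forall x, D x -> f' x = c * f x) -> hassum D f' (c * s).
Proof.
move=> [[C HC] Hs] ff.
have sumE (h h' : S -> R) (k : R) X : (forall x, x \in X -> D x) ->
    (forall x, D x -> h' x = k * h x) -> \sum_(x <- X) h' x = k * \sum_(x <- X) h x.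
  by move=> XD hh; rewrite mulr_sumr big_seq [RHS]big_seq; apply: eq_bigr => x /XD/hh.
split.
  exists (`|c| * C) => X uX XD.
  rewrite (sumE (fun x => `|f x|) (fun x => `|f' x|) `|c|)//.
    by rewrite ler_wpM2l// HC.
  by move=> x /ff ->; rewrite normrM.
move=> e e0; have c0 : 0 < `|c| + 1 by rewrite ltr_wpDl.
have [X0 X0D H] := Hs (e / (`|c| + 1)) (divr_gt0 e0 c0).
exists X0 => // X uX XD XX0; rewrite (sumE f f' c)// -mulrBr normrM.
apply: (@le_trans _ _ ((`|c| + 1) * (e / (`|c| + 1)))); last by rewrite mulrCA divff ?mulr1// gt_eqF.
by rewrite ler_pM ?H// lerDl.
Qed.

Definition gmom (E : R -> R) (n : nat) (j : 'I_n) (x : R) : R := x ^+ (n - j.+1) * E x.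

Lemma gmom_cont E n j : C1on11 E -> cont11 (@gmom E n j).
Proof.
move=> [E' [cE _]]; apply: cont11M; last exact: cE.
by apply: continuous_subspaceT => x; exact: exprn_continuous.
Qed.

Definition Pconst (E : R -> R) n b : R := CNa R n b * E 1 ^- n / pi ^+ n.

Lemma Ptop_topmass E (t : R) n b x :
  part n x -> Ptop (fun x : R => E x * phit t x) n b x =
  Pconst E n b * topmass b (@gmom E n) t x * dimSO R b n x.
Proof.
move=> px; rewrite /Ptop /Pconst /topmass /phdet px.
(* Since phi_t(1) = 1, the normalisation does not depend on t. *)
have -> : E 1 * phit t 1 = E 1 by rewrite /phit subrr mulr0 expR0 mulr1.
rewrite -!mulrA; congr (_ * (_ * _)); rewrite !mulrA; congr (_ * _).
have -> : (pi ^+ n)^-1 * lweight R b n x = \prod_(i < n) (Wt R b (posn x n i) / pi).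
  by rewrite big_split/= prodr_const card_ord exprVn mulrC.
rewrite -det_scale_row; congr (\det _); apply/matrixP => i j; rewrite !mxE.
by rewrite fcoef_mom.
Qed.

Lemma phit0 (E : R -> R) : (fun x : R => E x * phit 0 x) = E.
Proof. by apply/funext => x; rewrite /phit mul0r expR0 mulr1. Qed.

Lemma Pmeas_top E k s : size s = k.+1 ->
  Pmeas E (lvn k) (lvb k) s = Ptop E (lvn k) (lvb k) (last [::] s) * linkprod R k.+1 s.
Proof.
move=> ss; have nE : nlev (lvn k) (lvb k) = k.+1 by rewrite -[RHS]nlev_stage /= negbK.
by rewrite /Pmeas nE -nth_last ss.
Qed.

Lemma hassum_Amat E k (t : R) mu : C1on11 E -> 0 <= t -> pathb k.+1 mu ->
  hassum [set s | pathb k.+1 s]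
    (fun lam => Pmeas E (lvn k) (lvb k) lam * Amat (phit t) (lvn k) (lvb k) lam mu)
    (Pmeas (fun x : R => E x * phit t x) (lvn k) (lvb k) mu).
Proof.
move=> cE t0 pmu; have nE : nlev (lvn k) (lvb k) = k.+1 by rewrite -[RHS]nlev_stage /= negbK.
have lE s : pathb k.+1 s -> nth [::] s k = last [::] s.
  by move=> /pathb_size ss; rewrite -nth_last ss.
have plast s : pathb k.+1 s -> part (lvn k) (last [::] s) by move=> /pathb_last.
set y := last [::] mu; have py : part (lvn k) y by exact: plast.
have gc j := @gmom_cont E (lvn k) j cE.
pose c := Pconst E (lvn k) (lvb k) * dimSO R (lvb k) (lvn k) y * linkprod R k.+1 mu.
(* The sum over the top level alone, with T and the links of [mu] in place of the sum over a
   fibre. *)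
have H1 : hassum [set x | part (lvn k) x]
    (fun x => Ptop E (lvn k) (lvb k) x * (Tlev (phit t) k x y * linkprod R k.+1 mu))
    (c * topmass (lvb k) (@gmom E (lvn k)) t y).
  apply: (hassumZ (topmass_evolves (lvb k) gc t0 py)) => x /= px.
  have dx := dimSO_gt0 R (lvb k) px.
  rewrite -[in LHS](phit0 E) Ptop_topmass// TlevE /c; field.
  by rewrite gt_eqF.
have -> : Pmeas (fun x : R => E x * phit t x) (lvn k) (lvb k) mu =
    c * topmass (lvb k) (@gmom E (lvn k)) t y.
  by rewrite Pmeas_top ?(pathb_size pmu)// Ptop_topmass// /c; ring.
have := @hassum_fiber R _ _ [set s | pathb k.+1 s] [set x | part (lvn k) x] (last [::])
   (fibp k) (Ptop E (lvn k) (lvb k)) _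
   (fun lam => linkprod R k.+1 lam * Aprod t k.+1 lam mu) _ _ _ _ _ _ H1.
move=> H2; rewrite -[X in hassum _ _ X]mul1r.
apply: (hassumZ (H2 _ _ _ _ _)) => /=.
- by move=> l; exact: plast.
- by move=> l pl; exact: linkAprod_ge0.
- by move=> x; exact: fibp_uniq.
- move=> x l px; rewrite mem_fibp//; apply/andP/asboolP => -[h1 h2]; split => //.
    exact/eqP.
  exact/eqP.
- move=> x px; rewrite sum_fibp ?lE// => j jk; exact: (pathb_part pmu).
- by move=> l pl; rewrite mul1r Pmeas_top ?(pathb_size pl)// Amat_prod nE mulrA.
Qed.

(** The dimension ratios telescope down to the first level, where the dimension is an empty product;
    the indicators equal 1 on arrays. *)
Lemma linkprodE k s : pathb k.+1 s -> linkprod R k.+1 s =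
  \prod_(j < k) lweight R (lvb j) (lvn j) (nth [::] s j) / dimSO R (lvb k) (lvn k) (nth [::] s k).
Proof.
move=> ps; suff H j : (j <= k)%N -> linkprod R j.+1 s =
  \prod_(i < j) lweight R (lvb i) (lvn i) (nth [::] s i) / dimSO R (lvb j) (lvn j) (nth [::] s j).
  exact: H.
elim: j => [_|j IH jk].
  rewrite /linkprod big_geq// big_ord0 /dimSO /lvb /lvn /= /dimD big_ord1 big_ord1_cond /=.
  by rewrite invr1 mulr1.
have pj : part (lvn j) (nth [::] s j) by apply: (pathb_part ps); exact: ltnW.
have pj1 : part (lvn j.+1) (nth [::] s j.+1) by exact: (pathb_part ps).
have ilj : il (nth [::] s j) (nth [::] s j.+1).
  by case/andP: ps => _ /allP /(_ j.+1); rewrite mem_iota => /(_ jk)/andP[].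
rewrite /linkprod (big_nat_recr j.+1)//= -/(linkprod R j.+1 s) IH ?(ltnW jk)// LamE// ilj.
rewrite big_ord_recr/= mulr1; field.
by rewrite !gt_eqF// dimSO_gt0.
Qed.

(** The dimension in [Ptop] cancels the one in [linkprodE]. What remains is a function of the top
    level times [pweight], the form [path_generator] handles. *)
Lemma Pmeas_path E (t : R) k s : pathb k.+1 s ->
  Pmeas (fun x : R => E x * phit t x) (lvn k) (lvb k) s =
  Pconst E (lvn k) (lvb k) * (phdet (lvb k) (@gmom E (lvn k)) t (last [::] s) * pweight R k.+1 s).
Proof.
move=> ps; have ss := pathb_size ps; have pl : part (lvn k) (last [::] s) := pathb_last ps.
rewrite Pmeas_top// Ptop_topmass// linkprodE// /pweight big_ord_recr/= /topmass.
have -> : nth [::] s k = last [::] s by rewrite -nth_last ss.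
field; by rewrite gt_eqF// dimSO_gt0.
Qed.

End AHassum.

(** * The forward equation on arrays *)

Section QHassum.
Variable R : realType.
Variable M : nat.
Local Notation n := (uphalf M).
Local Notation b := (~~ odd M).

Definition nbp (s : seq (seq nat)) := [seq r <- nbs s | pathb M r].

Definition pathQ (x y : seq (seq nat)) : R := if pathb M x && pathb M y then sQ R M x y else 0.

Definition pathdeg : R := \prod_(k < M) 3 ^+ lvn k.

Lemma pathdeg_ge1 : 1 <= pathdeg.
Proof.
rewrite /pathdeg; elim/big_ind: _ => // [x y x1 y1|i _].
  by rewrite (le_trans x1)// ler_peMr// (le_trans _ x1).
by rewrite exprn_ege1// ler1n.
Qed.

Lemma pathdeg_ge0 : 0 <= pathdeg.
Proof. exact: le_trans pathdeg_ge1. Qed.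

Lemma size_nbs s : pathb M s -> (size (nbs s))%:R <= pathdeg.
Proof.
move=> ps; rewrite /nbs size_prodl big_map (big_nth [::]) (pathb_size ps) big_mkord.
rewrite natr_prod /pathdeg; apply: ler_prod => k _.
rewrite ler0n -natrX ler_nat (leq_trans (size_nbl _))//.
by have [-> _] := partP _ _ (pathb_part ps (ltn_ord k)).
Qed.

Lemma size_nbp s : pathb M s -> (size (nbp s))%:R <= pathdeg.
Proof.
move=> ps; apply: le_trans (size_nbs ps).
by rewrite ler_nat size_filter count_size.
Qed.

Lemma Qoff_itv N a (x y : seq (seq nat)) : 0 <= Qoff R N a x y <= 1.
Proof. by rewrite /Qoff; case: ifP => _; [|case: ifP => _]; apply/andP; split; lra. Qed.

Lemma pathQ_le x y : `|pathQ x y| <= pathdeg.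
Proof.
rewrite /pathQ; case: ifP => [/andP[px py]|_]; last by rewrite normr0 pathdeg_ge0.
have [<-|xy] := eqVneq x y; last first.
  rewrite sQ_off// /sQoff; have /andP[h1 h2] := Qoff_itv n b x y.
  by rewrite ger0_norm// (le_trans h2)// pathdeg_ge1.
rewrite sQ_diag// normrN; apply: le_trans (size_nbs px).
have h z : 0 <= sQoff R M x z <= 1 by exact: Qoff_itv.
rewrite ger0_norm; last by apply: sumr_ge0 => z _; case/andP: (h z).
rewrite -sum1_size natr_sum big_mkcond; apply: ler_sum => z _.
by case: ifP => _ //; case/andP: (h z).
Qed.

Lemma mem_nbp x y : (y \in nbp x) = pathb M y && (y \in nbs x).
Proof. by rewrite mem_filter. Qed.

Lemma nbp_uniq x : uniq (nbp x).
Proof. by apply: filter_uniq; exact: nbs_uniq. Qed.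

(** The top level suffices: [pathmass] is a function of it times the bounded [pweight], and a jump
    of the array moves it by at most one step per entry. *)
Definition prho (s : seq (seq nat)) : R := rho n 3 (last [::] s).

Definition prate : R := pathdeg * (pathdeg * 3 ^+ n).

Lemma prate_ge0 : 0 <= prate.
Proof. by rewrite !mulr_ge0 ?pathdeg_ge0 ?exprn_ge0. Qed.

Lemma prho_gt0 s : 0 < prho s.
Proof. by apply: rho_gt0; rewrite ltr0n. Qed.

Lemma pathQ_col y : \sum_(x <- nbp y) `|pathQ x y| * prho x <= prate * prho y.
Proof.
have [py|npy] := boolP (pathb M y); last first.
  rewrite big1 => [|x _]; first by rewrite mulr_ge0 ?prate_ge0// ltW// prho_gt0.
  by rewrite /pathQ (negbTE npy) andbF normr0 mul0r.
apply: (@le_trans _ _ (\sum_(x <- nbp y) pathdeg * (3 ^+ n * prho y))).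
  rewrite big_seq [leRHS]big_seq; apply: ler_sum => x; rewrite mem_nbp => /andP[px xy].
  rewrite ler_pM ?pathQ_le ?(ltW (prho_gt0 _))//; apply: rho_nbl.
  - by rewrite ler1n.
  - by have [] := partP _ _ (pathb_last py).
  - exact: nbs_last.
rewrite big_const_seq count_predT iter_addr addr0 -[leLHS]mulr_natl /prate -!mulrA.
by rewrite ler_wpM2r ?size_nbp// !mulr_ge0 ?pathdeg_ge0 ?exprn_ge0 ?(ltW (prho_gt0 _)).
Qed.

(** With the constant weight 1 the rows are bounded too. This controls the entries of the powers of
    Q and makes the series defining [expQ] converge. *)
Lemma pathQ_row x : \sum_(y <- nbp x) `|pathQ x y| * 1 <= pathdeg ^+ 2 * 1.
Proof.
rewrite mulr1; have [px|npx] := boolP (pathb M x); last first.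
  by rewrite big1 ?(exprn_ge0 _ pathdeg_ge0)// => y _; rewrite /pathQ (negbTE npx) normr0 mul0r.
apply: (@le_trans _ _ (\sum_(y <- nbp x) pathdeg)).
  by apply: ler_sum => y _; rewrite mulr1 pathQ_le.
rewrite big_const_seq count_predT iter_addr addr0 -[leLHS]mulr_natl expr2.
by rewrite ler_wpM2r ?size_nbp ?pathdeg_ge0.
Qed.

Lemma Qpow_finpow k x y : pathb M x -> pathb M y ->
  Qpow R n b k x y = finpow pathQ nbp k x y.
Proof.
elim: k x => [//|k IH] x px py.
rewrite /finpow /= -/(finpow pathQ nbp k _ y) (@rsum_list _ _ _ _ (nbs x)); last 2 first.
- exact: nbs_uniq.
- move=> z /JN_pathb pz; rewrite mulf_eq0 negb_or => /andP[q0 _].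
  exact: (sQ_supp px pz q0).
rewrite /finop big_filter; apply: eq_big => [z|z /asboolP/JN_pathb pz].
  by apply/asboolP/idP => /JN_pathb.
by rewrite IH// /pathQ px pz.
Qed.

Lemma expQ_series (t : R) x y : 0 <= t -> pathb M x -> pathb M y ->
  series (fun k => t ^+ k / k`!%:R * finpow pathQ nbp k x y) @ \oo --> expQ n b t x y.
Proof.
move=> t0 px py.
rewrite /expQ (_ : (fun k => _ * Qpow R n b k x y) =
   (fun k => t ^+ k / k`!%:R * finpow pathQ nbp k x y)); last first.
  by apply/funext => k; rewrite Qpow_finpow.
have B k z : `|finpow pathQ nbp k z y| <= (pathdeg ^+ 2) ^+ k * 1.
  elim: k z => [|k IH] z; first by rewrite /finpow/= expr0 mulr1; case: eqP; rewrite ?normr1 ?normr0.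
  by rewrite exprSr; apply: (finop_bound (fun=> ler01) pathQ_row IH).
apply: normed_cvg; apply: (series_le_cvg (v_ := exp_coeff (t * pathdeg ^+ 2))) => [k|k|k|].
- exact: normr_ge0.
- by rewrite /exp_coeff/= divr_ge0// exprn_ge0// mulr_ge0 ?exprn_ge0 ?pathdeg_ge0.
- rewrite /= normrM ger0_norm ?divr_ge0 ?exprn_ge0// /exp_coeff/= exprMn.
  rewrite mulrAC ler_wpM2r ?invr_ge0// ler_wpM2l ?exprn_ge0//.
  by have := B k x; rewrite mulr1.
- exact: is_cvg_series_exp_coeff.
Qed.

Variable g : 'I_n -> R -> R.
Hypothesis cg : forall j, cont11 (g j).

Definition pathmass (t : R) (s : seq (seq nat)) : R :=
  if pathb M s then phdet b g t (last [::] s) * pweight R M s else 0.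

(** The forward equation: [path_generator] with [V] the moment determinant at time t. *)
Lemma is_derive_pathmass (t : R) s :
  is_derive t 1 (fun u => pathmass u s) (finop (fun y x => pathQ x y) nbp (pathmass t) s).
Proof.
rewrite /pathmass /finop /pathQ; case ps : (pathb M s); last first.
  by rewrite big1 => [|x _]; [exact: is_derive_cst|rewrite andbF mul0r].
have H := is_derive_cM (pweight R M s) (is_derive_phdet b t (last [::] s) cg).
under eq_fun do rewrite mulrC.
apply: (is_derive_eq H); rewrite big_filter.
transitivity (\sum_(x <- nbs s | pathb M x) phdet b g t (last [::] x) * pweight R M x * sQ R M x s).
  rewrite path_generator//; congr (_ * _); rewrite /finop big_filter.
  by apply: eq_bigr => z pz; rewrite /pgen (pathb_last ps) pz.
by apply: eq_bigr => x px; rewrite px mulrC.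
Qed.

Lemma pathmass_bound : exists2 C, 0 <= C &
  forall t s, 0 <= t -> `|pathmass t s| <= C * prho s.
Proof.
have [C C0 HC] := phdet_bound b (lexx 3) cg.
have D0 : 0 <= \prod_(k < M) (2 ^+ lvn k : R) by apply: prodr_ge0 => k _; exact: exprn_ge0.
exists (C * \prod_(k < M) 2 ^+ lvn k); first by rewrite mulr_ge0.
move=> t s t0; rewrite /pathmass; case: ifP => ps; last first.
  by rewrite normr0 !mulr_ge0// ltW// prho_gt0.
rewrite normrM mulrAC ler_pM ?HC// ger0_norm ?(ltW (pweight_gt0 _ _ _))//.
by apply: ler_prod => k _; rewrite lweight_le (ltW (lweight_gt0 _ _ _ _)).
Qed.

Lemma hassum_expQ (t : R) y : 0 <= t -> pathb M y ->
  hassum [set s | pathb M s] (fun x => pathmass 0 x * expQ n b t x y) (pathmass t y).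
Proof.
move=> t0 py; have [C C0 HC] := pathmass_bound.
have rho0 s : 0 <= prho s by rewrite ltW// prho_gt0.
have tt : 0 <= t <= t by rewrite t0 lexx.
apply: (@hassum_exp _ _ _ pathQ nbp prho prate rho0 prate_ge0 nbp_uniq _ _ _ _ _ _ y C t) => //=.
- by move=> x z _; rewrite mem_nbp => /andP[].
- by move=> x z px pz; rewrite !mem_nbp px pz /= nbs_sym.
- move=> x z px pz; rewrite /pathQ px pz mem_nbp pz /=; exact: sQ_supp.
- by move=> z _; exact: pathQ_col.
- by move=> x _; exact: HC.
- by move=> x px; exact: expQ_series.
- exact: (finop_taylor rho0 pathQ_col is_derive_pathmass
    (fun s z (sT : 0 <= s <= t) => HC s z (proj1 (andP sT))) tt).
Qed.

End QHassum.

Unset Implicit Arguments.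

Theorem theorem3p12 (R : realType) (N : nat) (a : bool) (E : R -> R) (t : R) :
  (1 <= N)%N -> C1on11 E -> E 1 != 0 -> 0 <= t ->
  forall mu : seq (seq nat), JN N a mu ->
    summable (JN N a) (fun lam => (Pmeas E N a lam * expQ N a t lam mu)%:E) /\
    summable (JN N a) (fun lam => (Pmeas E N a lam * Amat (phit t) N a lam mu)%:E) /\
    rsum (JN N a) (fun lam => Pmeas E N a lam * expQ N a t lam mu)
    = rsum (JN N a) (fun lam => Pmeas E N a lam * Amat (phit t) N a lam mu).
Proof.
move=> N0 cE _ t0 mu.
(* [k] is the zero-based index of the top level, so the arrays have k + 1 levels. *)
have [k [<- <-]] : exists k, lvn k = N /\ lvb k = a.
  have [nN na] := stage_nlev a N0; have M0 : (0 < nlev N a)%N by rewrite /nlev; case: (a); lia.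
  exists (nlev N a).-1; move: nN na; case: (nlev N a) M0 => // k _ /= <- <-.
  by rewrite negbK.
have eb : ~~ odd k.+1 = lvb k by rewrite /= negbK.
have JNE : JN (lvn k) (lvb k) = [set s | pathb k.+1 s].
  by rewrite -eb; apply/seteqP; split => s /JN_pathb.
rewrite JNE => pmu; have gc j := @gmom_cont R E (lvn k) j cE.
have HA := hassum_Amat cE t0 pmu.
have HQ : hassum [set s | pathb k.+1 s]
    (fun lam => Pmeas E (lvn k) (lvb k) lam * expQ (lvn k) (lvb k) t lam mu)
    (Pmeas (fun x : R => E x * phit t x) (lvn k) (lvb k) mu).
  have := @hassum_expQ R k.+1 (@gmom R E (lvn k)) gc t mu t0 pmu.
  rewrite Pmeas_path// /pathmass pmu eb => H; apply: (hassumZ H) => x /= px.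
  by rewrite px -[in LHS](phit0 E) Pmeas_path// -[LHS]mulrA.
have [sQ eQ] := hassum_rsum HQ; have [sA eA] := hassum_rsum HA.
by rewrite eQ eA.
Qed.
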